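(* Consider the principal–agent game described in the context, under the standing assumptions (A1) and (A2). Let $$u_P^N=\int_0^{\tau_P}e^{-\rho s}g(s)(\mu+(1-\mu)\theta)\,ds+e^{-\rho\tau_P}(1-G(\tau_P))((1-\sigma)\theta+\sigma\mu)=u_P^{FB}(\tau_P)-e^{-\rho\tau_P}(1-G(\tau_P))\,\sigma\,(\theta-\mu)$$ be the principal's payoff from commitment to naive search. If the prior probability $\sigma$ of the manipulative agent is not too high, then the principal's payoff with a commitment to naive search is higher than her equilibrium payoff in the game (without commitment). Specifically: (1) if $\sigma<\bar\sigma$, then commitment to naive search delivers a higher payoff to the principal than the unique equilibrium of the game without commitment, which has beneficial search; (2) for some $\widetilde\sigma_N$ with $\bar\sigma<\widetilde\sigma_N\le 1$, if $\sigma\in(\bar\sigma,\widetilde\sigma_N)$, then commitment to naive search delivers a higher payoff to the principal than any equilibrium of the game without commitment, all of which feature non-beneficial search.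
   Context: Parameters and primitives. $\theta\in(0,1)$, $\beta\in(0,\theta)$, $\beta<\mu<\theta$, discount rate $\rho>0$, $\sigma\in(0,1)$. $G$ is a continuous CDF supported on $[0,\infty)$ with density $g$ and decreasing hazard rate $H_R(t)=g(t)/(1-G(t))$; $H_R(\infty)=\lim_{t\to\infty}H_R(t)$. Let $\phi_P=\frac{\rho\theta}{\mu(1-\theta)}$, $\phi_A=\frac{\rho\mu}{\beta(1-\mu)}$. Standing assumptions: (A1) $H_R(0)>\phi_P>H_R(\infty)$; (A2) $\phi_P>\phi_A$. $\tau_P\in(0,\infty)$ is the unique value with $H_R(\tau_P)=\phi_P$. Let $$\bar\sigma=1-\exp\Big\{-\int_0^{\tau_P}\frac{\mu(1-\theta)H_R(s)-\rho\theta}{\theta-\mu}ds\Big\}.$$ First-best payoff. $u_P^{FB}(t)=\int_0^t e^{-\rho x}g(x)(\mu+(1-\mu)\theta)dx+e^{-\rho t}(1-G(t))\theta$. Interpretation. The risky action pays both players $\omega\in\{0,1\}$ with $\Pr(\omega=1)=\mu$; the safe action pays the principal $\theta$ and the agent $\beta$. Real news, revealing $\omega$ (''type-$\omega$ news''), arrives at a time with CDF $G$ independent of $\omega$. With probability $\sigma$ the agent is manipulative and can fake type-1 news at a time of his choice. The principal stops and chooses safe at a chosen time if no news has arrived; she chooses safe after type-0 news and, after type-1 news at time $t$, chooses risky with probability $a(t)$. Under commitment to naive search the principal waits until $\tau_P$ and acts on all news arriving at or before $\tau_P$ (safe after type-0, risky after type-1), choosing safe if none arrives; the manipulative agent then fakes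 exactly at $\tau_P$, which gives $u_P^N$. Strategies. For $i\in\{A,P\}$, the agent's faking time ($i=A$) and the principal's stopping time ($i=P$) are drawn from a probability measure on $[0,\infty]$ with $F_i(t)=\int_0^t f_i^*(s)\,ds+\sum_{m:\,t_m\le t}f_m$ for $t<\infty$, where $f_i^*\ge0$ is the density of the absolutely continuous part, $\{t_m\}$ is a countable set of atoms with probabilities $f_m>0$, and any remaining mass sits at $\infty$ (never). Write $f_i=f_i^*+\sum_m f_m\delta_{t_m}$; integrals over $[0,t]$ include atoms at the endpoints. ''$f_i(t)>0$'' means $f_i^*(t)>0$ or $t$ is an atom. The principal also chooses $a:[0,\infty)\to[0,1]$. Principal's payoff. $w_0^P(s)=(1-\mu)g(s)(1-\sigma F_A(s))$, $w_1^P(s)=\mu g(s)(1-\sigma F_A(s))+\sigma f_A(s)(1-G(s))$, $W^P_\phi(t)=(1-G(t))(1-\sigma F_A(t))$, and $$\mu_1(s)=\frac{\mu g(s)(1-\sigma F_A(s))+\mu\sigma f_A(s)(1-G(s))}{\mu g(s)(1-\sigma F_A(s))+\sigma f_A(s)(1-G(s))}$$ (so $\mu_1(s)=\mu$ at an atom $s$ of $F_A$). Then $$u_P(t)=\int_0^t e^{-\rho s}\{w_0^P(s)\theta+w_1^P(s)((1-a(s))\theta+a(s)\mu_1(s))\}ds+e^{-\rho t}W^P_\phi(t)\theta .$$ Agent's payoff. $w_0^A(s)=(1-\mu)g(s)(1-F_P(s))$, $w_1^A(s)=\mu g(s)(1-F_P(s))$, $w_S^A(s)=f_P(s)(1-G(s))$,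 $W^A_\phi(t)=(1-G(t))(1-F_P(t))$, and $$u_A(t)=\int_0^t e^{-\rho s}\{w_0^A(s)\beta+w_1^A(s)((1-a(s))\beta+a(s))+w_S^A(s)\beta\}ds+e^{-\rho t}W^A_\phi(t)((1-a(t))\beta+\mu a(t)).$$ At $t=\infty$ the last term of $u_P$ and $u_A$ is $0$. Equilibrium. $(a,F_P,F_A)$ is an equilibrium iff: (AIC) $f_A(t)>0\Rightarrow u_A(t)\ge u_A(t')$ for all $t,t'$; (PICa) for all $t\ge0$, $a(t)=1$ if $\mu_1(t)>\theta$, $a(t)\in[0,1]$ if $\mu_1(t)=\theta$, $a(t)=0$ if $\mu_1(t)<\theta$; (PICt) $f_P(t)>0\Rightarrow u_P(t)\ge u_P(t')$ for all $t,t'$. The principal's equilibrium payoff is the expectation of $u_P$ under $F_P$; the equilibrium has beneficial search if this payoff exceeds $\theta$, and non-beneficial search otherwise.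
   Formalization: In (1), ''the unique equilibrium'' is false as defined: non-beneficial equilibria where the principal stops at time 0 for sure can coexist. Uniqueness is proved apart from these; the payoff comparison covers every equilibrium. *)

(* Defs.v *)
From HB Require Import structures.
From mathcomp Require Import all_boot all_order all_algebra.
From mathcomp Require Import all_classical all_reals all_analysis.
Set Implicit Arguments.
Unset Strict Implicit.
Unset Printing Implicit Defensive.
Import Order.TTheory GRing.Theory Num.Theory.
Import numFieldNormedType.Exports.
Local Open Scope classical_set_scope.
Local Open Scope ring_scope.

(* theta, beta : safe payoffs of the principal and of the agent; mu : prior
   probability of the good state; rho : discount rate; G, g : CDF and density of
   the arrival time of real news.  The probability sigma of the manipulative
   agent is kept separate because the results compare games across sigma. *)
Record primitives (R : realType) := Primitives {
  theta : R; beta : R; mu : R; rho : R; G : R -> R; g : R -> R }.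

Section Primitives.
Context {R : realType} (p : primitives R).
Local Notation leb := (@lebesgue_measure R).

Definition hazard (t : R) : R := g p t / (1 - G p t).

Definition phiP : R := rho p * theta p / (mu p * (1 - theta p)).
Definition phiA : R := rho p * mu p / (beta p * (1 - mu p)).

(* "Supported on [0, oo)" means that G vanishes on the nonpositive half-line
   and stays below 1.  "Decreasing" is the weak notion, which covers both
   usages; g need not be continuous. *)
Record news_distribution : Prop := NewsDistribution {
  G_continuous : continuous (G p);
  G_nondecreasing : {homo G p : s t / s <= t};
  G_le0 : forall t, t <= 0 -> G p t = 0;
  G_lt1 : forall t, G p t < 1;
  G_cvg1 : G p t @[t --> +oo] --> (1 : R);
  g_measurable : measurable_fun (`[0, +oo[ : set R) (g p);
  g_ge0 : forall t, 0 <= t -> 0 <= g p t;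
  G_density : forall t : R, 0 <= t ->
    (G p t)%:E = (\int[leb]_(s in `[0%R, t]) (g p s)%:E)%E;
  hazard_decreasing : forall s t, 0 <= s -> s <= t -> hazard t <= hazard s }.

Definition is_tauP (tau : R) : Prop :=
  [/\ 0 < tau, hazard tau = phiP &
      forall t, 0 <= t -> hazard t = phiP -> t = tau].

Definition sigmabar (tau : R) : R :=
  1 - expR (- \int[leb]_(s in `[0, tau])
                ((mu p * (1 - theta p) * hazard s - rho p * theta p)
                   / (theta p - mu p))).

Definition uFB (t : R) : R :=
  \int[leb]_(x in `[0, t])
    (expR (- rho p * x) * g p x * (mu p + (1 - mu p) * theta p))
  + expR (- rho p * t) * (1 - G p t) * theta p.

Definition uN (sigma tau : R) : R :=
  \int[leb]_(s in `[0, tau])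
    (expR (- rho p * s) * g p s * (mu p + (1 - mu p) * theta p))
  + expR (- rho p * tau) * (1 - G p tau)
    * ((1 - sigma) * theta p + sigma * mu p).

End Primitives.

(* A probability measure on [0, oo] without singular continuous part: [dens] is
   the density of its absolutely continuous part, [atom t] the mass of {t} for
   finite t, and the remaining mass [never] sits at oo.  The version of the
   density is part of the data, because the equilibrium conditions refer to its
   pointwise values. *)
Record timing (R : realType) := Timing {
  dens : R -> R;
  atom : R -> R;
  dens_measurable : measurable_fun (`[0, +oo[ : set R) dens;
  dens_ge0 : forall t, 0 <= t -> 0 <= dens t;
  atom_ge0 : forall t, 0 <= atom t;
  atom_countable : countable [set t | 0 < atom t];
  atom_neg : forall t, t < 0 -> atom t = 0;
  timing_mass :
    (\int[@lebesgue_measure R]_(s in `[0%R, +oo[) (dens s)%:E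
     + \esum_(s in `[0%R, +oo[) (atom s)%:E <= 1)%E }.

Record acceptance (R : realType) := Acceptance {
  acc :> R -> R;
  acc_measurable : measurable_fun (`[0, +oo[ : set R) acc;
  acc_itv : forall t, 0 <= t -> 0 <= acc t <= 1 }.

Section Timing.
Context {R : realType} (F : timing R).

(* The integral of h * f over A, atoms included.  It is only used with h
   nonnegative on A, as the unordered sum [esum] requires. *)
Definition tint (A : set R) (h : R -> R) : R :=
  \int[@lebesgue_measure R]_(s in A) (h s * dens F s)
  + fine (\esum_(s in A) (h s * atom F s)%:E).

Definition cdf (t : R) : R := tint `[0, t] (fun=> 1).

Definition never : R := 1 - tint `[0, +oo[ (fun=> 1).

(* "f(t) > 0", for t in [0, oo] *)
Definition active (t : \bar R) : Prop :=
  match t with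
  | t%:E => 0 < dens F t \/ 0 < atom F t
  | +oo%E => 0 < never
  | -oo%E => False
  end.

End Timing.

(* Payoffs from stopping or faking at t in [0, oo] integrate over the finite
   times s with 0 <= s <= t. *)
Definition upto (R : realType) (t : \bar R) : set R :=
  [set s : R | 0 <= s /\ (s%:E <= t)%E].

Section Game.
Context {R : realType} (p : primitives R) (sigma : R).
Context (a : acceptance R) (FP FA : timing R).
Local Notation leb := (@lebesgue_measure R).

Definition mu1 (s : R) : R :=
  let real := mu p * g p s * (1 - sigma * cdf FA s) in
  let fake := sigma * dens FA s * (1 - G p s) in
  if 0 < atom FA s then mu p else (real + mu p * fake) / (real + fake).

(* The principal's expected payoff from type-1 news at s. *)
Definition newsP (s : R) : R := (1 - a s) * theta p + a s * mu1 s.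

(* w_1^P mixes a density (real news) and the measure f_A (fake news); the two
   parts are integrated separately. *)
Definition uP (t : \bar R) : R :=
  \int[leb]_(s in upto t)
    (expR (- rho p * s)
     * ((1 - mu p) * g p s * (1 - sigma * cdf FA s) * theta p
        + mu p * g p s * (1 - sigma * cdf FA s) * newsP s))
  + tint FA (upto t)
      (fun s => expR (- rho p * s) * (sigma * (1 - G p s) * newsP s))
  + (if t is t%:E then
       expR (- rho p * t) * ((1 - G p t) * (1 - sigma * cdf FA t)) * theta p
     else 0).

Definition uA (t : \bar R) : R :=
  \int[leb]_(s in upto t)
    (expR (- rho p * s)
     * ((1 - mu p) * g p s * (1 - cdf FP s) * beta p
        + mu p * g p s * (1 - cdf FP s) * ((1 - a s) * beta p + a s)))
  + tint FP (upto t) (fun s => expR (- rho p * s) * ((1 - G p s) * beta p))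
  + (if t is t%:E then
       expR (- rho p * t) * ((1 - G p t) * (1 - cdf FP t))
       * ((1 - a t) * beta p + mu p * a t)
     else 0).

(* At mu1 t = theta, only a t in [0, 1] is required, which is [acc_itv]. *)
Record equilibrium : Prop := Equilibrium {
  AIC : forall t t' : \bar R, (0 <= t)%E -> (0 <= t')%E ->
    active FA t -> uA t' <= uA t;
  PICa : forall t : R, 0 <= t ->
    (theta p < mu1 t -> a t = 1) /\ (mu1 t < theta p -> a t = 0);
  PICt : forall t t' : \bar R, (0 <= t)%E -> (0 <= t')%E ->
    active FP t -> uP t' <= uP t }.

Definition payoffP : R :=
  tint FP `[0, +oo[ (fun t => uP t%:E) + never FP * uP +oo%E.

Definition beneficial : Prop := theta p < payoffP.

End Game.

(* Acceptance rules and distributions are compared on [0, oo); equality of the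
   CDFs identifies different versions of the same density. *)
Definition same_profile (R : realType) (a : acceptance R) (FP FA : timing R)
    (a' : acceptance R) (FP' FA' : timing R) : Prop :=
  forall t : R, 0 <= t ->
    [/\ a t = a' t, cdf FP t = cdf FP' t & cdf FA t = cdf FA' t].

(* The principal stops at time 0 with probability one.  The agent is then
   indifferent between all faking times, so that such profiles can be
   equilibria next to one with beneficial search. *)
Definition no_search (R : realType) (FP : timing R) : Prop := cdf FP 0 = 1.

(* Main.v *)
(* Integrating by parts, both payoffs become integrals of explicit rates.  With
   Q = 1 - sigma F_A, phi t = e^(-rho t) (1 - G t), the faking hazard
   k = sigma f_A / Q and K = (mu (1 - theta) H_R - rho theta) / (theta - mu),
   the payoff u_P grows at the rate (theta - mu) phi Q (K - k) while all news is
   accepted.  Take an equilibrium in which the principal does not stop at 0 for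
   sure.  All type-1 news before her last stopping time is accepted, nobody fakes
   after that time, and that time is tau_P.  While the principal does not stop,
   the agent prefers to wait, so u_P increases strictly; hence the times at which
   u_P is maximal form an interval [s, tau_P], there is no activity before s, and
   k = K on [s, tau_P].  As the agent surely fakes by tau_P, the integral A of K
   over [s, tau_P] satisfies 1 - sigma = e^(-A).  This determines s, and has no
   solution if sigma > sigmabar; the agent's indifference on [s, tau_P[ then
   determines F_P.  The equilibrium payoff is theta plus (theta - mu) times the
   integral of phi K over [0, s]; naive search yields the same with s = tau_P,
   less (theta - mu) phi(tau_P) sigma.  Since phi decreases, the integral of
   phi K over [s, tau_P] is at least phi(tau_P) A > phi(tau_P) (1 - e^(-A))
   = phi(tau_P) sigma.  With s = 0 this is a strict inequality
   at sigma = sigmabar, whence part (2). *)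
Require Import Defs.
From mathcomp Require Import all_boot all_order all_algebra.
From mathcomp Require Import all_classical all_reals all_analysis.
From mathcomp Require Import measurable_realfun ring lra.
Set Implicit Arguments.
Unset Strict Implicit.
Unset Printing Implicit Defensive.
Import Order.TTheory GRing.Theory Num.Theory.
Import numFieldNormedType.Exports.
(* The probability library also exports a [cdf]. *)
Import Defs.
Local Open Scope classical_set_scope.
Local Open Scope ring_scope.

(** The equilibrium conditions speak only of active times, and both players may mix densities with
    atoms, so no payoff is smooth a priori. Regularity comes from the acceptance rule being a best
    reply: atoms of fake news earn nothing above theta, and a faking density is accepted only where
    real news is frequent enough for the belief to reach theta. Hence u_P has a rate bounded
    independently of f_A and is Lipschitz, although F_A need not be continuous. The agent's payoff
    is less regular: it is a Lipschitz flow plus a prize proportional to (1 - F_P) a, which inherits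
    the jumps of F_P and of the acceptance rule. Comparisons between nearby faking times therefore
    rest on right continuity, and indifference passes from active times to all times because active
    times accumulate. Indifference in turn yields regularity: once faking is known to be spread over
    [s, tau_P], constancy of the agent's payoff writes e^(-rho t) (1 - G) (1 - F_P) as a Lipschitz
    function, so that F_P has no atom inside and solves a linear equation. The existence part runs
    the same identities backwards. *)

(** * Integration on intervals *)

(* Replaces differentiation: the hazard rate is only monotone, so the primitives
   below need not be differentiable, but an increment of second order (or of
   order dt * dM, where M may jump) still forces D to be constant. *)
Lemma quadratic_cst (R : realType) (D M : R -> R) (a b C : R) :
  a <= b -> 0 <= C ->
  (forall s t, a <= s -> s <= t -> t <= b ->
     `|D t - D s| <= C * (t - s) * (M t - M s)) -> D b = D a.
Proof.
move=> ab C0 H.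
(* Over [n.+1] equal steps of length [h] the bounds telescope to [C * h * (M b - M a)], which is of
   order [1 / n.+1]. *)
have HN (n : nat) : `|D b - D a| * n.+1%:R <= C * (b - a) * (M b - M a).
  set h := (b - a) / n.+1%:R.
  have h0 : 0 <= h by rewrite divr_ge0 // subr_ge0.
  have nh : n.+1%:R * h = b - a by rewrite mulrCA divff ?pnatr_eq0 // mulr1.
  have hi i : (i <= n.+1)%N ->
      `|D (a + i%:R * h) - D a| <= C * h * (M (a + i%:R * h) - M a).
    elim: i => [|i IH] Hi; first by rewrite mul0r addr0 !subrr normr0 mulr0.
    have {}IH := IH (ltnW Hi).
    have ih0 : 0 <= i%:R * h by rewrite mulr_ge0.
    have e : i.+1%:R * h = i%:R * h + h by rewrite -addn1 natrD mulrDl mul1r.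
    have ib : i.+1%:R * h <= b - a.
      by rewrite -nh ler_wpM2r // ler_nat.
    have := H (a + i%:R * h) (a + i.+1%:R * h).
    rewrite e in ib *.
    rewrite (_ : a + (i%:R * h + h) - (a + i%:R * h) = h); last by lra.
    move=> /(_ ltac:(lra) ltac:(lra) ltac:(lra)) H1.
    rewrite (_ : D _ - D a = (D (a + (i%:R * h + h)) - D (a + i%:R * h))
      + (D (a + i%:R * h) - D a)); last by lra.
    apply: (le_trans (ler_normD _ _)); lra.
  have := hi n.+1 (leqnn _).
  rewrite nh (_ : a + (b - a) = b); last by lra.
  rewrite /h mulrA -[X in _ <= X -> _]mulrAC.
  by rewrite ler_pdivlMr // ltr0n.
apply/eqP; rewrite -subr_eq0 -normr_eq0; apply/negPn/negP => Dn0.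
have Dp : 0 < `|D b - D a| by rewrite lt_def Dn0 normr_ge0.
set K := C * (b - a) * (M b - M a) in HN.
have := HN (Num.bound `|K / `|D b - D a| |).
rewrite leNgt => /negP; apply.
rewrite -ltr_pdivrMl // mulrC.
apply: (le_lt_trans (ler_norm _)).
apply: (lt_trans (archi_boundP (normr_ge0 _))).
by rewrite ltr_nat.
Qed.

Section Interval.
Context {R : realType}.
Local Notation leb := (@lebesgue_measure R).
Implicit Types (a b s t C : R) (f g x y k X Y K : R -> R).

Definition itv_integrable a b f := leb.-integrable `[a, b] (EFin \o f).

Definition bounded_meas a b f := measurable_fun (`[a, b]%classic : set R) f /\
  exists C, forall u, a <= u <= b -> `|f u| <= C.

(** A Lipschitz function with a bounded version of its derivative. The version is part of the data
    because signs and formulas for rates are checked pointwise. *)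
Definition primitive a b X x := bounded_meas a b x /\
  forall s t, a <= s -> s <= t -> t <= b ->
    X t - X s = \int[leb]_(u in `[s, t]) x u.

Lemma itvccP s t (u : R) : (`[s, t]%classic : set R) u = (s <= u <= t).
Proof. by rewrite /= in_itv. Qed.

Lemma sub_itvcc a b s t : a <= s -> t <= b ->
  (`[s, t]%classic : set R) `<=` (`[a, b]%classic : set R).
Proof.
move=> sa tb u; rewrite !itvccP => /andP[su ut].
by rewrite (le_trans sa su) (le_trans ut tb).
Qed.

Lemma lint_sub a b s t f : a <= s -> t <= b -> itv_integrable a b f ->
  itv_integrable s t f.
Proof. by move=> sa tb; apply: integrableS => //; exact: sub_itvcc. Qed.

Lemma bm_sub a b s t f : a <= s -> t <= b -> bounded_meas a b f ->
  bounded_meas s t f.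
Proof.
move=> sa tb [mf [C Cf]]; split.
  by apply: measurable_funS mf => //; exact: sub_itvcc.
by exists C => u /andP[su ut]; rewrite Cf // (le_trans sa su) (le_trans ut tb).
Qed.

Lemma prim_sub a b s t X x : a <= s -> t <= b -> primitive a b X x ->
  primitive s t X x.
Proof.
move=> sa tb [xbm H]; split; first exact: bm_sub xbm.
by move=> u v su uv vt; apply: H => //; [exact: le_trans su | exact: le_trans tb].
Qed.

Lemma bm_lint a b f : bounded_meas a b f -> itv_integrable a b f.
Proof.
move=> [mf [C Cf]]; apply: measurable_bounded_integrable => //.
  by rewrite /= lebesgue_measure_itv /=; case: ifP => // _; rewrite -EFinD ltry.
exists C; split; first exact: num_real.
move=> M CM u /=; rewrite in_itv /= => uab.
by rewrite (le_trans (Cf _ uab)) // ltW.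
Qed.

Lemma eq_Iint s t f g : (forall u, s <= u <= t -> f u = g u) ->
  \int[leb]_(u in `[s, t]) f u = \int[leb]_(u in `[s, t]) g u.
Proof.
by move=> fg; apply: eq_Rintegral => u; rewrite inE /= in_itv /= => /fg.
Qed.

Lemma bm_eq a b f g : (forall u, a <= u <= b -> f u = g u) ->
  bounded_meas a b f -> bounded_meas a b g.
Proof.
move=> fg [mf [C Cf]]; split.
  apply: eq_measurable_fun mf => u; rewrite inE /= in_itv /=; exact: fg.
by exists C => u uab; rewrite -fg // Cf.
Qed.

Lemma bm_cst a b C : bounded_meas a b (fun=> C).
Proof. by split; [exact: measurable_cst | exists `|C|]. Qed.

Lemma bmD a b f g : bounded_meas a b f -> bounded_meas a b g ->
  bounded_meas a b (fun u => f u + g u).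
Proof.
move=> [mf [C Cf]] [mg [C' Cg]]; split; first exact: measurable_funD.
exists (C + C') => u uab; apply: le_trans (ler_normD _ _) _.
by rewrite lerD ?Cf ?Cg.
Qed.

Lemma bmM a b f g : bounded_meas a b f -> bounded_meas a b g ->
  bounded_meas a b (fun u => f u * g u).
Proof.
move=> [mf [C Cf]] [mg [C' Cg]]; split; first exact: measurable_funM.
exists (C * C') => u uab; rewrite normrM.
by rewrite ler_pM ?Cf ?Cg.
Qed.

Lemma bmN a b f : bounded_meas a b f -> bounded_meas a b (fun u => - f u).
Proof.
move=> [mf [C Cf]]; split; first by apply/measurable_funN.
by exists C => u uab; rewrite normrN Cf.
Qed.

Lemma bmB a b f g : bounded_meas a b f -> bounded_meas a b g ->
  bounded_meas a b (fun u => f u - g u).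
Proof. by move=> bf /bmN; exact: bmD. Qed.

Lemma bm_nondec a b f :
  (forall s t, a <= s -> s <= t -> t <= b -> f s <= f t) -> bounded_meas a b f.
Proof.
move=> fnd; split; last first.
  exists (`|f a| + `|f b|) => u /andP[au ub].
  have ab := le_trans au ub.
  have := fnd _ _ (lexx a) au ub; have := fnd _ _ au ub (lexx b).
  have := ler_norm (f b); have := ler_norm (- f a); rewrite normrN.
  have := normr_ge0 (f a); have := normr_ge0 (f b).
  by rewrite ler_norml; lra.
have [ab|ab] := leP a b; last first.
  by rewrite set_itv_ge ?bnd_simp -?ltNge //; exact: measurable_fun_set0.
(* Clamping to [[a, b]] extends [f] to a monotone function on the whole line. *)
pose cl u := Num.max a (Num.min b u).
apply: (@eq_measurable_fun _ _ _ _ _ (f \o cl)).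
  move=> u; rewrite inE /= in_itv /= => /andP[au ub].
  by rewrite /cl min_r // max_r.
apply: nondecreasing_measurable => // s t st /=; apply: fnd.
- by rewrite /cl le_max lexx.
- by rewrite /cl ge_max !le_max lexx /= le_min2 ?lexx ?orbT.
- by rewrite /cl ge_max ab /= ge_min lexx.
Qed.

Lemma bm_noninc a b f :
  (forall s t, a <= s -> s <= t -> t <= b -> f t <= f s) -> bounded_meas a b f.
Proof.
move=> H; apply: (@bm_eq _ _ (fun u => - - f u)); first by move=> u;
  rewrite opprK.
by apply/bmN/bm_nondec => s t sa st tb; rewrite lerN2 H.
Qed.

Lemma lint_split a b c f : a <= c -> c <= b -> itv_integrable a b f ->
  \int[leb]_(u in `[a, b]) f u =
  \int[leb]_(u in `[a, c]) f u + \int[leb]_(u in `[c, b]) f u.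
Proof.
move=> ac cb fl; rewrite -(Rintegral_itv_obnd_cbnd (r := c)); last first.
  apply: integrableS fl => // u /=; rewrite !in_itv /= => /andP[cu ->].
  by rewrite andbT ltW // (le_lt_trans ac).
by rewrite -(Rintegral_itvB (x := c) fl) ?bnd_simp // addrC subrK.
Qed.

Lemma Iint_set1 s f : \int[leb]_(u in `[s, s]) f u = 0.
Proof. by rewrite set_itv1 Rintegral_set1. Qed.

Lemma Iint_cst s t C : s <= t -> \int[leb]_(u in `[s, t]) C = C * (t - s).
Proof.
move=> st; rewrite Rintegral_cst //= lebesgue_measure_itv /= lte_fin.
by move: st; rewrite le_eqVlt => /predU1P[->|->] //=; rewrite ltxx subrr.
Qed.

Lemma Iint_le s t f g : itv_integrable s t f -> itv_integrable s t g ->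
  (forall u, s <= u <= t -> f u <= g u) ->
  \int[leb]_(u in `[s, t]) f u <= \int[leb]_(u in `[s, t]) g u.
Proof.
by move=> fl gl fg; apply: le_Rintegral => // u /=; rewrite in_itv /=; exact: fg.
Qed.

Lemma lint_cst s t C : itv_integrable s t (fun=> C).
Proof. exact/bm_lint/bm_cst. Qed.

Lemma Iint_norm_le s t f C : s <= t -> itv_integrable s t f ->
  (forall u, s <= u <= t -> `|f u| <= C) ->
  `|\int[leb]_(u in `[s, t]) f u| <= C * (t - s).
Proof.
move=> st fl fC; rewrite ler_norml -mulNr -!Iint_cst //.
apply/andP; split; apply: Iint_le => //; try exact: lint_cst;
  by move=> u /fC; rewrite ler_norml => /andP[].
Qed.

Lemma Iint_oo s t f : itv_integrable s t f ->
  \int[leb]_(u in `[s, t]) f u = \int[leb]_(u in `]s, t[) f u.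
Proof.
move=> fl.
have sub : (`]s, t[%classic : set R) `<=` `[s, t]%classic.
  by move=> u; rewrite /= !in_itv /= => /andP[/ltW -> /ltW ->].
have fl2 : leb.-integrable `[s, t[ (EFin \o f).
  apply: integrableS fl => // u; rewrite /= !in_itv /= => /andP[-> /ltW ->] //.
rewrite -Rintegral_itv_bndo_bndc // -Rintegral_itv_obnd_cbnd //.
by apply: integrableS fl2 => // u; rewrite /= !in_itv /= => /andP[/ltW -> ->].
Qed.

Lemma Iint_ge0 s t f : itv_integrable s t f -> (forall u, s < u < t ->
  0 <= f u) ->
  0 <= \int[leb]_(u in `[s, t]) f u.
Proof.
by move=> fl f0; rewrite Iint_oo //; apply: Rintegral_ge0 => u /=;
  rewrite in_itv; exact: f0.
Qed.

(** No positive lower bound on [f] is at hand. A zero integral would make [f] vanish almost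
    everywhere on []s, t[], which has positive measure. *)
Lemma Iint_gt0 s t f : s < t -> itv_integrable s t f ->
  (forall u, s < u < t -> 0 < f u) -> 0 < \int[leb]_(u in `[s, t]) f u.
Proof.
move=> st fl fp; rewrite lt_def Iint_ge0 ?andbT //; last first.
  by move=> u /fp /ltW.
rewrite Iint_oo //; apply/eqP => I0.
have flo : leb.-integrable `]s, t[ (EFin \o f).
  by apply: integrableS fl => // u; rewrite /= !in_itv /= => /andP[/ltW ->
    /ltW ->].
have mf : measurable_fun `]s, t[ (EFin \o f) by case/integrableP : flo.
have : (\int[leb]_(u in `]s, t[) `|(EFin \o f) u| = 0)%E.
  rewrite -[RHS]/(0%R)%:E -[in RHS]I0 /Rintegral fineK;
    last exact: integrable_fin_num.
  by apply: eq_integral => u; rewrite inE /= in_itv /= => /fp /ltW fu;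
    rewrite ger0_norm.
move/(ae_eq_integral_abs leb (measurable_itv _) mf) => -[N [mN N0 sub]].
have : (leb `]s, t[ <= leb N)%E.
  apply: le_measure; rewrite ?inE //= => u /= ust.
  apply: sub => /=; apply/not_implyP; split => //.
  move: ust; rewrite in_itv /= => ust.
  by move=> [fu0]; have := fp _ ust; rewrite fu0 ltxx.
by rewrite N0 lebesgue_measure_itv /= lte_fin st -EFinD lee_fin subr_le0 leNgt st.
Qed.

Lemma lintD s t f g : itv_integrable s t f -> itv_integrable s t g ->
  itv_integrable s t (fun u => f u + g u).
Proof. by move=> fl gl; have := integrableD _ fl gl => /(_ _); apply. Qed.

Lemma lintZ s t f C : itv_integrable s t f -> itv_integrable s t (fun u =>
  C * f u).
Proof.
move=> fl; rewrite /itv_integrable (_ : EFin \o _ = (fun u =>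
  C%:E * (EFin \o f) u)%E) //.
exact: integrableZl.
Qed.

Lemma lintM s t f g : bounded_meas s t f -> itv_integrable s t g ->
  itv_integrable s t (fun u => f u * g u).
Proof.
move=> [mf [C Cf]] gl.
have [mg _] := integrableP _ _ _ gl.
have {}mg : measurable_fun `[s, t] g by exact/measurable_EFinP.
apply: (le_integrable _ _ _ (lintZ C gl)) => //.
  by apply/measurable_EFinP; exact: measurable_funM.
move=> u /=; rewrite in_itv /= => ust; rewrite lee_fin !normrM ler_wpM2r //.
by rewrite (le_trans (Cf _ ust)) ?ler_norm.
Qed.

Lemma IintD s t f g : itv_integrable s t f -> itv_integrable s t g ->
  \int[leb]_(u in `[s, t]) (f u + g u) =
  \int[leb]_(u in `[s, t]) f u + \int[leb]_(u in `[s, t]) g u.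
Proof. by move=> fl gl; exact: RintegralD. Qed.

Lemma IintZ s t f C : itv_integrable s t f ->
  \int[leb]_(u in `[s, t]) (C * f u) = C * \int[leb]_(u in `[s, t]) f u.
Proof. by move=> fl; exact: RintegralZl. Qed.

Lemma prim_bm a b X x : primitive a b X x -> bounded_meas a b X.
Proof.
move=> [xbm H]; have [mx [C Cx]] := xbm.
(* Adding the slope [C] makes [X] nondecreasing, hence measurable. *)
apply: (@bm_eq _ _ (fun u => (X u + C * u) - C * u)).
  by move=> u _; rewrite addrK.
have Cu : bounded_meas a b (fun u => C * u).
  by apply: bmM; [exact: bm_cst | exact: bm_nondec].
apply: bmB => //; apply: bm_nondec => s t sa st tb.
have /= : `|X t - X s| <= C * (t - s).
  rewrite H //; apply: Iint_norm_le => //.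
    exact/bm_lint/(bm_sub sa tb).
  move=> u /andP[su ut]; apply: Cx.
  by rewrite (le_trans sa su) (le_trans ut tb).
rewrite ler_norml; lra.
Qed.

Lemma prim_lip a b X x : primitive a b X x -> exists2 C, 0 <= C &
  forall s t, a <= s -> s <= t -> t <= b -> `|X t - X s| <= C * (t - s).
Proof.
move=> [xbm H]; have [mx [C Cx]] := xbm.
exists `|C| => // s t sa st tb; rewrite H //; apply: Iint_norm_le => //.
  exact/bm_lint/(bm_sub sa tb).
move=> u /andP[su ut]; rewrite (le_trans _ (ler_norm C)) // Cx //.
by rewrite (le_trans sa su) (le_trans ut tb).
Qed.

Lemma eq_prim a b X x x' : (forall u, a <= u <= b -> x u = x' u) ->
  primitive a b X x -> primitive a b X x'.
Proof.
move=> xx' [xbm H]; split; first exact: bm_eq xbm.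
move=> s t sa st tb; rewrite H //; apply: eq_Iint => u /andP[su ut].
by rewrite xx' // (le_trans sa su) (le_trans ut tb).
Qed.

Lemma eq_primF a b X X' x : (forall u, a <= u <= b -> X u = X' u) ->
  primitive a b X x -> primitive a b X' x.
Proof.
move=> XX' [xbm H]; split=> // s t sa st tb; rewrite -H // !XX' //.
  by rewrite sa (le_trans st tb).
by rewrite tb (le_trans sa st).
Qed.

(** Endpoints are null; this serves where a formula for the rate fails at an endpoint, as at [tau],
    where acceptance is not controlled. *)
Lemma eq_prim_oo a b X x x' : bounded_meas a b x' -> (forall u, a < u < b ->
  x u = x' u) ->
  primitive a b X x -> primitive a b X x'.
Proof.
move=> x'bm xx' [xbm H]; split=> // s t sa st tb.
rewrite H // !Iint_oo; try by apply/bm_lint; exact: bm_sub sa tb _.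
apply: eq_Rintegral => u; rewrite inE /= in_itv /= => /andP[su ut].
by rewrite xx' // (le_lt_trans sa su) (lt_le_trans ut tb).
Qed.

Lemma prim_cst a b C : primitive a b (fun=> C) (fun=> 0).
Proof.
split; first exact: bm_cst.
by move=> s t _ st _; rewrite Iint_cst // mul0r subrr.
Qed.

Lemma primD a b X Y x y : primitive a b X x -> primitive a b Y y ->
  primitive a b (fun u => X u + Y u) (fun u => x u + y u).
Proof.
move=> [xbm HX] [ybm HY]; split; first exact: bmD.
move=> s t sa st tb; rewrite IintD; last 2 first.
- exact/bm_lint/(bm_sub sa tb).
- exact/bm_lint/(bm_sub sa tb).
by rewrite -HX // -HY //; lra.
Qed.

Lemma primZ a b X x C : primitive a b X x ->
  primitive a b (fun u => C * X u) (fun u => C * x u).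
Proof.
move=> [xbm HX]; split; first by apply: bmM => //; exact: bm_cst.
move=> s t sa st tb; rewrite IintZ; last exact/bm_lint/(bm_sub sa tb).
by rewrite -HX // mulrBr.
Qed.

Lemma prim_int a b x : bounded_meas a b x ->
  primitive a b (fun t => \int[leb]_(u in `[a, t]) x u) x.
Proof.
move=> xbm; split=> // s t sa st tb.
rewrite (lint_split (c := s) sa st); last exact/bm_lint/(bm_sub _ tb).
by rewrite addrC addKr.
Qed.

(** Over [[c, d]] the increment of [X * Y] minus the candidate integral is the product of the two
    increments, less two integrals of a rate against an increment. All three are of order
    [(d - c) ^ 2] because [X] and [Y] are Lipschitz. *)
Lemma primM a b X Y x y : primitive a b X x -> primitive a b Y y ->
  primitive a b (fun u => X u * Y u) (fun u => x u * Y u + X u * y u).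
Proof.
move=> pX pY; have [xbm HX] := pX; have [ybm HY] := pY.
have Xbm := prim_bm pX; have Ybm := prim_bm pY.
have zbm : bounded_meas a b (fun u => x u * Y u + X u * y u) by apply: bmD;
  exact: bmM.
split=> // s t sa st tb.
have [CX CX0 LX] := prim_lip pX; have [CY CY0 LY] := prim_lip pY.
have [_ [Cx Hx]] := xbm; have [_ [Cy Hy]] := ybm.
pose Z v := \int[leb]_(u in `[s, v]) (x u * Y u + X u * y u).
suff : X t * Y t - Z t = X s * Y s - Z s.
  by rewrite /Z Iint_set1; lra.
apply: (@quadratic_cst _ (fun v => X v * Y v - Z v) id s t
  (CX * CY + `|Cx| * CY + CX * `|Cy|)) => //.
  by rewrite !addr_ge0 // mulr_ge0.
move=> c d sc cd dt.
have ac := le_trans sa sc; have db := le_trans dt tb.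
have xl : itv_integrable c d x by exact/bm_lint/(bm_sub ac db).
have yl : itv_integrable c d y by exact/bm_lint/(bm_sub ac db).
have e1 : \int[leb]_(u in `[c, d]) (x u * (Y u - Y c)) =
    \int[leb]_(u in `[c, d]) (x u * Y u) - (X d - X c) * Y c.
  rewrite HX // mulrC -mulNr -IintZ // -IintD; last 2 first.
  - by apply/bm_lint/bmM; exact: bm_sub (Ybm) || exact: bm_sub (xbm).
  - exact: lintZ.
  by apply: eq_Iint => u _; lra.
have e2 : \int[leb]_(u in `[c, d]) ((X u - X c) * y u) =
    \int[leb]_(u in `[c, d]) (X u * y u) - X c * (Y d - Y c).
  rewrite HY // -mulNr -IintZ // -IintD; last 2 first.
  - by apply/bm_lint/bmM; exact: bm_sub (Xbm) || exact: bm_sub (ybm).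
  - exact: lintZ.
  by apply: eq_Iint => u _; lra.
have b1 : `|\int[leb]_(u in `[c, d]) (x u * (Y u - Y c))|
    <= `|Cx| * CY * (d - c) * (d - c).
  apply: Iint_norm_le => //.
    apply/bm_lint/bmM; first exact: bm_sub (xbm).
    by apply: bmB; [exact: bm_sub (Ybm) | exact: bm_cst].
  move=> u /andP[cu ud]; rewrite normrM -mulrA ler_pM //.
    rewrite (le_trans _ (ler_norm Cx)) // Hx //.
    by rewrite (le_trans ac cu) (le_trans ud db).
  rewrite (le_trans (LY _ _ _ _ _)) // ?(le_trans ud db) //.
  by rewrite ler_wpM2l // lerD2r.
have b2 : `|\int[leb]_(u in `[c, d]) ((X u - X c) * y u)|
    <= CX * `|Cy| * (d - c) * (d - c).
  apply: Iint_norm_le => //.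
    apply/bm_lint/bmM; last exact: bm_sub (ybm).
    by apply: bmB; [exact: bm_sub (Xbm) | exact: bm_cst].
  move=> u /andP[cu ud]; rewrite normrM mulrAC ler_pM //.
    rewrite (le_trans (LX _ _ _ _ _)) // ?(le_trans ud db) //.
    by rewrite ler_wpM2l // lerD2r.
  rewrite (le_trans _ (ler_norm Cy)) // Hy //.
  by rewrite (le_trans ac cu) (le_trans ud db).
have b3 : `|(X d - X c) * (Y d - Y c)| <= CX * CY * (d - c) * (d - c).
  rewrite normrM (_ : _ * _ * _ * _ = (CX * (d - c)) * (CY * (d - c)));
    last by ring.
  by rewrite ler_pM // ?LX ?LY.
have -> : X d * Y d - Z d - (X c * Y c - Z c) =
  (X d - X c) * (Y d - Y c) - \int[leb]_(u in `[c, d]) (x u * (Y u - Y c))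
  - \int[leb]_(u in `[c, d]) ((X u - X c) * y u).
  rewrite /Z (lint_split (c := c) sc cd); last first.
    exact/bm_lint/(bm_sub sa db).
  rewrite (@IintD c d); last 2 first.
  - by apply/bm_lint/bmM; exact: bm_sub (Ybm) || exact: bm_sub (xbm).
  - by apply/bm_lint/bmM; exact: bm_sub (Xbm) || exact: bm_sub (ybm).
  by rewrite e1 e2; ring.
by move: b1 b2 b3; rewrite !ler_norml => ? ? ?; apply/andP; split; nra.
Qed.

(** The inequality [1 + x <= expR x], used in both directions, places the first-order remainder
    between 0 and a multiple of the squared increment of [K], as [quadratic_cst] requires. *)
Lemma prim_expR a b K k : primitive a b K k ->
  primitive a b (fun u => expR (K u)) (fun u => k u * expR (K u)).
Proof.
move=> pK; have [kbm HK] := pK.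
have Kbm := prim_bm pK; have [C C0 LK] := prim_lip pK.
have [_ [B HB]] := Kbm; have [_ [Ck Hk]] := kbm.
have eB u : a <= u <= b -> expR (K u) <= expR B.
  by move=> uab; rewrite ler_expR (le_trans (ler_norm _)) // HB.
have key' u v : expR (K v) * (1 + (K u - K v)) <= expR (K u).
  have -> : expR (K u) = expR (K v) * expR (K u - K v).
    by rewrite -expRD addrC subrK.
  by rewrite ler_wpM2l ?expR_ge0 // expR_ge1Dx.
have key u v : a <= u -> u <= v -> v <= b ->
    0 <= expR (K v) - expR (K u) - expR (K u) * (K v - K u)
      <= expR B * ((K v - K u) * (K v - K u)).
  move=> au uv vb.
  have h1 := key' v u; have h2 := key' u v.
  have := eB u; rewrite au (le_trans uv vb) => /(_ isT) e1.
  have := eB v; rewrite vb (le_trans au uv) => /(_ isT) e2.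
  have := expR_gt0 (K u); have := expR_gt0 (K v).
  set U := expR (K u) in h1 h2 e1 *; set V := expR (K v) in h1 h2 e2 *.
  rewrite -(opprB (K v)) in h2 *; set d := K v - K u in h1 h2 *.
  move=> V0 U0; apply/andP; split; first by lra.
  have d2 : 0 <= d * d by rewrite -expr2 sqr_ge0.
  have h3 : (V - U) * d <= expR B * (d * d).
    have [le|le] := leP 0 d.
      have : (V - U) * d <= (V * d) * d by rewrite ler_wpM2r //; lra.
      by have := ler_wpM2r d2 e2; lra.
    have : (V - U) * d <= (U * d) * d by rewrite ler_wnM2r //; lra.
    by have := ler_wpM2r d2 e1; lra.
  lra.
have Ebm : bounded_meas a b (fun u => expR (K u)).
  split; first by apply: measurableT_comp => //; case: Kbm.
  by exists (expR B) => u /eB; rewrite ger0_norm // expR_ge0.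
have zbm : bounded_meas a b (fun u => k u * expR (K u)) by exact: bmM.
have LE u v : a <= u -> u <= v -> v <= b ->
    `|expR (K v) - expR (K u)| <= (expR B * C) * (v - u).
  move=> au uv vb; have /andP[k1 k2] := key u v au uv vb.
  have uab : a <= u <= b by rewrite au (le_trans uv vb).
  have vab : a <= v <= b by rewrite vb (le_trans au uv).
  have := eB u uab; have := eB v vab; have := LK _ _ au uv vb.
  have := expR_gt0 (K u); have := expR_gt0 (K v).
  move: k1 {k2}; have := key' u v.
  set EB := expR B; set U := expR (K u); set V := expR (K v).
  rewrite !ler_norml => k2 k1 V0 U0 /andP[L1 L2] VB UB.
  rewrite -mulrA; apply/andP; split; last first.
    have [le|le] := leP 0 (K v - K u); nra.
  have [le|le] := leP 0 (K v - K u); nra.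
split=> // s t sa st tb.
pose Z v := \int[leb]_(u in `[s, v]) (k u * expR (K u)).
suff : expR (K t) - Z t = expR (K s) - Z s.
  by rewrite /Z Iint_set1; lra.
have C'0 : 0 <= expR B * C by rewrite mulr_ge0 // expR_ge0.
apply: (@quadratic_cst _ (fun v => expR (K v) - Z v) id s t
  (expR B * C * C + `|Ck| * (expR B * C))) => //.
  by rewrite addr_ge0 // mulr_ge0 //.
move=> c d sc cd dt.
have ac := le_trans sa sc; have db := le_trans dt tb.
have kl : itv_integrable c d k by exact/bm_lint/(bm_sub ac db).
have e1 : \int[leb]_(u in `[c, d]) (k u * (expR (K u) - expR (K c))) =
    \int[leb]_(u in `[c, d]) (k u * expR (K u)) - expR (K c) * (K d - K c).
  rewrite HK // -mulNr -IintZ // -IintD; last 2 first.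
  - exact/bm_lint/(bm_sub ac db).
  - exact: lintZ.
  by apply: eq_Iint => u _; lra.
have b1 : `|\int[leb]_(u in `[c, d]) (k u * (expR (K u) - expR (K c)))|
    <= `|Ck| * (expR B * C) * (d - c) * (d - c).
  apply: Iint_norm_le => //.
    apply/bm_lint/bmM; first exact: bm_sub (kbm).
    by apply: bmB; [exact: bm_sub (Ebm) | exact: bm_cst].
  move=> u /andP[cu ud]; rewrite normrM -mulrA ler_pM //.
    rewrite (le_trans _ (ler_norm Ck)) // Hk //.
    by rewrite (le_trans ac cu) (le_trans ud db).
  rewrite (le_trans (LE _ _ _ _ _)) // ?(le_trans ud db) //.
  by rewrite ler_wpM2l // lerD2r.
have -> : expR (K d) - Z d - (expR (K c) - Z c) =
  (expR (K d) - expR (K c) - expR (K c) * (K d - K c))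
  - \int[leb]_(u in `[c, d]) (k u * (expR (K u) - expR (K c))).
  rewrite e1 /Z (lint_split (c := c) sc cd); last first.
    exact/bm_lint/(bm_sub sa db).
  by ring.
have /andP[k1 k2] := key _ _ ac cd db.
have k3 : expR B * ((K d - K c) * (K d - K c)) <= expR B * C * C * (d - c) *
  (d - c).
  rewrite -!mulrA ler_wpM2l ?expR_ge0 //.
  rewrite (le_trans (ler_norm _)) // normrM.
  rewrite (_ : C * _ = (C * (d - c)) * (C * (d - c))); last by ring.
  by rewrite ler_pM // LK.
by move: b1; rewrite !ler_norml => ?; apply/andP; split; nra.
Qed.

Lemma prim_lt a b X x s t : primitive a b X x -> a <= s -> s < t -> t <= b ->
  (forall u, s < u < t -> 0 < x u) -> X s < X t.
Proof.
move=> [xbm H] sa st tb xp; rewrite -subr_gt0 (H _ _ sa (ltW st) tb).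
by apply: Iint_gt0 => //; exact/bm_lint/(bm_sub sa tb).
Qed.

Lemma prim_gt a b X x s t : primitive a b X x -> a <= s -> s < t -> t <= b ->
  (forall u, s < u < t -> x u < 0) -> X t < X s.
Proof.
move=> pX sa st tb xn; rewrite -ltrN2 -mulN1r -[ltRHS]mulN1r.
apply: (prim_lt (primZ (-1) pX) sa st tb) => u ust.
by rewrite mulN1r oppr_gt0 xn.
Qed.

Lemma prim_le a b X x s t : primitive a b X x -> a <= s -> s <= t -> t <= b ->
  (forall u, s < u < t -> 0 <= x u) -> X s <= X t.
Proof.
move=> [xbm H] sa st tb x0; rewrite -subr_ge0 H //.
by apply: Iint_ge0 => //; exact/bm_lint/(bm_sub sa tb).
Qed.

Lemma prim_const a b X x s t : primitive a b X x -> a <= s -> s <= t -> t <= b ->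
  (forall u, s < u < t -> x u = 0) -> X t = X s.
Proof.
move=> pX sa st tb x0; apply/eqP; rewrite eq_le; apply/andP; split; last first.
  by apply: (prim_le pX) => // u /x0 ->.
rewrite -lerN2 -mulN1r -[leRHS]mulN1r.
by apply: (prim_le (primZ (-1) pX)) => // u /x0 ->; rewrite mulr0.
Qed.

(** Integrating factor: the product of [X] with [expR (- K)] has rate zero. *)
Lemma prim_linear a b X k t : primitive a b X (fun u => k u * X u) ->
  bounded_meas a b k ->
  a <= t <= b -> X t = X a * expR (\int[leb]_(u in `[a, t]) k u).
Proof.
move=> pX kbm /andP[at_ tb].
have pK := prim_int kbm; set K := (fun _ => _) in pK.
have pE := prim_expR (primZ (-1) pK).
have pZ := primM pX pE.
have : X t * expR (-1 * K t) = X a * expR (-1 * K a).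
  by apply: (prim_const pZ) => // u _; ring.
rewrite /K Iint_set1 mulr0 expR0 mulr1 => <-.
by rewrite -mulrA -expRD mulN1r addNr expR0 mulr1.
Qed.

Lemma prim_first a b X x v : primitive a b X x -> a <= b -> v <= X b ->
  exists t, [/\ a <= t, t <= b, v <= X t & forall u, a <= u -> u < t -> X u < v].
Proof.
move=> pX ab vb; have [C C0 LX] := prim_lip pX.
pose S := [set u | a <= u <= b /\ v <= X u].
have Sb : S b by rewrite /S /= ab lexx.
have Slb : has_lbound S by exists a => u [/andP[]].
have Sinf : has_inf S by split => //; exists b.
have ai : a <= inf S by apply: lb_le_inf; [exists b | move=> u [/andP[]]].
have ib : inf S <= b by exact: ge_inf.
exists (inf S); split => //; last first.
  move=> u au ui; rewrite ltNge; apply/negP => vu.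
  have : inf S <= u by apply: ge_inf => //; split=> //;
    rewrite au (le_trans (ltW ui)).
  by rewrite leNgt ui.
rewrite leNgt; apply/negP => lt_v.
(* Chosen so that [C * e + e] is the gap: within distance [e] the Lipschitz bound cannot close it.
   The 1 keeps the divisor positive. *)
pose e := (v - X (inf S)) / (C + 1).
have e0 : 0 < e by rewrite divr_gt0 ?subr_gt0 // ltr_wpDl.
have [u [/andP[au ub] vu] ue] := inf_adherent e0 Sinf.
have iu : inf S <= u by apply: ge_inf => //; split=> //; rewrite au ub.
have := LX _ _ ai iu ub; rewrite ler_norml => /andP[_ h].
have h2 : C * (u - inf S) <= C * e by rewrite ler_wpM2l // lerBlDl ltW.
have h3 : C * e + e = v - X (inf S).
  by rewrite -{2}[e]mul1r -mulrDl /e mulrC divfK // gt_eqF // ltr_wpDl.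
lra.
Qed.

Lemma prim_last a b X x v : primitive a b X x -> a <= b -> v <= X a ->
  exists t, [/\ a <= t, t <= b, v <= X t & forall u, t < u -> u <= b -> X u < v].
Proof.
move=> pX ab va; have [C C0 LX] := prim_lip pX.
pose S := [set u | a <= u <= b /\ v <= X u].
have Sa : S a by rewrite /S /= ab lexx.
have Sub : has_ubound S by exists b => u [/andP[]].
have Ssup : has_sup S by split => //; exists a.
have ib : sup S <= b by apply: ge_sup; [exists a | move=> u [/andP[]]].
have ai : a <= sup S by exact: ub_le_sup.
exists (sup S); split => //; last first.
  move=> u ui ub; rewrite ltNge; apply/negP => vu.
  have : u <= sup S.
    by apply: ub_le_sup => //; split=> //; rewrite ub (le_trans ai (ltW ui)).
  by rewrite leNgt ui.
rewrite leNgt; apply/negP => lt_v.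
pose e := (v - X (sup S)) / (C + 1).
have e0 : 0 < e by rewrite divr_gt0 ?subr_gt0 // ltr_wpDl.
have [u [/andP[au ub] vu] ue] := sup_adherent e0 Ssup.
have iu : u <= sup S by apply: ub_le_sup => //; split=> //; rewrite au ub.
have := LX _ _ au iu ib; rewrite ler_norml => /andP[h _].
have h2 : C * (sup S - u) <= C * e by rewrite ler_wpM2l //; lra.
have h3 : C * e + e = v - X (sup S).
  by rewrite -{2}[e]mul1r -mulrDl /e mulrC divfK // gt_eqF // ltr_wpDl.
lra.
Qed.

Lemma prim_le_left a b X x v : primitive a b X x -> a < b ->
  (forall u, a <= u -> u < b -> X u <= v) -> X b <= v.
Proof.
move=> pX ab Hv; rewrite leNgt; apply/negP => lt_v.
have [C C0 LX] := prim_lip pX.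
pose e := (X b - v) / (C + 1).
have e0 : 0 < e by rewrite divr_gt0 ?subr_gt0 // ltr_wpDl.
have h3 : C * e + e = X b - v.
  by rewrite -{2}[e]mul1r -mulrDl /e mulrC divfK // gt_eqF // ltr_wpDl.
pose u := Num.max a (b - e).
have au : a <= u by rewrite le_max lexx.
have ub : u < b by rewrite gt_max ab ltrBlDr ltrDl.
have bu : b - u <= e by rewrite lerBlDr -lerBlDl le_max lexx orbT.
have := Hv u au ub; have := LX _ _ au (ltW ub) (lexx b).
rewrite ler_norml => /andP[_ h].
have := ler_wpM2l C0 bu; lra.
Qed.

Lemma prim_IVT a b X x v : primitive a b X x -> a <= b -> X a <= v -> v <= X b ->
  exists t, [/\ a <= t, t <= b & X t = v].
Proof.
move=> pX ab av vb; have [t [at_ tb vt Ht]] := prim_first pX ab vb.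
exists t; split => //; apply/eqP; rewrite eq_le vt andbT.
move: at_; rewrite [a <= t]le_eqVlt => /predU1P[<-//|at_].
apply: (prim_le_left (prim_sub (lexx a) tb pX) at_) => u au ut.
exact/ltW/Ht.
Qed.

End Interval.

(** * Timings *)

Section TimingTheory.
Context {R : realType} (F : timing R).
Local Notation leb := (@lebesgue_measure R).
Local Notation pos := (`[0%R, +oo[%classic : set R).
Implicit Types (A B : set R) (h : R -> R) (s t c C : R).

(** Only one inequality needs an argument; the other is the same one with [c^-1] and [c * h]. *)
Lemma esumZ A c h : 0 <= c -> (forall x, 0 <= h x) ->
  (\esum_(x in A) (c * h x)%:E = c%:E * \esum_(x in A) (h x)%:E)%E.
Proof.
have le (d : R) (k : R -> R) : 0 <= d -> (forall x, 0 <= k x) ->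
    (\esum_(x in A) (d * k x)%:E <= d%:E * \esum_(x in A) (k x)%:E)%E.
  move=> d0 k0; rewrite [leLHS]/esum; apply: ge_ereal_sup => _ [X AX <-].
  under eq_fsbigr do rewrite EFinM.
  rewrite -ge0_mule_fsumr; last by move=> x; rewrite lee_fin.
  apply: lee_wpmul2l; first by rewrite lee_fin.
  by apply: esum_ge; exists X.
move=> c0 h0; apply/eqP; rewrite eq_le le //=.
move: c0; rewrite [0 <= c]le_eqVlt => /predU1P[<-|c0].
  by rewrite mul0e; apply: esum_ge0 => x _; rewrite mul0r.
have -> : (\esum_(x in A) (h x)%:E = \esum_(x in A) (c^-1 * (c * h x))%:E)%E.
  by apply: eq_esum => x _; rewrite mulKf ?gt_eqF.
have c'0 : 0 <= c^-1 by rewrite invr_ge0 ltW.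
have ch0 x : 0 <= c * h x by rewrite mulr_ge0 // ltW.
apply: (@le_trans _ _ (c%:E * (c^-1%:E * \esum_(x in A) (c * h x)%:E))%E).
  by apply: lee_wpmul2l; [rewrite lee_fin ltW | exact: le].
by rewrite muleA -EFinM mulfV ?gt_eqF // mul1e.
Qed.

(** Nonnegativity is what [esum] needs; the bound keeps the density part and the atomic part of
    [tint] finite, so that [fine] loses nothing. *)
Definition weight A h := measurable_fun A h /\
  exists C, forall x, A x -> 0 <= h x <= C.

Lemma pos_ge0 x : pos x -> 0 <= x.
Proof. by rewrite /= in_itv /= andbT. Qed.

Lemma dens_integrable A : measurable A -> A `<=` pos ->
  leb.-integrable A (EFin \o dens F).
Proof.
move=> mA Apos; apply: (integrableS (mu := leb) (E := pos)) => //.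
apply/integrableP; split; first by apply/measurable_EFinP; exact: dens_measurable.
have -> : (\int[leb]_(x in pos) `|(EFin \o dens F) x| =
    \int[leb]_(x in pos) (dens F x)%:E)%E.
  by apply: eq_integral => s; rewrite inE => /pos_ge0 s0;
    rewrite /= ger0_norm // dens_ge0.
apply: (@le_lt_trans _ _ 1%E); last by rewrite ltry.
apply: le_trans (timing_mass F); rewrite leeDl // esum_ge0 // => x _.
by rewrite lee_fin atom_ge0.
Qed.

Lemma atom_fin A : A `<=` pos -> \esum_(s in A) (atom F s)%:E \is a fin_num.
Proof.
move=> Apos; rewrite ge0_fin_numE; last by apply: esum_ge0 => x _;
  rewrite lee_fin atom_ge0.
apply: (@le_lt_trans _ _ 1%E); last by rewrite ltry.
apply: le_trans (timing_mass F).
rewrite [leRHS]addeC; apply: (@le_trans _ _ (\esum_(s in pos) (atom F s)%:E));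
  last first.
  by rewrite leeDl // integral_ge0 // => x /pos_ge0 x0; rewrite lee_fin dens_ge0.
rewrite (esumID A pos); last by move=> x _; rewrite lee_fin atom_ge0.
rewrite setIidr // leeDl // esum_ge0 // => x _; by rewrite lee_fin atom_ge0.
Qed.

Lemma okw_atom_fin A h : A `<=` pos -> weight A h ->
  \esum_(s in A) (h s * atom F s)%:E \is a fin_num.
Proof.
move=> Apos [_ [C Ch]].
have h0 s : A s -> (0 <= (h s * atom F s)%:E)%E.
  by move=> /Ch /andP[? _]; rewrite lee_fin mulr_ge0 ?atom_ge0.
rewrite ge0_fin_numE; last by apply: esum_ge0.
apply: (@le_lt_trans _ _ (\esum_(s in A) (`|C| * atom F s)%:E)).
  apply: le_esum => s /Ch /andP[_ hC]; rewrite lee_fin ler_wpM2r ?atom_ge0 //.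
  exact: le_trans hC (ler_norm _).
rewrite esumZ //; last exact: atom_ge0.
by rewrite -(fineK (atom_fin Apos)) -EFinM ltry.
Qed.

Lemma okw_integrable A h : measurable A -> A `<=` pos -> weight A h ->
  leb.-integrable A (EFin \o (fun s => h s * dens F s)).
Proof.
move=> mA Apos [mh [C Ch]].
have dl := dens_integrable mA Apos.
have [md _] := integrableP _ _ _ dl.
have {}md : measurable_fun A (dens F) by exact/measurable_EFinP.
have CdL : leb.-integrable A (EFin \o (fun s => C * dens F s)).
  rewrite (_ : EFin \o _ = (fun u => C%:E * (EFin \o dens F) u)%E) //.
  exact: integrableZl.
apply: (le_integrable _ _ _ CdL) => //.
  by apply/measurable_EFinP; exact: measurable_funM.
move=> u Au; have /andP[h0 hC] := Ch _ Au; rewrite lee_fin !normrM ler_wpM2r //.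
by rewrite (ger0_norm h0) (le_trans hC) ?ler_norm.
Qed.

Lemma tint_ge0 A h : A `<=` pos -> (forall s, A s -> 0 <= h s) ->
  0 <= tint F A h.
Proof.
move=> Apos h0; rewrite /tint addr_ge0 //.
  by apply: Rintegral_ge0 => x Ax; rewrite mulr_ge0 ?h0 ?dens_ge0 //;
    exact/pos_ge0/Apos.
by apply/fine_ge0/esum_ge0 => x Ax; rewrite lee_fin mulr_ge0 ?h0 ?atom_ge0.
Qed.

Lemma eq_tint A h h' : (forall s, A s -> h s = h' s) -> tint F A h = tint F A h'.
Proof.
move=> hh'; rewrite /tint; congr (_ + fine _).
  by apply: eq_Rintegral => s; rewrite inE => /hh' ->.
by apply: eq_esum => s /hh' ->.
Qed.

Lemma tint_le A h h' : measurable A -> A `<=` pos -> weight A h -> weight A h' ->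
  (forall s, A s -> h s <= h' s) -> tint F A h <= tint F A h'.
Proof.
move=> mA Apos oh oh' hh'; rewrite /tint lerD //.
  apply: le_Rintegral => //; try exact: okw_integrable.
  by move=> x Ax; rewrite ler_wpM2r ?hh' // dens_ge0 //; exact/pos_ge0/Apos.
apply: fine_le; try exact: okw_atom_fin.
by apply: le_esum => x Ax; rewrite lee_fin ler_wpM2r ?hh' ?atom_ge0.
Qed.

Lemma okw1 A : weight A (fun=> 1).
Proof. by split; [exact: measurable_cst|exists 1 => x _; rewrite ler01 lexx]. Qed.

Lemma tintZ A h c : measurable A -> A `<=` pos -> 0 <= c -> weight A h ->
  (forall x, 0 <= h x) -> tint F A (fun s => c * h s) = c * tint F A h.
Proof.
move=> mA Apos c0 oh h0; rewrite /tint.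
under eq_Rintegral do rewrite -mulrA.
rewrite RintegralZl //; last exact: okw_integrable.
under eq_esum do rewrite -mulrA.
rewrite esumZ //; last by move=> x; rewrite mulr_ge0 ?atom_ge0.
by rewrite fineM ?okw_atom_fin // mulrDr.
Qed.

Lemma tint_cst A c : measurable A -> A `<=` pos -> 0 <= c ->
  tint F A (fun=> c) = c * tint F A (fun=> 1).
Proof.
by move=> mA Apos c0; rewrite -tintZ //; [apply: eq_tint => s _;
  rewrite mulr1|exact: okw1].
Qed.

Lemma okw_sub A B h : measurable B -> A `<=` B -> weight B h -> weight A h.
Proof.
move=> mB AB [mh [C Ch]]; split; first exact: (measurable_funS mB AB mh).
by exists C => x /AB; exact: Ch.
Qed.

Lemma tint_setU A B h : measurable A -> measurable B ->
  A `|` B `<=` pos -> weight (A `|` B) h -> [disjoint A & B] ->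
  tint F (A `|` B) h = tint F A h + tint F B h.
Proof.
move=> mA mB ABpos oh AB; have mAB := measurableU _ _ mA mB.
have Apos : A `<=` pos by move=> x Ax; apply: ABpos; left.
have Bpos : B `<=` pos by move=> x Bx; apply: ABpos; right.
have ohA : weight A h by apply: okw_sub oh => // x; left.
have ohB : weight B h by apply: okw_sub oh => // x; right.
rewrite /tint Rintegral_setU //; last exact: okw_integrable.
rewrite (esumID A); last first.
  move=> x Ax; have [_ [C Ch]] := oh; have /andP[h0 _] := Ch _ Ax.
  by rewrite lee_fin mulr_ge0 ?atom_ge0.
have -> : (A `|` B) `&` A = A.
  by apply/seteqP; split => [x []|x Ax] //; split => //; left.
have -> : (A `|` B) `&` ~` A = B.
  apply/seteqP; split => [x [[]] //|x Bx]; split; first by right.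
  by move=> Ax; move/disj_set2P : AB => /seteqP[+ _] => /(_ x); apply; split.
rewrite fineD; [lra|exact: okw_atom_fin|exact: okw_atom_fin].
Qed.

Lemma tint_inactive A h : A `<=` pos -> (forall s, A s -> ~ active F s%:E) ->
  tint F A h = 0.
Proof.
move=> Apos An.
have d0 s : A s -> dens F s = 0.
  move=> As; apply/eqP; rewrite eq_le dens_ge0 ?andbT; last exact/pos_ge0/Apos.
  by rewrite leNgt; apply/negP => dp; apply: (An _ As); left.
have a0 s : A s -> atom F s = 0.
  move=> As; apply/eqP; rewrite eq_le atom_ge0 ?andbT.
  by rewrite leNgt; apply/negP => ap; apply: (An _ As); right.
rewrite /tint esum1 => [|s As]; last by rewrite a0 // mulr0.
by rewrite /Rintegral integral0_eq ?addr0 // => s As; rewrite d0 // mulr0.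
Qed.

Lemma itvcc_pos s t : 0 <= s -> (`[s, t]%classic : set R) `<=` pos.
Proof. by move=> s0 x; rewrite /= !in_itv /= andbT => /andP[sx _];
  exact: le_trans sx. Qed.

Lemma itvoc_pos s t : 0 <= s -> (`]s, t]%classic : set R) `<=` pos.
Proof.
by move=> s0 x; rewrite /= !in_itv /= andbT => /andP[/ltW sx _];
  exact: le_trans sx.
Qed.

Lemma tint_split s t h : 0 <= s -> s <= t -> weight `[0, t] h ->
  tint F `[0, t] h = tint F `[0, s] h + tint F `]s, t] h.
Proof.
move=> s0 st oh.
have e : (`[0, t]%classic : set R) = `[0, s] `|` `]s, t].
  by rewrite (@itv_bndbnd_setU _ _ _ (BRight s)) ?bnd_simp.
rewrite e in oh *; rewrite tint_setU //.
  by move=> x [|]; [exact: itvcc_pos|exact: itvoc_pos].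
apply/disj_set2P/seteqP; split => // x []; rewrite /= !in_itv /=.
by move=> /andP[_ xs] /andP[]; rewrite ltNge xs.
Qed.

Local Notation Ft := (cdf F).

Lemma cdfB s t : 0 <= s -> s <= t -> Ft t - Ft s = tint F `]s, t] (fun=> 1).
Proof. by move=> s0 st; rewrite /cdf (tint_split s0 st (okw1 _)) addrC addKr. Qed.

Lemma cdf_le s t : 0 <= s -> s <= t -> Ft s <= Ft t.
Proof.
by move=> s0 st; rewrite -subr_ge0 cdfB // tint_ge0 //; exact: itvoc_pos.
Qed.

Lemma cdf_ge0 t : 0 <= Ft t.
Proof. by rewrite /cdf tint_ge0 //; exact: itvcc_pos. Qed.

Lemma tint_total_le1 : tint F pos (fun=> 1) <= 1.
Proof.
rewrite /tint -lee_fin EFinD /Rintegral !fineK.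
- under eq_integral do rewrite mul1r.
  by under eq_esum do rewrite mul1r; exact: timing_mass.
- by apply: okw_atom_fin => //; exact: okw1.
- by apply: integrable_fin_num => //; apply: okw_integrable => //; exact: okw1.
Qed.

Lemma cdf_total t : 0 <= t ->
  tint F pos (fun=> 1) = Ft t + tint F `]t, +oo[ (fun=> 1).
Proof.
move=> t0.
have e : pos = `[0, t] `|` `]t, +oo[.
  by rewrite (@itv_bndbnd_setU _ _ _ (BRight t)) ?bnd_simp.
have sub : (`[0, t]%classic `|` `]t, +oo[%classic : set R) `<=` pos by rewrite -e.
rewrite [in LHS]e tint_setU //; first exact: okw1.
apply/disj_set2P/seteqP; split => // x []; rewrite /= !in_itv /= andbT.
by move=> /andP[_ xs]; rewrite ltNge xs.
Qed.

Lemma itvoy_pos t : 0 <= t -> (`]t, +oo[%classic : set R) `<=` pos.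
Proof. by move=> t0 x; rewrite /= !in_itv /= !andbT => /ltW; exact: le_trans. Qed.

Lemma cdf_le1 t : Ft t <= 1.
Proof.
have [t0|t0] := leP 0 t.
  apply: le_trans tint_total_le1; rewrite (cdf_total t0) lerDl.
  by apply: tint_ge0 => //; exact: itvoy_pos.
rewrite /cdf set_itv_ge ?bnd_simp -?ltNge // /tint Rintegral_set0 esum_set0 /=.
by rewrite addr0.
Qed.

Lemma cdf_bm t : bounded_meas 0 t Ft.
Proof. by apply: bm_nondec => s u s0 su _; exact: cdf_le. Qed.

Lemma tint_oc_bounds s t h c C : 0 <= s -> s <= t -> 0 <= c ->
  weight `]s, t] h -> (forall x, s < x <= t -> c <= h x <= C) ->
  c * (Ft t - Ft s) <= tint F `]s, t] h <= C * (Ft t - Ft s).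
Proof.
move=> s0 st c0 oh hc.
have [->|] := eqVneq s t.
  by rewrite subrr !mulr0 set_itvoc0 /tint Rintegral_set0 esum_set0 /= addr0 lexx.
rewrite eq_sym => ts; have {}st : s < t by rewrite lt_def ts.
have C0 : 0 <= C.
  have := hc t; rewrite st lexx => /(_ isT) /andP[c1 c2].
  exact: le_trans c0 (le_trans c1 c2).
have pos_oc := @itvoc_pos s t s0.
have okc d : 0 <= d -> weight `]s, t] (fun=> d).
  by move=> d0; split; [exact: measurable_cst | exists d => x _; rewrite d0 lexx].
have ec d : 0 <= d -> d * (Ft t - Ft s) = tint F `]s, t] (fun=> d).
  by move=> d0; rewrite (cdfB s0 (ltW st)) -tint_cst.
rewrite (ec _ c0) (ec _ C0).
have hc' x : `]s, t]%classic x -> c <= h x <= C by rewrite /= in_itv /=;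
  exact: hc.
apply/andP; split; apply: tint_le => //; try exact: okc.
  by move=> x /hc' /andP[].
by move=> x /hc' /andP[].
Qed.

Lemma inactive_cdf s t : 0 <= s -> s <= t ->
  (forall x, s < x <= t -> ~ active F x%:E) -> Ft t = Ft s.
Proof.
move=> s0 st An; apply/eqP; rewrite -subr_eq0 cdfB // tint_inactive //.
exact: itvoc_pos.
Qed.

Lemma inactive_cdf0 t : 0 <= t ->
  (forall x, 0 <= x <= t -> ~ active F x%:E) -> Ft t = 0.
Proof.
move=> t0 An; rewrite /cdf tint_inactive //.
exact: itvcc_pos.
Qed.

Lemma inactive_cdf1 t : 0 <= t -> (forall x, t < x -> ~ active F x%:E) ->
  ~ active F +oo%E -> Ft t = 1.
Proof.
move=> t0 An Ay; apply/eqP; rewrite eq_le cdf_le1 /=.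
have := cdf_total t0; rewrite (@tint_inactive `]t, +oo[); last 2 first.
- exact: itvoy_pos.
- by move=> x /=; rewrite in_itv /= andbT; exact: An.
rewrite addr0 => <-.
by rewrite leNgt; apply/negP => lt1; apply: Ay; rewrite /= /never subr_gt0.
Qed.

Lemma active_in s t : 0 <= s -> s <= t -> Ft s < Ft t ->
  exists2 x, s < x <= t & active F x%:E.
Proof.
move=> s0 st Fst; apply/not_exists2P => H.
have := inactive_cdf s0 st => /(_ _) e; move: Fst; rewrite e ?ltxx //.
by move=> x xst Ax; have [] := H x.
Qed.

Lemma cdf_AC s t : 0 <= s -> s <= t -> (forall x, s < x <= t -> atom F x = 0) ->
  Ft t - Ft s = \int[leb]_(u in `[s, t]) dens F u.
Proof.
move=> s0 st at0; rewrite cdfB // /tint esum1 ?addr0; last first.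
  by move=> x /=; rewrite in_itv /= => xst; rewrite at0 ?mulr0.
under eq_Rintegral do rewrite mul1r.
rewrite Rintegral_itv_obnd_cbnd //; apply: dens_integrable => //.
exact: itvoc_pos.
Qed.

Lemma cdf_at0 : Ft 0 = atom F 0.
Proof.
rewrite /cdf set_itv1 /tint Rintegral_set1 add0r esum_set1 ?mul1r //.
by rewrite lee_fin atom_ge0.
Qed.

End TimingTheory.

(** * Integration by parts, monotone limits and right continuity for timings *)

Section TimingCalculus.
Context {R : realType} (F : timing R).
Local Notation leb := (@lebesgue_measure R).
Local Notation pos := (`[0%R, +oo[%classic : set R).
Local Notation Ft := (cdf F).
Implicit Types (h phi y : R -> R) (s t c C : R).

Lemma bm_okw t h : bounded_meas 0 t h -> (forall x, 0 <= x <= t ->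
  0 <= h x) -> weight `[0, t] h.
Proof.
move=> [mh [C hC]] h0; split=> //; exists C => x /=; rewrite in_itv /= => xt.
by rewrite h0 //= (le_trans (ler_norm _)) // hC.
Qed.

Lemma tint_at0 h : 0 <= h 0 -> tint F `[0, 0] h = h 0 * Ft 0.
Proof.
move=> h0; rewrite cdf_at0 set_itv1 /tint Rintegral_set1 add0r esum_set1 //.
by rewrite lee_fin mulr_ge0 ?atom_ge0.
Qed.

(** On []c, d]] the mass meets values of [phi] within [C * (d - c)] of [phi c], and replacing [Ft u]
    by [Ft c] in the integral errs by at most [d - c] times that mass. So [D] moves by at most a
    multiple of [(d - c) * (Ft d - Ft c)], and [quadratic_cst] applies with [M := Ft], jumps
    included. *)
Lemma tint_parts t phi y : 0 <= t -> primitive 0 t phi y ->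
  (forall x, 0 <= x <= t -> 0 <= phi x) ->
  tint F `[0, t] phi + phi t * (1 - Ft t) =
  phi 0 + \int[leb]_(u in `[0, t]) (y u * (1 - Ft u)).
Proof.
move=> t0 pphi phi0; have [ybm _] := pphi.
have ophi : weight `[0, t] phi by apply: bm_okw => //; exact: prim_bm pphi.
pose D v := tint F `[0, v] phi + phi v * (1 - Ft v)
            - \int[leb]_(u in `[0, v]) (y u * (1 - Ft u)).
suff : D t = D 0.
  rewrite /D tint_at0 ?phi0 ?lexx // Iint_set1; lra.
have [C C0 LC] := prim_lip pphi; have [_ [Cy Hy]] := ybm.
apply: (@quadratic_cst _ D Ft 0 t (C + C + `|Cy|)) => //.
  by rewrite !addr_ge0.
move=> c d c0 cd dt; have d0 := le_trans c0 cd.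
have okcd : weight `[0, d] phi.
  by apply: okw_sub ophi => //; exact: sub_itvcc.
rewrite /D (tint_split F c0 cd okcd).
have F1 : bounded_meas 0 t (fun u => 1 - Ft u) by apply: bmB;
  [exact: bm_cst | exact: cdf_bm].
rewrite (lint_split (c := c) c0 cd); last first.
  by apply/bm_lint/(bm_sub _ dt)/bmM.
have dF := cdf_le F c0 cd.
have Lcd := LC _ _ c0 cd dt.
have e : \int[leb]_(u in `[c, d]) (y u * (Ft c - Ft u)) =
    \int[leb]_(u in `[c, d]) (y u * (1 - Ft u)) - (1 - Ft c) * (phi d - phi c).
  have [_ ->] := pphi => //.
  have yl : itv_integrable c d y by exact/bm_lint/(bm_sub c0 dt).
  rewrite -mulNr -IintZ // -IintD; last 2 first.
  - by apply/bm_lint/(bm_sub c0 dt)/bmM.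
  - exact: lintZ.
  by apply: eq_Iint => u _; lra.
have b : `|\int[leb]_(u in `[c, d]) (y u * (Ft c - Ft u))|
    <= `|Cy| * (Ft d - Ft c) * (d - c).
  apply: Iint_norm_le => //.
    apply/bm_lint/(bm_sub c0 dt)/bmM => //.
    by apply: bmB; [exact: bm_cst | exact: cdf_bm].
  move=> u /andP[cu ud]; rewrite normrM ler_pM //.
    rewrite (le_trans _ (ler_norm Cy)) // Hy //.
    by rewrite (le_trans c0 cu) (le_trans ud dt).
  rewrite distrC ger0_norm ?subr_ge0 ?cdf_le // lerD2r.
  by rewrite cdf_le // (le_trans c0 cu).
have /andP[b1 b2] : (phi c - C * (d - c)) * (Ft d - Ft c) <= tint F `]c, d] phi
    <= (phi c + C * (d - c)) * (Ft d - Ft c).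
  have okoc : weight `]c, d] phi.
    apply: okw_sub ophi => // x /=; rewrite !in_itv /= => /andP[cx xd].
    by rewrite (le_trans c0 (ltW cx)) (le_trans xd dt).
  (* The lower bound is cut off at 0 because [tint_oc_bounds] requires it to be nonnegative. *)
  have /andP[b1 b2] := @tint_oc_bounds _ F c d phi
    (Num.max 0 (phi c - C * (d - c))) (phi c + C * (d - c)) c0 cd
    ltac:(by rewrite le_max lexx) okoc
    ltac:(move=> x /andP[cx xd];
      have := LC c x c0 (ltW cx) (le_trans xd dt);
      have := ler_wpM2l C0 (_ : x - c <= d - c);
      rewrite lerD2r => /(_ xd) h1; rewrite ler_norml => /andP[h2 h3];
      rewrite ge_max phi0 ?(le_trans c0 (ltW cx)) ?(le_trans xd dt) //=;
      apply/andP; split; lra).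
  rewrite b2 andbT (le_trans _ b1) // ler_wpM2r ?subr_ge0 //.
  by rewrite le_max lexx orbT.
move: b Lcd; rewrite e !ler_norml => /andP[b3 b4] /andP[b5 b6].
have b5' := ler_wpM2r (_ : 0 <= Ft d - Ft c) b5.
have b6' := ler_wpM2r (_ : 0 <= Ft d - Ft c) b6.
rewrite subr_ge0 in b5' b6'; have {}b5' := b5' dF; have {}b6' := b6' dF.
apply/andP; split; lra.
Qed.

Section IncreasingUnion.
Context (A : nat -> set R).
Context (mA : forall n, measurable (A n)).
Context (ndA : forall n k, (n <= k)%N -> A n `<=` A k).
Context (Apos : \bigcup_n A n `<=` pos).

Let U := \bigcup_n A n.
Let sub n : A n `<=` U. Proof. by move=> x Ax; exists n. Qed.
Let mU : measurable U. Proof. exact: bigcupT_measurable. Qed.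

Lemma bigcup_int_le (f : R -> R) c : measurable_fun U f ->
  (forall x, U x -> 0 <= f x) ->
  (exists N : nat, forall n : nat, (N <= n)%N ->
     (\int[leb]_(u in A n) (f u)%:E <= c%:E)%E) ->
  (\int[leb]_(u in U) (f u)%:E <= c%:E)%E.
Proof.
move=> mf f0 [N HN].
have := @ge0_nondecreasing_set_cvg_integral _ (measurableTypeR R) R
  A (EFin \o f) leb.
move=> cv; apply: (cvge_to_le (cv _ _ _ _)) => //.
- by move=> n k nk; apply/subsetPset; exact: ndA.
- by move=> n; apply/measurable_EFinP; exact: (measurable_funS _ (@sub n) mf).
- by move=> n x /sub Ux; rewrite lee_fin f0.
by exists N => // n /= Nn; exact: HN.
Qed.

(** A finite set [X] of atoms lies in some [A n], by monotonicity. Moving its mass to the right-hand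
    side leaves a pure Lebesgue integral, to which monotone convergence applies; the supremum over
    [X] comes last. *)
Lemma tint_bigcup_le (f h : R -> R) c :
  measurable_fun U f -> (forall x, U x -> 0 <= f x) ->
  (forall n, leb.-integrable (A n) (EFin \o f)) -> weight U h ->
  (exists N : nat, forall n : nat, (N <= n)%N ->
    \int[leb]_(u in A n) f u + tint F (A n) h <= c) ->
  \int[leb]_(u in U) f u + tint F U h <= c.
Proof.
move=> mf f0 fl oh [N HN].
have An_pos n : A n `<=` pos by move=> x /sub /Apos.
have [mh [C hC]] := oh.
have h0 x : U x -> 0 <= h x by move=> /hC /andP[].
have mhd : measurable_fun U (fun u => h u * dens F u).
  apply: measurable_funM => //.
  by apply: (measurable_funS _ Apos) => //; exact: dens_measurable.
have hd0 x : U x -> 0 <= h x * dens F x.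
  by move=> Ux; rewrite mulr_ge0 ?h0 // dens_ge0 //; exact/pos_ge0/Apos.
have oA n : weight (A n) h by exact: okw_sub oh.
have hdl n : leb.-integrable (A n) (EFin \o (fun u => h u * dens F u)).
  exact: okw_integrable.
pose k u := f u + h u * dens F u.
have mk : measurable_fun U k by exact: measurable_funD.
have k0 x : U x -> 0 <= k x by move=> x0; rewrite addr_ge0 ?f0 ?hd0.
have kl n : leb.-integrable (A n) (EFin \o k).
  by have := integrableD _ (fl n) (hdl n) => /(_ (mA n)).
have key X : fsets U X ->
    (\int[leb]_(u in U) (k u)%:E + \sum_(s \in X) (h s * atom F s)%:E <= c%:E)%E.
  move=> [finX XU].
  have [M XM] : exists M : nat, X `<=` A M.
    have [q eX] : exists q : seq R, X = [set` q] by exact/finite_seqP.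
    rewrite {}eX in XU *; elim: q XU => [|y q IH] XU; first by exists 0%N.
    have [M HM] : exists M : nat, [set` q] `<=` A M.
      by apply: IH => x /= xq; apply: XU; rewrite /= inE xq orbT.
    have [K _ HK] : U y by apply: XU; rewrite /= mem_head.
    exists (maxn M K) => x /=; rewrite inE => /predU1P[->|xq].
      exact: ndA (leq_maxr _ _) _ HK.
    by apply: ndA (leq_maxl _ _) _ _; exact: HM.
  have Xfin : \sum_(s \in X) (h s * atom F s)%:E \is a fin_num.
    by rewrite fsumEFin.
  set S := \sum_(s \in X) _ in Xfin *.
  rewrite -(fineK Xfin) -leeBrDr // -EFinB.
  apply: bigcup_int_le => //; exists (maxn N M) => n.
  rewrite geq_max => /andP[Nn Mn].
  rewrite -[leLHS]fineK; last first.
    by apply: integrable_fin_num; [exact: mA|exact: kl].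
  rewrite lee_fin -[X in X <= _]/(\int[leb]_(u in A n) k u).
  rewrite RintegralD; [|exact: mA|exact: fl|exact: hdl].
  have := HN _ Nn; rewrite /tint addrA.
  suff : fine S <= fine (\esum_(s in A n) (h s * atom F s)%:E) by lra.
  apply: fine_le => //; first exact: okw_atom_fin.
  by apply: esum_ge; exists X => //; split=> // x /XM; exact: ndA.
have kfin : (\int[leb]_(u in U) (k u)%:E)%E \is a fin_num.
  rewrite ge0_fin_numE; last by apply: integral_ge0 => x Ux; rewrite lee_fin k0.
  have := key _ (fsets_set0 _); rewrite fsbig_set0 adde0 => /le_lt_trans; apply.
  exact: ltry.
have ksum : (\int[leb]_(u in U) (k u)%:E =
    \int[leb]_(u in U) (f u)%:E + \int[leb]_(u in U) (h u * dens F u)%:E)%E.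
  by rewrite -ge0_integralD //; exact/measurable_EFinP.
have f_fin : (\int[leb]_(u in U) (f u)%:E)%E \is a fin_num.
  rewrite ge0_fin_numE; last exact: integral_ge0.
  apply: (@le_lt_trans _ _ (\int[leb]_(u in U) (k u)%:E)%E).
    by rewrite ksum leeDl // integral_ge0.
  by rewrite -ge0_fin_numE // integral_ge0.
have hd_fin : (\int[leb]_(u in U) (h u * dens F u)%:E)%E \is a fin_num.
  by apply: integrable_fin_num => //; exact: okw_integrable.
rewrite /tint addrA -fineD // -ksum -lee_fin EFinD fineK // fineK; last first.
  exact: okw_atom_fin.
rewrite addeC -leeBrDr // -(fineK kfin) -EFinB; apply: ge_ereal_sup =>
  _ [X HX <-].
by rewrite EFinB fineK // leeBrDr // addeC key.
Qed.

End IncreasingUnion.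

Lemma tint_pinfty_le (f h : R -> R) c :
  measurable_fun pos f -> (forall x : R, 0 <= x -> 0 <= f x) ->
  (forall t, itv_integrable 0 t f) -> weight pos h ->
  (exists N : nat, forall n : nat, (N <= n)%N ->
    \int[leb]_(u in `[0, n%:R]) f u + tint F `[0, n%:R] h <= c) ->
  \int[leb]_(u in pos) f u + tint F pos h <= c.
Proof.
move=> mf f0 fl oh HN.
have e : pos = \bigcup_(n : nat) (`[0%R, n%:R]%classic : set R).
  by rewrite itv_bndy_bigcup_BRight; apply: eq_bigcupr => n _; rewrite add0r.
rewrite e in mf oh *; apply: tint_bigcup_le => //; last 2 first.
- by rewrite -e => x /pos_ge0; exact: f0.
- by move=> n; exact: fl.
- move=> n k nk x /=; rewrite !in_itv /= => /andP[-> xn].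
  by rewrite (le_trans xn) // ler_nat.
- by rewrite -e.
Qed.

(** Otherwise [Ft] exceeds [Ft s + e] at every [s + 1 / n.+1]. Then each []s + 1 / n.+1, s + 1]] has
    mass at most [Ft (s + 1) - Ft s - e], and so has their union []s, s + 1]], a contradiction. *)
Lemma cdf_right_continuous s (e : R) : 0 <= s -> 0 < e ->
  exists2 d, 0 < d & forall x, s <= x -> x <= s + d -> Ft x <= Ft s + e.
Proof.
move=> s0 e0; apply/not_exists2P => H.
have {}H n : Ft s + e < Ft (s + n.+1%:R^-1).
  have n0 : 0 < n.+1%:R^-1 :> R by rewrite invr_gt0 ltr0n.
  have [] := H n.+1%:R^-1; first by rewrite n0.
  move=> Hn; rewrite ltNge; apply/negP => le; apply: Hn => x sx xn.
  by apply: le_trans (cdf_le F _ xn) le; exact: le_trans sx.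
pose A n := (`]s + n.+1%:R^-1, s + 1]%classic : set R).
have eA : `]s, s + 1]%classic = \bigcup_n A n.
  apply/seteqP; split => x.
    rewrite /= in_itv /= => /andP[sx xs].
    have xs0 : 0 < x - s by rewrite subr_gt0.
    exists (Num.bound (x - s)^-1) => //; rewrite /A /= in_itv /= xs andbT.
    rewrite -ltrBrDl invf_plt ?posrE ?ltr0n //.
    apply: (lt_le_trans (archi_boundP _)); last by rewrite ler_nat.
    by rewrite invr_ge0 ltW.
  move=> [n _]; rewrite /A /= !in_itv /= => /andP[h ->]; rewrite andbT.
  by apply: le_lt_trans h; rewrite lerDl invr_ge0.
have sA n : s + n.+1%:R^-1 <= s + 1.
  by rewrite lerD2l invf_le1 ?ltr0n // ler1n.
have n0 n : 0 <= s + n.+1%:R^-1 by rewrite addr_ge0.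
have := @tint_bigcup_le A _ _ _ (fun=> 0) (fun=> 1) (Ft (s + 1) - (Ft s + e)).
rewrite -eA => key.
suff : \int[leb]_(_ in `]s, s + 1]) 0 + tint F `]s, s + 1] (fun=> 1)
    <= Ft (s + 1) - (Ft s + e).
  rewrite -cdfB ?lerDl // /Rintegral integral0 /=; lra.
apply: key => //.
- by move=> n; exact: measurable_itv.
- move=> n k nk x; rewrite /A /= !in_itv /= => /andP[h ->]; rewrite andbT.
  by apply: le_lt_trans h; rewrite lerD2l lef_pV2 ?posrE ?ltr0n // ler_nat.
- exact: itvoc_pos.
- by move=> n; apply: (integrable0 leb).
- exact: okw1.
exists 0%N => n _; rewrite -cdfB // /Rintegral integral0 /= add0r.
by rewrite lerD2l lerN2 ltW.
Qed.

End TimingCalculus.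

(** * The primitives *)

Section Setting.
Context {R : realType} (p : primitives R) (tau : R).
Local Notation leb := (@lebesgue_measure R).
Local Notation th := (theta p).
Local Notation be := (beta p).
Local Notation m := (mu p).
Local Notation r := (rho p).
Local Notation H := (hazard p).

Record setting : Prop := Setting {
  theta01 : 0 < th < 1;
  beta_theta : 0 < be < th;
  mu_between : be < m < th;
  rho_gt0 : 0 < r;
  newsG : news_distribution p;
  phiA_lt_phiP : phiA p < phiP p;
  tauP_def : is_tauP p tau }.

Definition disc (t : R) : R := expR (- r * t) * (1 - G p t).
(** Each rate is named after the player whose timing it governs: faking at hazard [rateA] keeps the
    principal indifferent between stopping times, and stopping at hazard [rateP] keeps the agent
    indifferent between faking times. *)
Definition rateA (t : R) : R := (m * (1 - th) * H t - r * th) / (th - m).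
Definition rateP (t : R) : R := (be * (1 - m) * H t - r * m) / (m - be).

Context (st : setting).

Lemma theta_gt0 : 0 < th. Proof. by case/andP: (theta01 st). Qed.
Lemma theta_lt1 : th < 1. Proof. by case/andP: (theta01 st). Qed.
Lemma beta_gt0 : 0 < be. Proof. by case/andP: (beta_theta st). Qed.
Lemma beta_lt_mu : be < m. Proof. by case/andP: (mu_between st). Qed.
Lemma mu_lt_theta : m < th. Proof. by case/andP: (mu_between st). Qed.
Lemma mu_gt0 : 0 < m. Proof. exact: lt_trans beta_gt0 beta_lt_mu. Qed.
Lemma tau_gt0 : 0 < tau. Proof. by case: (tauP_def st). Qed.

Lemma survival_gt0 t : 0 < 1 - G p t.
Proof. by rewrite subr_gt0 (G_lt1 (newsG st)). Qed.

Lemma hazard_ge0 t : 0 <= t -> 0 <= H t.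
Proof.
by move=> t0; apply: divr_ge0;
  [exact: (g_ge0 (newsG st)) | exact/ltW/survival_gt0].
Qed.

Lemma hazardE t : g p t = H t * (1 - G p t).
Proof. by rewrite /hazard divfK // gt_eqF // survival_gt0. Qed.

Lemma hazard_nonincr s t : 0 <= s -> s <= t -> H t <= H s.
Proof. exact: hazard_decreasing (newsG st) s t. Qed.

Lemma hazard_bm t : bounded_meas 0 t H.
Proof. by apply: bm_noninc => s u s0 su _; exact: hazard_nonincr. Qed.

Lemma G_bm t : bounded_meas 0 t (G p).
Proof. by apply: bm_nondec => s u _ su _; exact: (G_nondecreasing (newsG st)).
  Qed.

Lemma g_bm t : bounded_meas 0 t (g p).
Proof.
apply: (@bm_eq _ _ _ (fun u => H u * (1 - G p u))).
  by move=> u _; rewrite hazardE.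
by apply: bmM; [exact: hazard_bm | apply: bmB; [exact: bm_cst | exact: G_bm]].
Qed.

Lemma G_int t : 0 <= t -> G p t = \int[leb]_(u in `[0, t]) g p u.
Proof. by move=> t0; rewrite /Rintegral -(G_density (newsG st)). Qed.

Lemma prim_G t : primitive 0 t (G p) (g p).
Proof.
split; first exact: g_bm.
move=> s u s0 su ut; rewrite !G_int ?(le_trans s0) //.
by rewrite (lint_split s0 su (bm_lint (g_bm u))) addrC addKr.
Qed.

Lemma prim_id (a b : R) : primitive a b id (fun=> 1).
Proof. by split; [exact: bm_cst | move=> s t _ st' _;
  rewrite Iint_cst // mul1r]. Qed.

Lemma prim_disc t : primitive 0 t disc (fun u => - (r + H u) * disc u).
Proof.
have pe := prim_expR (primZ (- r) (prim_id 0 t)).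
have pG := primD (prim_cst 0 t 1) (primZ (-1) (prim_G t)).
apply: (eq_primF _ (eq_prim _ (primM pe pG))) => u _; rewrite /disc.
  by rewrite mulN1r.
by rewrite hazardE; ring.
Qed.

Lemma disc_gt0 t : 0 < disc t.
Proof. by rewrite mulr_gt0 ?expR_gt0 ?survival_gt0. Qed.

Lemma disc0 : disc 0 = 1.
Proof. by rewrite /disc mulr0 expR0 mul1r (G_le0 (newsG st)) // subr0. Qed.

Lemma disc_nonincr s t : s <= t -> disc t <= disc s.
Proof.
move=> st'; rewrite ler_pM ?expR_ge0 //; first exact: ltW (survival_gt0 t).
  by rewrite ler_expR ler_nM2l // oppr_lt0 (rho_gt0 st).
by rewrite lerB // (G_nondecreasing (newsG st)).
Qed.

Lemma disc_bm t : bounded_meas 0 t disc.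
Proof. exact: prim_bm (prim_disc t). Qed.

Lemma disc_le1 t : 0 <= t -> disc t <= 1.
Proof. by move=> /disc_nonincr; rewrite disc0. Qed.

Lemma hazard_tau : H tau = phiP p. Proof. by case: (tauP_def st). Qed.

(** The hazard rate is only weakly decreasing; strictness comes from [tau] being the sole solution
    of [hazard t = phiP]. *)
Lemma hazard_before t : 0 <= t -> t < tau -> phiP p < H t.
Proof.
move=> t0 tt; rewrite lt_def -hazard_tau (hazard_nonincr t0 (ltW tt)) andbT.
apply/eqP => e; have [_ _ /(_ t t0)] := tauP_def st.
by rewrite e hazard_tau => /(_ erefl) tE; rewrite tE ltxx in tt.
Qed.

Lemma hazard_after t : tau < t -> H t < phiP p.
Proof.
move=> tt; have t0 := lt_trans tau_gt0 tt.
rewrite lt_def -hazard_tau (hazard_nonincr (ltW tau_gt0) (ltW tt)) andbT.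
apply/eqP => e; have [_ _ /(_ t (ltW t0))] := tauP_def st.
by rewrite -e hazard_tau => /(_ erefl) tE; rewrite tE ltxx in tt.
Qed.

Lemma phiPE : m * (1 - th) * phiP p = r * th.
Proof.
rewrite /phiP mulrC divfK // gt_eqF // mulr_gt0 ?mu_gt0 // subr_gt0.
exact: theta_lt1.
Qed.

Lemma gainP_gt0 t : 0 <= t -> t < tau -> 0 < m * (1 - th) * H t - r * th.
Proof.
move=> t0 tt; rewrite -phiPE -mulrBr mulr_gt0 ?mulr_gt0 ?mu_gt0 ?subr_gt0
  ?theta_lt1 //.
exact: hazard_before.
Qed.

Lemma g_gt0 t : 0 <= t -> t < tau -> 0 < g p t.
Proof.
move=> t0 tt; rewrite hazardE mulr_gt0 ?survival_gt0 //.
have h := gainP_gt0 t0 tt; rewrite lt_def hazard_ge0 // andbT.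
apply/eqP => e; move: h; rewrite e mulr0 sub0r oppr_gt0 ltNge.
by rewrite mulr_ge0 // ltW ?theta_gt0 // (rho_gt0 st).
Qed.

Lemma gainP_tau : m * (1 - th) * H tau - r * th = 0.
Proof. by rewrite -phiPE hazard_tau subrr. Qed.

Lemma gainP_lt0 t : tau < t -> m * (1 - th) * H t - r * th < 0.
Proof.
move=> tt; rewrite -phiPE -mulrBr pmulr_rlt0 ?subr_lt0 ?hazard_after //.
by rewrite mulr_gt0 ?mu_gt0 ?subr_gt0 ?theta_lt1.
Qed.

(** With certain acceptance and an idle principal, delaying a fake changes the agent's payoff at the
    rate [be * (1 - m) * H t - r * m], up to the factor [waiting]. This is its value at [tau], its
    minimum over [[0, tau]]; assumption (A2) makes it positive. *)
Definition gainA0 : R := be * (1 - m) * phiP p - r * m.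

Lemma gainA0_gt0 : 0 < gainA0.
Proof.
have m1 : m < 1 by exact: lt_trans mu_lt_theta theta_lt1.
have : be * (1 - m) * phiA p < be * (1 - m) * phiP p.
  by rewrite ltr_pM2l ?(phiA_lt_phiP st) // mulr_gt0 ?beta_gt0 ?subr_gt0.
suff -> : be * (1 - m) * phiA p = r * m by rewrite /gainA0 subr_gt0.
by rewrite /phiA mulrC divfK // gt_eqF // mulr_gt0 ?beta_gt0 // subr_gt0.
Qed.

Lemma gainA_ge t : 0 <= t -> t <= tau -> gainA0 <= be * (1 - m) * H t - r * m.
Proof.
have m1 : m < 1 by exact: lt_trans mu_lt_theta theta_lt1.
move=> t0 tt; rewrite /gainA0 lerD2r ler_wpM2l //.
  by rewrite mulr_ge0 ?ltW ?beta_gt0 ?subr_gt0.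
by rewrite -hazard_tau hazard_nonincr.
Qed.

Lemma rateA_gt0 t : 0 <= t -> t < tau -> 0 < rateA t.
Proof. by move=> t0 tt; rewrite divr_gt0 ?gainP_gt0 // subr_gt0 mu_lt_theta. Qed.

Lemma rateA_ge0 t : 0 <= t -> t <= tau -> 0 <= rateA t.
Proof.
move=> t0; rewrite le_eqVlt => /predU1P[->|/rateA_gt0 h]; last exact/ltW/h.
by rewrite /rateA gainP_tau mul0r.
Qed.

Lemma rateAE t : (th - m) * rateA t = m * (1 - th) * H t - r * th.
Proof. by rewrite mulrC divfK // subr_eq0 gt_eqF ?mu_lt_theta. Qed.

Lemma ratePE t : (m - be) * rateP t = be * (1 - m) * H t - r * m.
Proof. by rewrite mulrC divfK // subr_eq0 gt_eqF ?beta_lt_mu. Qed.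

Lemma rateP_gt0 t : 0 <= t -> t <= tau -> 0 < rateP t.
Proof.
move=> t0 tt; apply: divr_gt0; last by rewrite subr_gt0 beta_lt_mu.
exact: lt_le_trans gainA0_gt0 (gainA_ge t0 tt).
Qed.

Lemma rateA_bm t : bounded_meas 0 t rateA.
Proof.
apply: bmM; last exact: bm_cst.
apply: bmB; last exact: bm_cst.
by apply: bmM; [exact: bm_cst | exact: hazard_bm].
Qed.

Lemma rateP_bm t : bounded_meas 0 t rateP.
Proof.
apply: bmM; last exact: bm_cst.
apply: bmB; last exact: bm_cst.
by apply: bmM; [exact: bm_cst | exact: hazard_bm].
Qed.

(** Indifference yields an equation for [disc * Y], with [Y] being [unfaked] or [1 - cdf FP]. Since
    [disc] solves the same equation with [k = 0], it cancels. *)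
Lemma disc_linear s b k Y : 0 <= s -> bounded_meas s b k ->
  primitive s b (fun u => disc u * Y u)
    (fun u => - (r + H u + k u) * (disc u * Y u)) ->
  forall t, s <= t <= b ->
    Y t = Y s * expR (- \int[leb]_(u in `[s, t]) k u).
Proof.
move=> sge0 kbm pY t stb; have /andP[st' tb] := stb.
have dk : bounded_meas s b (fun u => - (r + H u)).
  apply: bmN; apply: bmD; first exact: bm_cst.
  exact: bm_sub sge0 (lexx b) (hazard_bm b).
have kl : itv_integrable s t k by exact/bm_lint/(bm_sub (lexx s) tb).
have dl : itv_integrable s t (fun u =>
  - (r + H u)) by exact/bm_lint/(bm_sub (lexx s) tb).
have hd := prim_linear (prim_sub sge0 (lexx b) (prim_disc b)) dk stb.
have kk : bounded_meas s b (fun u => - (r + H u + k u)).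
  apply: (@bm_eq _ _ _ (fun u => - (r + H u) - k u)); first by move=> u _; ring.
  exact: bmB.
have := prim_linear pY kk stb; rewrite hd.
have -> : \int[leb]_(u in `[s, t]) - (r + H u + k u) =
    \int[leb]_(u in `[s, t]) - (r + H u) - \int[leb]_(u in `[s, t]) k u.
  rewrite -mulN1r -IintZ // -IintD //; last exact: lintZ.
  by apply: eq_Iint => u _; ring.
rewrite expRD => e; have d0 := disc_gt0 s.
set E := expR (\int[leb]_(u in `[s, t]) - (r + H u)) in e *.
have E0 : disc s * E != 0 by rewrite gt_eqF // mulr_gt0 // expR_gt0.
apply: (mulfI E0); rewrite e; ring.
Qed.

End Setting.

(** * Payoffs as integrals of rates *)

Section Measurability.
Context {R : realType}.
Local Notation pos := (`[0%R, +oo[%classic : set R).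

Lemma pos_measurable (f : R -> R) : (forall t, bounded_meas 0 t f) ->
  measurable_fun pos f.
Proof.
move=> fb.
have -> : pos = \bigcup_(n : nat) (`[0%R, n%:R]%classic : set R).
  by rewrite itv_bndy_bigcup_BRight; apply: eq_bigcupr => n _; rewrite add0r.
by apply/measurable_fun_bigcup => // n; case: (fb n%:R).
Qed.

Lemma bm_pos (f : R -> R) t C : measurable_fun pos f ->
  (forall u, 0 <= u <= t -> `|f u| <= C) -> bounded_meas 0 t f.
Proof.
move=> mf fC; split; last by exists C.
by apply: (measurable_funS _ _ mf) => //; exact: itvcc_pos.
Qed.

Lemma upto_fin (t : R) : upto t%:E = `[0, t]%classic.
Proof.
apply/seteqP; split => u; rewrite /= in_itv /=.
  by move=> [-> ut] /=; rewrite -lee_fin.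
by move=> /andP[u0 ut]; split=> //; rewrite lee_fin.
Qed.

Lemma upto_pinfty : upto (+oo%E : \bar R) = pos.
Proof.
apply/seteqP; split => u; rewrite /= in_itv /= andbT.
  by case.
by move=> u0; split=> //; exact: leey.
Qed.

End Measurability.

(** * The principal's payoff *)

Section Payoffs.
Context {R : realType} (p : primitives R) (tau : R) (st : setting p tau).
Context (sigma : R) (hs : 0 < sigma < 1).
Context (a : acceptance R) (FP FA : timing R).
Local Notation leb := (@lebesgue_measure R).
Local Notation pos := (`[0%R, +oo[%classic : set R).
Local Notation th := (theta p).
Local Notation be := (beta p).
Local Notation m := (mu p).
Local Notation r := (rho p).
Local Notation H := (hazard p).

Definition unfaked (u : R) : R := 1 - sigma * cdf FA u.
Definition realnews (u : R) : R := m * g p u * unfaked u.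
Definition fakenews (u : R) : R := sigma * dens FA u * (1 - G p u).
(* The rate of w_1^P * a * (mu1 - theta), up to discounting.  The best reply a
   vanishes at the atoms of FA and where mu1 is the junk value 0 / 0 = 0, so
   this holds at every time and not only almost everywhere. *)
Definition surplus (u : R) : R :=
  a u * ((1 - th) * realnews u - (th - m) * fakenews u).
Definition uP_rate (u : R) : R :=
  expR (- r * u) * surplus u - r * th * (disc p u * unfaked u).

Let s0 : 0 < sigma. Proof. by case/andP: hs. Qed.
Let s1 : sigma < 1. Proof. by case/andP: hs. Qed.

Lemma unfaked_ge u : 1 - sigma <= unfaked u.
Proof.
by rewrite /unfaked lerB // ler_piMr ?(ltW s0) ?cdf_le1.
Qed.

Lemma unfaked_gt0 u : 0 < unfaked u.
Proof. by rewrite (lt_le_trans _ (unfaked_ge u)) // subr_gt0. Qed.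

Lemma unfaked_le1 u : unfaked u <= 1.
Proof. by rewrite /unfaked gerBl mulr_ge0 ?(ltW s0) ?cdf_ge0. Qed.

Lemma unfaked_bm t : bounded_meas 0 t unfaked.
Proof.
by apply: bmB; [exact: bm_cst | apply: bmM; [exact: bm_cst | exact: cdf_bm]].
Qed.

Lemma realnews_ge0 u : 0 <= u -> 0 <= realnews u.
Proof.
move=> u0; apply: mulr_ge0; last exact: ltW (unfaked_gt0 u).
by apply: mulr_ge0; [exact/ltW/(mu_gt0 st) | exact: (g_ge0 (newsG st))].
Qed.

Lemma realnews_gt0 u : 0 < g p u -> 0 < realnews u.
Proof. by move=> g0; rewrite !mulr_gt0 ?(mu_gt0 st) ?unfaked_gt0. Qed.

Lemma fakenews_ge0 u : 0 <= u -> 0 <= fakenews u.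
Proof.
move=> u0; apply: mulr_ge0; last exact: ltW (survival_gt0 st u).
by apply: mulr_ge0; [exact: ltW | exact: dens_ge0].
Qed.

Lemma realnews_bm t : bounded_meas 0 t realnews.
Proof.
apply: bmM; last exact: unfaked_bm.
by apply: bmM; [exact: bm_cst | exact: (g_bm st)].
Qed.

Lemma acc_bm t : bounded_meas 0 t a.
Proof.
apply: (@bm_pos _ _ _ 1) => [|u /andP[u0 _]]; first exact: acc_measurable.
by have /andP[a0 a1] := acc_itv a u0; rewrite ger0_norm.
Qed.

(** Stated apart from [equilibrium], so that the payoff formulas also apply to the profile under
    construction in the existence part. *)
Definition picA := forall t : R, 0 <= t ->
  (th < mu1 p sigma FA t -> a t = 1) /\ (mu1 p sigma FA t < th -> a t = 0).

Context (pic : picA).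

Lemma mu1E u : atom FA u = 0 -> mu1 p sigma FA u =
  (realnews u + m * fakenews u) / (realnews u + fakenews u).
Proof. by rewrite /mu1 => ->; rewrite ltxx. Qed.

Lemma acc_atom u : 0 <= u -> 0 < atom FA u -> a u = 0.
Proof.
move=> u0 at0; have [_] := pic u0; apply.
by rewrite /mu1 at0 (mu_lt_theta st).
Qed.

Lemma news_eq0 u : 0 <= u -> realnews u + fakenews u = 0 -> a u = 0.
Proof.
move=> u0 e; have := atom_ge0 FA u; rewrite le_eqVlt => /predU1P[/esym at0|].
  (* Without any news [mu1] is 0 / 0 = 0, which lies below [theta] and forces rejection. *)
  have [_] := pic u0; apply; rewrite mu1E // e invr0 mulr0; exact: (theta_gt0 st).
exact: acc_atom.
Qed.

Lemma news_gt0 u : 0 <= u -> realnews u + fakenews u != 0 ->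
  0 < realnews u + fakenews u.
Proof. by move=> u0 e; rewrite lt_def e addr_ge0 ?realnews_ge0 ?fakenews_ge0. Qed.

Lemma surplusE u : 0 <= u ->
  a u * (mu1 p sigma FA u - th) = surplus u / (realnews u + fakenews u).
Proof.
move=> u0; have := atom_ge0 FA u; rewrite le_eqVlt => /predU1P[/esym at0|at0].
  have [e|ne] := eqVneq (realnews u + fakenews u) 0.
    by rewrite /surplus news_eq0 // !mul0r.
  by rewrite mu1E // /surplus; field.
by rewrite /surplus acc_atom // !mul0r.
Qed.

(** Rejection kills the first factor of [surplus], and mixing requires [mu1 = theta], which kills
    the second. So a nonzero surplus goes with certain acceptance. *)
Lemma surplus_cases u : 0 <= u ->
  (a u = 1 /\ 0 <= (1 - th) * realnews u - (th - m) * fakenews u) \/ surplus u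
    = 0.
Proof.
move=> u0; have [p1 p2] := pic u0.
have [e|ne] := eqVneq (realnews u + fakenews u) 0.
  by right; rewrite /surplus news_eq0 // mul0r.
have := atom_ge0 FA u; rewrite le_eqVlt => /predU1P[/esym at0|at0]; last first.
  by right; rewrite /surplus acc_atom // mul0r.
rewrite mu1E // in p1 p2; have n0 := news_gt0 u0 ne.
have [lt|lt|e] := ltgtP th ((realnews u + m * fakenews u) / (realnews u +
  fakenews u)).
- left; split; first exact: p1.
  by move: lt; rewrite ltr_pdivlMr //; lra.
- by right; rewrite /surplus p2 // mul0r.
- right; rewrite /surplus (_ : _ - _ = 0) ?mulr0 //.
  have : th * (realnews u + fakenews u) = realnews u + m * fakenews u.
    by rewrite e divfK.
  lra.
Qed.

Lemma surplus_ge0 u : 0 <= u -> 0 <= surplus u.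
Proof. by move=> /surplus_cases[[e h]|->//]; rewrite /surplus e mul1r. Qed.

(** Fakes only lower the surplus, so the bound is free of [dens FA], which may be unbounded. This is
    what makes [uP] Lipschitz in the stopping time. *)
Lemma surplus_le u : 0 <= u -> surplus u <= (1 - th) * realnews u.
Proof.
move=> u0; have [[e h]|->] := surplus_cases u0; last first.
  by rewrite mulr_ge0 ?realnews_ge0 // subr_ge0 ltW // (theta_lt1 st).
rewrite /surplus e mul1r gerBl mulr_ge0 ?fakenews_ge0 // subr_ge0 ltW //.
exact: (mu_lt_theta st).
Qed.

Lemma surplus_lt1 u : 0 <= u -> a u != 1 -> surplus u = 0.
Proof. by move=> u0 /eqP au; have [[]|] := surplus_cases u0. Qed.

Lemma acc_inactive u : 0 <= u -> 0 < g p u -> ~ active FA u%:E -> a u = 1.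
Proof.
move=> u0 g0 An.
have d0 : dens FA u = 0.
  apply/eqP; rewrite eq_le dens_ge0 // andbT leNgt; apply/negP => d0.
  by apply: An; left.
have at0 : atom FA u = 0.
  apply/eqP; rewrite eq_le atom_ge0 andbT leNgt; apply/negP => at0.
  by apply: An; right.
have [+ _] := pic u0; apply;
  rewrite mu1E // /fakenews d0 mulr0 mul0r mulr0 !addr0.
by rewrite divff ?gt_eqF ?realnews_gt0 // (theta_lt1 st).
Qed.

Lemma acc_noreal u : 0 <= u -> g p u = 0 -> ~ active FA u%:E -> a u = 0.
Proof.
move=> u0 g0 An.
have d0 : dens FA u = 0.
  apply/eqP; rewrite eq_le dens_ge0 // andbT leNgt; apply/negP => d0.
  by apply: An; left.
by apply: news_eq0 => //; rewrite /realnews /fakenews d0 g0 !(mulr0, mul0r) addr0.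
Qed.

Lemma acc1_atom u : 0 <= u -> a u = 1 -> atom FA u = 0.
Proof.
move=> u0 a1; apply/eqP; rewrite eq_le atom_ge0 andbT leNgt; apply/negP => at0.
by move: (acc_atom u0 at0); rewrite a1 => /eqP; rewrite oner_eq0.
Qed.

Lemma acc1_fake u : 0 <= u -> a u = 1 ->
  (th - m) * fakenews u <= (1 - th) * realnews u.
Proof.
move=> u0 a1; rewrite -subr_ge0.
by have [[_ //]|] := surplus_cases u0; rewrite /surplus a1 mul1r => ->.
Qed.

Lemma fakenews_pos_measurable : measurable_fun pos fakenews.
Proof.
apply: measurable_funM; last by apply: pos_measurable => t; apply: bmB;
  [exact: bm_cst|exact: (G_bm st)].
by apply: measurable_funM; [exact: measurable_cst|exact: dens_measurable].
Qed.

Lemma surplus_bm t : bounded_meas 0 t surplus.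
Proof.
have [_ [C HC]] := realnews_bm t.
apply: (@bm_pos _ _ _ ((1 - th) * C)) => [|u /andP[u0 ut]].
  apply: measurable_funM; first exact: acc_measurable.
  apply: measurable_funB; apply: measurable_funM; try exact: measurable_cst.
    by apply: pos_measurable => v; exact: realnews_bm.
  exact: fakenews_pos_measurable.
rewrite ger0_norm ?surplus_ge0 // (le_trans (surplus_le u0)) // ler_wpM2l //.
  by rewrite subr_ge0 ltW // (theta_lt1 st).
by rewrite (le_trans (ler_norm _)) // HC // u0.
Qed.

(** The excess of [newsP] over [theta], by [surplusE]. Written as this quotient it avoids the case
    distinction on atoms in [mu1], and its measurability and its bounds follow from those of
    [surplus]. *)
Definition margin (u : R) : R := surplus u / (realnews u + fakenews u).

Lemma margin_ge0 u : 0 <= u -> 0 <= margin u.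
Proof.
by move=> u0; rewrite divr_ge0 ?surplus_ge0 // addr_ge0 ?realnews_ge0
  ?fakenews_ge0.
Qed.

Lemma margin_le1 u : 0 <= u -> margin u <= 1.
Proof.
move=> u0; have [e|ne] := eqVneq (realnews u + fakenews u) 0.
  by rewrite /margin e invr0 mulr0.
rewrite ler_pdivrMr ?news_gt0 // mul1r (le_trans (surplus_le u0)) //.
have := realnews_ge0 u0; have := fakenews_ge0 u0; have := theta_gt0 st; nra.
Qed.

Lemma marginM u : 0 <= u -> margin u * (realnews u + fakenews u) = surplus u.
Proof.
move=> u0; have [e|ne] := eqVneq (realnews u + fakenews u) 0.
  by rewrite e mulr0 /surplus news_eq0 // mul0r.
by rewrite /margin divfK.
Qed.

Lemma margin_measurable : measurable_fun pos margin.
Proof.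
(* On nonnegative reals the power -1 is the inverse, at 0 included, where both are 0. *)
apply: (@eq_measurable_fun _ _ _ _ _
  (fun u => surplus u * (realnews u + fakenews u) `^ (-1))).
  move=> u; rewrite inE => /pos_ge0 u0.
  by rewrite powR_inv1 // addr_ge0 ?realnews_ge0 ?fakenews_ge0.
apply: measurable_funM; first by apply: pos_measurable => t; exact: surplus_bm.
apply: (measurableT_comp (measurable_powR (-1))).
apply: measurable_funD; last exact: fakenews_pos_measurable.
by apply: pos_measurable => t; exact: realnews_bm.
Qed.

Lemma margin_bm t : bounded_meas 0 t margin.
Proof.
apply: (@bm_pos _ _ _ 1) => [|u /andP[u0 _]]; first exact: margin_measurable.
by rewrite ger0_norm ?margin_ge0 ?margin_le1.
Qed.

Lemma newsPE u : 0 <= u -> newsP p sigma a FA u = th + margin u.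
Proof. by move=> u0; rewrite /margin -surplusE // /newsP; ring. Qed.

Lemma exp_bm t : bounded_meas 0 t (fun u => expR (- r * u)).
Proof. exact: prim_bm (prim_expR (primZ (- r) (prim_id 0 t))). Qed.

Lemma uP_rate_bm t : bounded_meas 0 t uP_rate.
Proof.
apply: bmB; first by apply: bmM; [exact: exp_bm|exact: surplus_bm].
apply: bmM; first exact: bm_cst.
by apply: bmM; [exact: (disc_bm st)|exact: unfaked_bm].
Qed.

Let f1 u := expR (- r * u)
  * ((1 - m) * g p u * (1 - sigma * cdf FA u) * th
     + m * g p u * (1 - sigma * cdf FA u) * newsP p sigma a FA u).
Let h1 u := expR (- r * u) * (sigma * (1 - G p u) * newsP p sigma a FA u).

Let f1E u : 0 <= u ->
  f1 u = th * (H u * disc p u * unfaked u) + m * (H u * disc p u * unfaked u)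
    * margin u.
Proof. by move=> u0; rewrite /f1 newsPE // (hazardE st) /disc /unfaked; ring. Qed.

Let h1E u : 0 <= u -> h1 u = sigma * th * disc p u + sigma * disc p u * margin u.
Proof. by move=> u0; rewrite /h1 newsPE // /disc; ring. Qed.

Let hdq_bm t : bounded_meas 0 t (fun u => H u * disc p u * unfaked u).
Proof.
apply: bmM; last exact: unfaked_bm.
by apply: bmM; [exact: (hazard_bm st)|exact: (disc_bm st)].
Qed.

Let f1_bm t : bounded_meas 0 t f1.
Proof.
apply: (@bm_eq _ _ _ (fun u =>
  th * (H u * disc p u * unfaked u) + m * (H u * disc p u * unfaked u) *
    margin u)).
  by move=> u /andP[u0 _]; rewrite f1E.
apply: bmD; first by apply: bmM; [exact: bm_cst|exact: hdq_bm].
by apply: bmM; [apply: bmM; [exact: bm_cst|exact: hdq_bm]|exact: margin_bm].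
Qed.

Let h1_bm t : bounded_meas 0 t h1.
Proof.
apply: (@bm_eq _ _ _ (fun u =>
  sigma * th * disc p u + sigma * disc p u * margin u)).
  by move=> u /andP[u0 _]; rewrite h1E.
apply: bmD; first by apply: bmM; [exact: bm_cst|exact: (disc_bm st)].
by apply: bmM; [apply: bmM; [exact: bm_cst|exact: (disc_bm st)]|exact: margin_bm].
Qed.

Lemma dens_lint (F : timing R) (t : R) : itv_integrable 0 t (dens F).
Proof. by apply: dens_integrable => //; exact: itvcc_pos. Qed.

Lemma disc_tint (F : timing R) t : 0 <= t ->
  tint F `[0, t] (disc p) + disc p t * (1 - cdf F t) =
  1 - \int[leb]_(u in `[0, t]) ((r + H u) * disc p u * (1 - cdf F u)).
Proof.
move=> t0; rewrite (tint_parts F t0 (prim_disc st t)); last first.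
  by move=> x _; exact: ltW (disc_gt0 st x).
rewrite (disc0 st); congr (_ + _).
rewrite -mulN1r -IintZ; last first.
  apply/bm_lint/bmM; last by apply: bmB; [exact: bm_cst|exact: cdf_bm].
  apply: bmM; last exact: (disc_bm st).
  by apply: bmD; [exact: bm_cst|exact: (hazard_bm st)].
by apply: eq_Iint => u _; ring.
Qed.

Let tint_h1 t : 0 <= t -> tint FA `[0, t] h1 =
  sigma * th * tint FA `[0, t] (disc p)
  + \int[leb]_(u in `[0, t]) (sigma * disc p u * margin u * dens FA u).
Proof.
move=> t0.
have od : weight `[0, t] (disc p).
  by apply: bm_okw; [exact: (disc_bm st)|move=> x _; exact: ltW (disc_gt0 st x)].
rewrite -tintZ //; last 3 first.
- exact: itvcc_pos.
- by rewrite mulr_ge0 ?(ltW s0) // ltW // (theta_gt0 st).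
- by move=> x; exact: ltW (disc_gt0 st x).
rewrite /tint addrAC -IintD; last 2 first.
- apply: lintM; last exact: dens_lint.
  by apply: bmM; [exact: bm_cst|exact: (disc_bm st)].
- apply: lintM; last exact: dens_lint.
  apply: bmM; last exact: margin_bm.
  by apply: bmM; [exact: bm_cst|exact: (disc_bm st)].
congr (_ + fine _).
  by apply: eq_Iint => u /andP[u0 _]; rewrite h1E //; ring.
apply: eq_esum => u /=; rewrite in_itv /= => /andP[u0 _]; congr (_%:E).
(* News at an atom of [FA] is rejected and earns exactly [theta], so the margin integrates against
   the density alone. *)
have := atom_ge0 FA u; rewrite le_eqVlt => /predU1P[<-|at0];
  first by rewrite !mulr0.
by rewrite h1E // /margin /surplus acc_atom // !mul0r mulr0 addr0.
Qed.

Lemma uP_fin t : 0 <= t ->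
  uP p sigma a FA t%:E = th + \int[leb]_(u in `[0, t]) uP_rate u.
Proof.
move=> t0; rewrite /uP upto_fin -/f1 -/h1 tint_h1 //.
have qbm : bounded_meas 0 t (fun u => 1 - cdf FA u).
  by apply: bmB; [exact: bm_cst|exact: cdf_bm].
have dbm := disc_bm st t; have ubm := unfaked_bm t; have Hbm := hazard_bm st t.
have rHbm : bounded_meas 0 t (fun u => (r + H u) * disc p u).
  by apply: bmM => //; apply: bmD => //; exact: bm_cst.
have e1 : \int[leb]_(u in `[0, t]) f1 u =
  th * \int[leb]_(u in `[0, t]) (H u * disc p u * unfaked u)
  + \int[leb]_(u in `[0, t]) (m * (H u * disc p u * unfaked u) * margin u).
  rewrite -IintZ; last exact: bm_lint.
  rewrite -IintD; last 2 first.
  - by apply/lintZ/bm_lint.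
  - by apply/bm_lint/bmM; [apply: bmM => //; exact: bm_cst|exact: margin_bm].
  by apply: eq_Iint => u /andP[u0 _]; rewrite f1E.
(* By [marginM] the margins on real and on fake news add up to [surplus]. *)
have e2 : \int[leb]_(u in `[0, t]) (m * (H u * disc p u * unfaked u) * margin u)
   + \int[leb]_(u in `[0, t]) (sigma * disc p u * margin u * dens FA u)
   = \int[leb]_(u in `[0, t]) (expR (- r * u) * surplus u).
  rewrite -IintD; last 2 first.
  - by apply/bm_lint/bmM; [apply: bmM => //; exact: bm_cst|exact: margin_bm].
  - apply: lintM; last exact: dens_lint.
    by apply: bmM; [apply: bmM => //; exact: bm_cst|exact: margin_bm].
  apply: eq_Iint => u /andP[u0 _]; rewrite -marginM // /realnews /fakenews.
  by rewrite (hazardE st) /disc; ring.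
have e3 : \int[leb]_(u in `[0, t]) uP_rate u =
   \int[leb]_(u in `[0, t]) (expR (- r * u) * surplus u)
   - r * th * \int[leb]_(u in `[0, t]) (disc p u * unfaked u).
  rewrite -mulNr -IintZ; last by apply/bm_lint/bmM.
  rewrite -IintD; last 2 first.
  - by apply/bm_lint/bmM; [exact: exp_bm|exact: surplus_bm].
  - by apply/lintZ/bm_lint/bmM.
  by apply: eq_Iint => u _; rewrite /uP_rate; ring.
have e4 := disc_tint FA t0.
have e5 : disc p t = 1 - \int[leb]_(u in `[0, t]) ((r + H u) * disc p u).
  have [_ /(_ 0 t (lexx 0) t0 (lexx t))] := prim_disc st t.
  rewrite (disc0 st) => e; rewrite -[LHS](subrK 1) e addrC; congr (_ + _).
  rewrite -mulN1r -IintZ; last exact: bm_lint.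
  by apply: eq_Iint => u _; ring.
have e6 : \int[leb]_(u in `[0, t]) ((r + H u) * disc p u * (1 - cdf FA u)) * sigma
  + (1 - sigma) * \int[leb]_(u in `[0, t]) ((r + H u) * disc p u)
  = r * \int[leb]_(u in `[0, t]) (disc p u * unfaked u)
    + \int[leb]_(u in `[0, t]) (H u * disc p u * unfaked u).
  rewrite mulrC -!IintZ; try by apply/bm_lint; try exact: bmM.
  rewrite -!IintD; try by [apply/lintZ/bm_lint; try exact: bmM | exact/bm_lint].
  by apply: eq_Iint => u _; rewrite /unfaked; ring.
have e7 : expR (- r * t) * ((1 - G p t) * (1 - sigma * cdf FA t)) * th =
   th * (disc p t * (1 - sigma * cdf FA t)) by rewrite /disc; ring.
rewrite e7 e1 e3 -e2.
set I1 := \int[leb]_(u in `[0, t]) (H u * disc p u * unfaked u) in e6 *.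
set I2 := \int[leb]_(u in `[0, t]) (disc p u * unfaked u) in e6 *.
set I3 := \int[leb]_(u in `[0, t]) ((r + H u) * disc p u) in e5 e6 *.
set I4 := \int[leb]_(u in `[0, t]) ((r + H u) * disc p u * (1 - cdf FA u)) in
  e4 e6 *.
set T := tint FA _ _ in e4 *.
(* One unit paid at the first news, real or fake, or else at [t] is worth 1 less the interest lost
   by waiting. Times [theta], this is the payoff if every piece of news is answered by the safe
   action. *)
have e8 : I1 + sigma * T + disc p t * (1 - sigma * cdf FA t) = 1 - r * I2.
  have e4' : sigma * (T + disc p t * (1 - cdf FA t)) = sigma * (1 - I4) by
    rewrite e4.
  have e5' : (1 - sigma) * disc p t = (1 - sigma) * (1 - I3) by rewrite {1}e5.
  lra.
by move: e8 => /(congr1 (fun x => th * x)); lra.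
Qed.

Lemma uP_prim t : primitive 0 t (fun v => uP p sigma a FA v%:E) uP_rate.
Proof.
split; first exact: uP_rate_bm.
move=> c d c0 cd dt; rewrite !uP_fin ?(le_trans c0) //.
rewrite (lint_split c0 cd); first by lra.
exact/bm_lint/uP_rate_bm.
Qed.

Lemma uP_at0 : uP p sigma a FA 0%:E = th.
Proof. by rewrite uP_fin // Iint_set1 addr0. Qed.

Lemma uP_rate_lt1 u : 0 <= u -> a u != 1 ->
  uP_rate u = - (r * th * (disc p u * unfaked u)).
Proof. by move=> u0 a1; rewrite /uP_rate surplus_lt1 // mulr0 add0r. Qed.

Lemma uP_rate_eq1 u : a u = 1 -> uP_rate u =
  disc p u * unfaked u * (m * (1 - th) * H u - r * th)
  - (th - m) * (sigma * (disc p u * dens FA u)).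
Proof.
by move=> a1; rewrite /uP_rate /surplus a1 /realnews /fakenews (hazardE st)
  /disc; ring.
Qed.

Lemma uP_rate_le u : 0 <= u ->
  uP_rate u <= disc p u * unfaked u * (m * (1 - th) * H u - r * th).
Proof.
move=> u0; rewrite /uP_rate.
have := ler_wpM2l (expR_ge0 (- r * u)) (surplus_le u0).
by rewrite /realnews (hazardE st) /disc; lra.
Qed.

(** The integrals up to [n] increase to those over the half-line, and the terminal term, absent at
    infinity, is nonnegative. *)
Lemma uP_pinfty c :
  (exists N : nat, forall n : nat, (N <= n)%N -> uP p sigma a FA n%:R%:E <= c) ->
  uP p sigma a FA +oo%E <= c.
Proof.
move=> [N HN]; rewrite /uP upto_pinfty addr0 -/f1 -/h1.
have nonneg u : 0 <= u -> 0 <= newsP p sigma a FA u.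
  by move=> u0; rewrite newsPE // addr_ge0 ?margin_ge0 // ltW // (theta_gt0 st).
apply: tint_pinfty_le.
- exact: pos_measurable.
- move=> u u0; rewrite -[X in 0 <= X]/(f1 u) f1E //.
  have d0 := ltW (disc_gt0 st u); have q0 := ltW (unfaked_gt0 u).
  have h0 := hazard_ge0 st u0; have m0 := margin_ge0 u0.
  have t0 := ltW (theta_gt0 st); have mu0 := ltW (mu_gt0 st).
  have dq0 : 0 <= H u * disc p u * unfaked u.
    by apply: mulr_ge0 => //; apply: mulr_ge0.
  apply: addr_ge0; first exact: mulr_ge0.
  by apply: mulr_ge0 => //; exact: mulr_ge0.
- by move=> t; exact: bm_lint.
- split; first exact: pos_measurable.
  exists (sigma * th + sigma) => u /pos_ge0 u0;
    rewrite -[X in 0 <= X <= _]/(h1 u) h1E //.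
  have d0 := ltW (disc_gt0 st u); have d1 := disc_le1 st u0.
  have t0 := ltW (theta_gt0 st); have m0 := margin_ge0 u0; have m1 :=
    margin_le1 u0.
  have ss := ltW s0.
  have sd0 : 0 <= sigma * disc p u by exact: mulr_ge0.
  have st0 : 0 <= sigma * th by exact: mulr_ge0.
  apply/andP; split; first by apply: addr_ge0; exact: mulr_ge0.
  apply: lerD; first by rewrite ler_piMr.
  by rewrite -mulrA ler_piMr // mulr_ile1.
exists N => n /HN; apply: le_trans; rewrite /uP upto_fin -/f1 -/h1 lerDl.
apply: mulr_ge0; last exact: ltW (theta_gt0 st).
apply: mulr_ge0; first exact: expR_ge0.
by apply: mulr_ge0; apply: ltW; [exact: (survival_gt0 st)|exact: unfaked_gt0].
Qed.

End Payoffs.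

(** * The agent's payoff *)

Section AgentPayoff.
Context {R : realType} (p : primitives R) (tau : R) (st : setting p tau).
Context (a : acceptance R) (FP : timing R).
Local Notation leb := (@lebesgue_measure R).
Local Notation pos := (`[0%R, +oo[%classic : set R).
Local Notation th := (theta p).
Local Notation be := (beta p).
Local Notation m := (mu p).
Local Notation r := (rho p).
Local Notation H := (hazard p).

Definition waiting (u : R) : R := disc p u * (1 - cdf FP u).
Definition uA_rate (u : R) : R :=
  waiting u * ((1 - be) * m * H u * a u - r * be).
(** The Lipschitz part of [uA]. What remains by [uA_fin] is the premium of a fake over the safe
    action, [(m - be) * (waiting t * a t)], which may jump with [FP] and with [a]. *)
Definition uA_flow (t : R) : R := be + \int[leb]_(u in `[0, t]) uA_rate u.

Lemma waiting_bm t : bounded_meas 0 t waiting.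
Proof.
apply: bmM; first exact: (disc_bm st).
by apply: bmB; [exact: bm_cst|exact: cdf_bm].
Qed.

Lemma waiting_ge0 u : 0 <= waiting u.
Proof.
by apply: mulr_ge0; [exact: ltW (disc_gt0 st u)|rewrite subr_ge0 cdf_le1].
Qed.

Lemma uA_rate_bm t : bounded_meas 0 t uA_rate.
Proof.
apply: bmM; first exact: waiting_bm.
apply: bmB; last exact: bm_cst.
by apply: bmM; [apply: bmM; [exact: bm_cst|exact: (hazard_bm st)]|exact: acc_bm].
Qed.

Let f2 u := expR (- r * u)
     * ((1 - m) * g p u * (1 - cdf FP u) * be
        + m * g p u * (1 - cdf FP u) * ((1 - a u) * be + a u)).
Let h2 u := expR (- r * u) * ((1 - G p u) * be).

Let f2E u : f2 u = be * (H u * waiting u) + m * (1 - be) * (H u * waiting u) *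
  a u.
Proof. by rewrite /f2 (hazardE st) /waiting /disc; ring. Qed.

Let hw_bm t : bounded_meas 0 t (fun u => H u * waiting u).
Proof. by apply: bmM; [exact: (hazard_bm st)|exact: waiting_bm]. Qed.

Let f2_bm t : bounded_meas 0 t f2.
Proof.
apply: (@bm_eq _ _ _ (fun u =>
  be * (H u * waiting u) + m * (1 - be) * (H u * waiting u) * a u)).
  by move=> u _; rewrite f2E.
apply: bmD; first by apply: bmM; [exact: bm_cst|exact: hw_bm].
by apply: bmM; [apply: bmM; [exact: bm_cst|exact: hw_bm]|exact: acc_bm].
Qed.

Let h2_bm t : bounded_meas 0 t h2.
Proof.
apply: (@bm_eq _ _ _ (fun u => be * disc p u)).
  by move=> u _; rewrite /h2 /disc; ring.
by apply: bmM; [exact: bm_cst|exact: (disc_bm st)].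
Qed.

Lemma uA_fin t : 0 <= t ->
  uA p a FP t%:E = uA_flow t + (m - be) * (waiting t * a t).
Proof.
move=> t0; rewrite /uA upto_fin -/f2 -/h2.
have od : weight `[0, t] (disc p).
  by apply: bm_okw; [exact: (disc_bm st)|move=> x _; exact: ltW (disc_gt0 st x)].
have qbm : bounded_meas 0 t (fun u => 1 - cdf FP u).
  by apply: bmB; [exact: bm_cst|exact: cdf_bm].
have dbm := disc_bm st t; have wbm := waiting_bm t; have Hbm := hazard_bm st t.
have abm := acc_bm a t; have hwbm := hw_bm t.
have e0 : tint FP `[0, t] h2 = be * tint FP `[0, t] (disc p).
  rewrite -tintZ //; last 3 first.
  - exact: itvcc_pos.
  - exact: ltW (beta_gt0 st).
  - by move=> x; exact: ltW (disc_gt0 st x).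
  by apply: eq_tint => u _; rewrite /h2 /disc; ring.
have e1 : \int[leb]_(u in `[0, t]) f2 u =
  be * \int[leb]_(u in `[0, t]) (H u * waiting u)
  + \int[leb]_(u in `[0, t]) (m * (1 - be) * (H u * waiting u) * a u).
  rewrite -IintZ; last exact: bm_lint.
  rewrite -IintD; last 2 first.
  - by apply/lintZ/bm_lint.
  - by apply/bm_lint/bmM => //; apply: bmM => //; exact: bm_cst.
  by apply: eq_Iint => u _; rewrite f2E.
have e2 : \int[leb]_(u in `[0, t]) uA_rate u =
  \int[leb]_(u in `[0, t]) (m * (1 - be) * (H u * waiting u) * a u)
  - r * be * \int[leb]_(u in `[0, t]) waiting u.
  rewrite -mulNr -IintZ; last exact: bm_lint.
  rewrite -IintD; last 2 first.
  - by apply/bm_lint/bmM => //; apply: bmM => //; exact: bm_cst.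
  - by apply/lintZ/bm_lint.
  by apply: eq_Iint => u _; rewrite /uA_rate; ring.
have e3 := disc_tint st FP t0.
have e4 : \int[leb]_(u in `[0, t]) ((r + H u) * disc p u * (1 - cdf FP u)) =
  r * \int[leb]_(u in `[0, t]) waiting u + \int[leb]_(u in `[0, t]) (H u *
    waiting u).
  rewrite -IintZ; last exact: bm_lint.
  rewrite -IintD; [|exact/lintZ/bm_lint|exact: bm_lint].
  by apply: eq_Iint => u _; rewrite /waiting; ring.
have e5 : expR (- r * t) * ((1 - G p t) * (1 - cdf FP t)) * ((1 - a t) * be +
  m * a t)
  = be * (disc p t * (1 - cdf FP t)) + (m - be) * (waiting t * a t).
  by rewrite /waiting /disc; ring.
rewrite e5 e0 e1 /uA_flow e2.
move: e3 => /(congr1 (fun x => be * x)); rewrite e4; lra.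
Qed.

Lemma uA_flow_prim t : primitive 0 t uA_flow uA_rate.
Proof.
split; first exact: uA_rate_bm.
move=> c d c0 cd dt; rewrite /uA_flow (lint_split c0 cd); first by lra.
exact/bm_lint/uA_rate_bm.
Qed.

Lemma uA_pinfty c :
  (exists N : nat, forall n : nat, (N <= n)%N -> uA p a FP n%:R%:E <= c) ->
  uA p a FP +oo%E <= c.
Proof.
move=> [N HN]; rewrite /uA upto_pinfty addr0 -/f2 -/h2.
have b0 := ltW (beta_gt0 st); have m0 := ltW (mu_gt0 st).
have b1 : 0 <= 1 - be.
  rewrite subr_ge0; apply: ltW; apply: lt_trans (theta_lt1 st).
  by case/andP: (beta_theta st).
apply: tint_pinfty_le.
- exact: pos_measurable.
- move=> u u0; rewrite -[X in 0 <= X]/(f2 u) f2E //.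
  have h0 := hazard_ge0 st u0; have w0 := waiting_ge0 u.
  have /andP[a0 _] := acc_itv a u0.
  have dq0 : 0 <= H u * waiting u by exact: mulr_ge0.
  apply: addr_ge0; first exact: mulr_ge0.
  by apply: mulr_ge0 => //; apply: mulr_ge0 => //; exact: mulr_ge0.
- by move=> t; exact: bm_lint.
- split; first exact: pos_measurable.
  exists be => u /pos_ge0 u0; rewrite -[X in 0 <= X <= _]/(h2 u).
  have -> : h2 u = be * disc p u by rewrite /h2 /disc; ring.
  have d0 := ltW (disc_gt0 st u); have d1 := disc_le1 st u0.
  by apply/andP; split; [exact: mulr_ge0|rewrite ler_piMr].
exists N => n /HN; apply: le_trans; rewrite /uA upto_fin -/f2 -/h2 lerDl.
have /andP[a0 a1] := acc_itv a (ler0n R n).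
apply: mulr_ge0.
  apply: mulr_ge0; first exact: expR_ge0.
  by apply: mulr_ge0; [exact: ltW (survival_gt0 st _)|rewrite subr_ge0 cdf_le1].
apply: addr_ge0; last exact: mulr_ge0.
by apply: mulr_ge0 => //; rewrite subr_ge0.
Qed.

End AgentPayoff.

(** * Equilibria with search *)

Section Equilibrium.
Context {R : realType} (p : primitives R) (tau : R) (st : setting p tau).
Context (sigma : R) (hs : 0 < sigma < 1).
Context (a : acceptance R) (FP FA : timing R).
Local Notation leb := (@lebesgue_measure R).
Local Notation pos := (`[0%R, +oo[%classic : set R).
Local Notation th := (theta p).
Local Notation be := (beta p).
Local Notation m := (mu p).
Local Notation r := (rho p).
Local Notation H := (hazard p).
Local Notation uP' := (uP p sigma a FA).
Local Notation uA' := (uA p a FP).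


(* Optimality at active times gives uP * dens = V * dens pointwise, so that the
   payoff integral needs no measurability of uP. *)
Lemma eq_tint_active A (h h' : R -> R) : A `<=` pos ->
  (forall s, A s -> active FP s%:E -> h s = h' s) -> tint FP A h = tint FP A h'.
Proof.
move=> Apos hh'; rewrite /tint; congr (_ + fine _).
  apply: eq_Rintegral => s; rewrite inE => As.
  have := dens_ge0 FP (pos_ge0 (Apos _ As)); rewrite le_eqVlt => /predU1P[<-|d0].
    by rewrite !mulr0.
  by rewrite (hh' _ As) //; left.
apply: eq_esum => s As.
have := atom_ge0 FP s; rewrite le_eqVlt => /predU1P[<-|d0];
  first by rewrite !mulr0.
by rewrite (hh' _ As) //; right.
Qed.

Section PrincipalBestReply.
Context (pic : picA p sigma a FA).

Lemma uP_lt_after s t : tau <= s -> s < t -> uP' t%:E < uP' s%:E.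
Proof.
move=> ts st'; have sge0 := le_trans (ltW (tau_gt0 st)) ts.
apply: (prim_gt (uP_prim st hs pic t)) => // u /andP[su ut].
have u0 := le_trans sge0 (ltW su).
apply: le_lt_trans (uP_rate_le st hs pic u0) _.
rewrite pmulr_rlt0; first exact: (gainP_lt0 st (le_lt_trans ts su)).
by apply: mulr_gt0; [exact: (disc_gt0 st)|exact: unfaked_gt0 hs _ _].
Qed.

Lemma uP_oo_lt : uP' +oo%E < uP' tau%:E.
Proof.
apply: (@le_lt_trans _ _ (uP' (tau + 1)%:E)); last by apply: uP_lt_after;
  rewrite ?ltrDl.
apply: (uP_pinfty st hs pic); exists (Num.bound (tau + 1)) => n Nn.
have tn : tau + 1 < n%:R.
  apply: (lt_le_trans (archi_boundP _)); last by rewrite ler_nat.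
  by rewrite addr_ge0 // ltW // (tau_gt0 st).
by apply/ltW/uP_lt_after => //; rewrite lerDl.
Qed.

Section Reply.
Context (picT : forall t t' : \bar R, (0 <= t)%E -> (0 <= t')%E ->
  active FP t -> uP' t' <= uP' t).

Lemma payoff_active t : (0 <= t)%E -> active FP t ->
  payoffP p sigma a FP FA = uP' t.
Proof.
move=> t0 At; set V := uP' t.
have VE s : (0 <= s)%E -> active FP s -> uP' s = V.
  by move=> sge0 As; apply/eqP; rewrite eq_le !picT.
(* Stopping at 0 earns [theta], so [V >= theta > 0]; [tint_cst] needs a nonnegative constant. *)
have V0 : 0 <= V.
  apply: le_trans (_ : th <= _); first exact: ltW (theta_gt0 st).
  by rewrite -(uP_at0 st hs pic) picT.
rewrite /payoffP (@eq_tint_active _ _ (fun=> V)) //; last first.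
  by move=> s /pos_ge0 sge0; apply: VE; rewrite lee_fin.
rewrite tint_cst //.
have -> : never FP * uP' +oo%E = never FP * V.
  have [e|ne] := eqVneq (never FP) 0; first by rewrite e !mul0r.
  rewrite VE //; rewrite /= lt_def ne /never subr_ge0; exact: tint_total_le1.
by rewrite /never; ring.
Qed.

Lemma inactive_after_tau t : tau < t -> ~ active FP t%:E.
Proof.
move=> tt At; have t0 := ltW (tau_gt0 st).
have := @picT t%:E tau%:E _ _ At; rewrite !lee_fin =>
  /(_ (le_trans t0 (ltW tt)) t0).
by rewrite leNgt uP_lt_after.
Qed.

Lemma inactive_oo : ~ active FP +oo%E.
Proof.
move=> Ao.
have tau0 : (0 <= tau%:E)%E by rewrite lee_fin ltW // (tau_gt0 st).
have := @picT +oo%E tau%:E (leey _) tau0 Ao.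
by rewrite leNgt uP_oo_lt.
Qed.

Lemma cdf_tau : cdf FP tau = 1.
Proof.
apply: inactive_cdf1; [exact: ltW (tau_gt0 st)|exact: inactive_after_tau|].
exact: inactive_oo.
Qed.

End Reply.
End PrincipalBestReply.

Context (eq : equilibrium p sigma a FP FA).
Let pic : picA p sigma a FA := PICa eq.
Let picT := PICt eq.

Lemma no_search_payoff : cdf FP 0 = 1 -> payoffP p sigma a FP FA = th.
Proof.
move=> F0; rewrite (@payoff_active pic picT 0%:E) ?(uP_at0 st hs pic) //.
by right; rewrite -cdf_at0 F0.
Qed.

Context (F0 : cdf FP 0 < 1).

(** [T] is the infimum of the times by which the principal has surely stopped; right continuity of
    [cdf FP] makes it one of them. *)
Lemma last_stop : exists T, [/\ 0 < T, T <= tau, cdf FP T = 1 &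
  forall t, 0 <= t -> t < T -> cdf FP t < 1].
Proof.
pose S := [set t | 0 <= t /\ cdf FP t = 1].
have t0 := ltW (tau_gt0 st).
have Stau : S tau by split=> //; exact: (cdf_tau pic picT).
have Slb : has_lbound S by exists 0 => u [].
have Sinf : has_inf S by split => //; exists tau.
have i0 : 0 <= inf S by apply: lb_le_inf; [exists tau|move=> u []].
have FT : cdf FP (inf S) = 1.
  apply/eqP; rewrite eq_le cdf_le1 /=; apply/ler_addgt0Pr => e e0.
  have [d d0 Hd] := cdf_right_continuous FP i0 e0.
  have [u Su ud] := inf_adherent d0 Sinf; have [_ Fu] := Su.
  by rewrite -[leLHS]Fu; apply: Hd; [exact: ge_inf|exact: ltW].
exists (inf S); split => //.
- rewrite lt_def i0 andbT; apply/eqP => e; have := F0.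
  by rewrite -[X in cdf _ X]e FT ltxx.
- exact: ge_inf.
move=> t tge0 ti; rewrite lt_def cdf_le1 andbT; apply/eqP => e.
by have : inf S <= t; [apply: ge_inf|rewrite leNgt ti].
Qed.

Section Stop.
Context (T : R) (T0 : 0 < T) (Ttau : T <= tau) (FT : cdf FP T = 1).
Context (Flt : forall t : R, 0 <= t -> t < T -> cdf FP t < 1).

Let gainA u := be * (1 - m) * H u - r * m.
(** The payoff from faking at [u] if that fake were accepted for sure. *)
Let lot (u : R) := uA_flow p a FP u + (m - be) * waiting p FP u.
Let mb0 : 0 < m - be. Proof. by rewrite subr_gt0 (beta_lt_mu st). Qed.
Let b1 : 0 < 1 - be.
Proof.
rewrite subr_gt0; apply: lt_trans (theta_lt1 st).
by case/andP: (beta_theta st).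
Qed.

Lemma uA_acc1 t : 0 <= t -> a t = 1 -> uA' t%:E = lot t.
Proof. by move=> t0 a1; rewrite (uA_fin st) // a1 mulr1. Qed.

(** The flow and [disc] are Lipschitz, and [cdf FP] is right continuous. From the left [lot] may
    drop, at an atom of [FP]. *)
Lemma lot_right_continuous (s e : R) : 0 <= s -> 0 < e ->
  exists2 d, 0 < d & forall x, s <= x -> x <= s + d -> `|lot x - lot s| <= e.
Proof.
move=> sge0 e0.
have [C1 C10 L1] := prim_lip (uA_flow_prim st a FP (s + 1)).
have [C2 C20 L2] := prim_lip (prim_disc st (s + 1)).
pose K := C1 + (m - be) * C2.
have K0 : 0 <= K by rewrite addr_ge0 // mulr_ge0 // ltW.
have e1 : 0 < e / 2 / (K + 1) by rewrite !divr_gt0 // ltr_wpDl.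
have e2 : 0 < e / 2 / (m - be) by rewrite !divr_gt0.
have [d d0 Hd] := cdf_right_continuous FP sge0 e2.
exists (Num.min d (Num.min 1 (e / 2 / (K + 1)))).
  by rewrite !lt_min d0 ltr01 e1.
move=> x sx; rewrite -lerBlDl !le_min => /and3P[xd x1 xe].
have {}x1 : x <= s + 1 by lra.
have h1 := L1 _ _ sge0 sx x1; have h2 := L2 _ _ sge0 sx x1.
have h3 : cdf FP x <= cdf FP s + e / 2 / (m - be) by apply: Hd => //; lra.
have h4 := cdf_le FP sge0 sx.
have h5 : `|waiting p FP x - waiting p FP s| <= C2 * (x - s) + (cdf FP x - cdf
  FP s).
  have -> : waiting p FP x - waiting p FP s =
      (disc p x - disc p s) * (1 - cdf FP x) - disc p s * (cdf FP x - cdf FP s).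
    by rewrite /waiting; ring.
  apply: (le_trans (ler_normB _ _)); apply: lerD; rewrite normrM.
    rewrite -[leRHS]mulr1 ler_pM // ger0_norm ?subr_ge0 ?cdf_le1 //.
    by rewrite gerBl cdf_ge0.
  rewrite [`|_ - _|]ger0_norm ?subr_ge0 // ger0_norm ?(ltW (disc_gt0 st s)) //.
  by rewrite ler_piMl ?subr_ge0 // (disc_le1 st).
have -> : lot x - lot s = (uA_flow p a FP x - uA_flow p a FP s)
    + (m - be) * (waiting p FP x - waiting p FP s) by rewrite /lot; ring.
apply: (le_trans (ler_normD _ _)); rewrite normrM (gtr0_norm mb0).
have h6 : (m - be) * `|waiting p FP x - waiting p FP s| <=
    (m - be) * (C2 * (x - s) + (cdf FP x - cdf FP s)) by rewrite ler_wpM2l // ltW.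
have h7 : (m - be) * (cdf FP x - cdf FP s) <= e / 2.
  by rewrite mulrC -ler_pdivlMr //; lra.
have h8 : K * (x - s) <= e / 2.
  apply: le_trans (_ : (K + 1) * (x - s) <= _).
    by rewrite ler_wpM2r ?subr_ge0 // lerDl.
  by rewrite mulrC -ler_pdivlMr // ltr_wpDl.
by rewrite /K in h8; lra.
Qed.

Lemma acc_ne1_active s : 0 <= s -> s < T -> a s != 1 -> active FA s%:E.
Proof.
move=> sge0 sT /eqP as1; apply: contrapT => An; apply: as1.
by apply: (acc_inactive st hs pic) => //;
  exact: (g_gt0 st sge0 (lt_le_trans sT Ttau)).
Qed.

(** Where [a s < 1] faking is active, hence optimal. A later time close to [s] with certain
    acceptance would earn almost [lot s], which exceeds [uA s] by a fixed amount. *)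
Lemma acc_ne1_right s : 0 <= s -> s < T -> a s != 1 ->
  exists2 d, 0 < d & forall x, s <= x -> x <= s + d -> a x != 1.
Proof.
move=> sge0 sT as1; have As := acc_ne1_active sge0 sT as1.
have /andP[_ ale1] := acc_itv a sge0.
have asl : a s < 1 by rewrite lt_def eq_sym as1.
have w0 : 0 < waiting p FP s.
  by apply: mulr_gt0; [exact: (disc_gt0 st)|rewrite subr_gt0 Flt].
(* Half of [lot s - uA s]. *)
pose e := (m - be) * (waiting p FP s * (1 - a s)) / 2.
have e0 : 0 < e.
  apply: divr_gt0 => //; apply: mulr_gt0 => //; apply: mulr_gt0 => //.
  by rewrite subr_gt0.
have [d d0 Hd] := lot_right_continuous sge0 e0.
exists d => // x sx xd; apply/eqP => ax.
have x0 := le_trans sge0 sx.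
have := AIC eq (t := s%:E) (t' := x%:E); rewrite !lee_fin => /(_ sge0 x0 As).
rewrite (uA_acc1 x0 ax) (uA_fin st) // => h.
have := Hd x sx xd; rewrite ler_norml => /andP[h1 _].
by move: h h1 e0; rewrite /lot /e; lra.
Qed.

(** With an idle principal the gain from delay has three parts: the waiting gain under full
    acceptance, less the loss on real news rejected meanwhile, plus the gain from moving from
    acceptance [a s] to certain acceptance. *)
Lemma uA_diff s t : 0 <= s -> s <= t ->
  (forall u, s <= u <= t -> cdf FP u = cdf FP s) -> a t = 1 ->
  uA' t%:E - uA' s%:E = (1 - cdf FP s) *
    (\int[leb]_(u in `[s, t])
       (disc p u * gainA u - (1 - be) * m * H u * (disc p u * (1 - a u)))
     + (m - be) * (disc p s * (1 - a s))).
Proof.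
move=> sge0 st' Fc at1; have t0 := le_trans sge0 st'.
rewrite !(uA_fin st) // at1.
have [_ Hf] := uA_flow_prim st a FP t; have [_ Hd] := prim_disc st t.
have {}Hf := Hf _ _ sge0 st' (lexx t); have {}Hd := Hd _ _ sge0 st' (lexx t).
set q := 1 - cdf FP s.
have ws : waiting p FP s = disc p s * q by [].
have wt : waiting p FP t = disc p t * q by rewrite /waiting Fc // st' lexx.
have rbm := bm_sub sge0 (lexx t) (uA_rate_bm st a FP t).
have dbm : bounded_meas s t (fun u => - (r + H u) * disc p u).
  by have [b _] := prim_disc st t; exact: bm_sub b.
have e : q * \int[leb]_(u in `[s, t])
       (disc p u * gainA u - (1 - be) * m * H u * (disc p u * (1 - a u))) =
   \int[leb]_(u in `[s, t]) uA_rate p a FP u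
   + (m - be) * q * \int[leb]_(u in `[s, t]) (- (r + H u) * disc p u).
  rewrite -IintZ; last first.
    have Hb := bm_sub sge0 (lexx t) (hazard_bm st t).
    have db := bm_sub sge0 (lexx t) (disc_bm st t).
    have ab := bm_sub sge0 (lexx t) (acc_bm a t).
    apply/bm_lint/bmB; apply: bmM => //.
      by apply: bmB; [apply: bmM => //|]; exact: bm_cst.
      by apply: bmM => //; exact: bm_cst.
    by apply: bmM => //; apply: bmB => //; exact: bm_cst.
  rewrite -[in RHS]IintZ; last exact: bm_lint.
  rewrite -IintD; [|exact: bm_lint|exact/lintZ/bm_lint].
  apply: eq_Iint => u /Fc Fu; rewrite /uA_rate /waiting Fu -/q /gainA; ring.
rewrite mulrDr e -Hd -Hf ws wt; ring.
Qed.

(* If a < 1 at s, then a < 1 up to some c < T with a c = 1.  On [s, c[ the agent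
   fakes everywhere, so uP falls and the principal never stops there.  The agent
   is then indifferent on [s, c[; but close to c, where a must be close to 1,
   waiting is strictly profitable because the hazard rate exceeds phiA. *)
Lemma acc_before s : 0 <= s -> s < T -> a s = 1.
Proof.
move=> sge0 sT; apply/eqP; apply: contraPT isT => as1 _.
pose S := [set x | s <= x <= T /\ (x = T \/ a x = 1)].
have ST : S T by split; [rewrite (ltW sT) lexx|left].
have Slb : has_lbound S by exists s => u [/andP[]].
have Sinf : has_inf S by split => //; exists T.
set c := inf S.
have sc : s <= c by apply: lb_le_inf; [exists T | move=> u [/andP[]]].
have cT : c <= T by exact: ge_inf.
have nS x : s <= x -> x < c -> a x != 1.
  move=> sx xc; apply/eqP => ax.
  have : c <= x by apply: ge_inf => //; split;
    [rewrite sx (le_trans (ltW xc))|right].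
  by rewrite leNgt xc.
have step x : s <= x -> x < T -> a x != 1 -> (forall y, s <= y -> y < x ->
  a y != 1) -> x < c.
  move=> sx xT ax Hx; have [d d0 Hd] := acc_ne1_right (le_trans sge0 sx) xT ax.
  have xd : x < Num.min T (x + d) by rewrite lt_min xT ltrDl.
  apply: lt_le_trans xd _; apply: lb_le_inf; first by exists T.
  move=> y [/andP[sy yT] [->|ay]]; first by rewrite ge_min lexx.
  rewrite ge_min; apply/orP; right; rewrite leNgt; apply/negP => yd.
  have [yx|xy] := ltP y x; first by move: (Hx y sy yx); rewrite ay eqxx.
  by move: (Hd y xy (ltW yd)); rewrite ay eqxx.
have {}sc : s < c by apply: step => // y sy; rewrite ltNge sy.
have uPd x : s < x -> x <= c -> uP' x%:E < uP' s%:E.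
  move=> sx xc; apply: (prim_gt (uP_prim st hs pic x)) => // u /andP[su ux].
  have u0 := le_trans sge0 (ltW su).
  rewrite (uP_rate_lt1 st hs pic u0) ?nS ?(ltW su) ?(lt_le_trans ux) //.
  rewrite oppr_lt0; apply: mulr_gt0.
    by apply: mulr_gt0; [exact: (rho_gt0 st)|exact: (theta_gt0 st)].
  by apply: mulr_gt0; [exact: (disc_gt0 st)|exact: (unfaked_gt0 hs)].
have idleP x : s < x <= c -> ~ active FP x%:E.
  move=> /andP[sx xc] Ax; have x0 := le_trans sge0 (ltW sx).
  have := @picT x%:E s%:E; rewrite !lee_fin => /(_ x0 sge0 Ax).
  by rewrite leNgt uPd.
(* If [c = T], the principal would be idle on []s, T]], where she must still stop with positive
   probability. *)
have {}cT : c < T.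
  rewrite lt_def cT andbT; apply/eqP => e.
  have [x /andP[sx xT] Ax] : exists2 x, s < x <= T & active FP x%:E.
    by apply: active_in => //; [exact: ltW|rewrite FT Flt].
  by apply: (idleP x) => //; rewrite sx -e.
have c0 := le_trans sge0 (ltW sc).
have ac : a c = 1.
  apply/eqP; apply: contraPT isT => ac _.
  by have := step c (ltW sc) cT ac nS; rewrite ltxx.
have Fc u : s <= u <= c -> cdf FP u = cdf FP s.
  move=> /andP[su uc]; apply: inactive_cdf => // x /andP[sx xu].
  by apply: idleP; rewrite sx (le_trans xu).
pose q := 1 - cdf FP s.
have q0 : 0 < q by rewrite subr_gt0 Flt.
pose y u := disc p u * (1 - a u).
have y0 u : s <= u -> 0 <= y u.
  move=> su; have u0 := le_trans sge0 su; have /andP[_ a1] := acc_itv a u0.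
  by rewrite mulr_ge0 ?subr_ge0 // ltW // (disc_gt0 st).
have y1 u : s <= u -> y u <= 1.
  move=> su; have u0 := le_trans sge0 su; have /andP[a0 a1] := acc_itv a u0.
  rewrite -[leRHS]mulr1; apply: ler_pM;
    rewrite ?subr_ge0 ?(disc_le1 st) ?gerBl //.
  exact: ltW (disc_gt0 st u).
pose K := (1 - be) * m * H 0.
have K0 : 0 <= K.
  by apply: mulr_ge0; [apply/mulr_ge0; apply/ltW => //;
    exact: (mu_gt0 st)|exact: (hazard_ge0 st)].
have HK u : s <= u -> (1 - be) * m * H u * y u <= K * y u.
  move=> su; apply: ler_wpM2r; first exact: y0.
  apply: ler_wpM2l; last by apply: (hazard_nonincr st) => //; exact: le_trans su.
  by apply/mulr_ge0; apply/ltW => //; exact: (mu_gt0 st).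
have gA u : s <= u -> u <= c -> disc p c * gainA0 p <= disc p u * gainA u.
  move=> su uc; have u0 := le_trans sge0 su.
  apply: ler_pM; [exact: ltW (disc_gt0 st c)|exact: ltW (gainA0_gt0 st)| |].
    exact: (disc_nonincr st).
  by apply: (gainA_ge st) => //; rewrite (le_trans uc) // (le_trans (ltW cT)).
have dg0 : 0 < disc p c * gainA0 p.
  by apply: mulr_gt0; [exact: (disc_gt0 st)|exact: (gainA0_gt0 st)].
have lint_x x : s <= x -> itv_integrable x c (fun u =>
    disc p u * gainA u - (1 - be) * m * H u * (disc p u * (1 - a u))).
  move=> sx; have x0 := le_trans sge0 sx.
  have Hb := bm_sub x0 (lexx c) (hazard_bm st c).
  have db := bm_sub x0 (lexx c) (disc_bm st c).
  have ab := bm_sub x0 (lexx c) (acc_bm a c).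
  apply/bm_lint/bmB; apply: bmM => //.
    by apply: bmB; [apply: bmM => //|]; exact: bm_cst.
    by apply: bmM => //; exact: bm_cst.
  by apply: bmM => //; apply: bmB => //; exact: bm_cst.
have key x : s <= x -> x < c -> \int[leb]_(u in `[x, c])
    (disc p u * gainA u - (1 - be) * m * H u * y u) + (m - be) * y x <= 0.
  move=> sx xc; have x0 := le_trans sge0 sx.
  have Ax := acc_ne1_active x0 (lt_trans xc cT) (nS x sx xc).
  have := AIC eq (t := x%:E) (t' := c%:E); rewrite !lee_fin => /(_ x0 c0 Ax).
  have Fx : cdf FP x = cdf FP s by apply: Fc; rewrite sx (ltW xc).
  rewrite -subr_le0 uA_diff ?(ltW xc) //; last first.
    by move=> u /andP[xu uc]; rewrite Fx; apply: Fc; rewrite (le_trans sx xu).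
  by rewrite Fx pmulr_rle0.
(* Rejected real news costs at most [K] per unit of time as [y <= 1], so the shortfall [y x] must
   vanish linearly as [x] approaches [c]. *)
have bd x : s <= x -> x < c -> (m - be) * y x <= K * (c - x).
  move=> sx xc; have := key x sx xc.
  have : - K * (c - x) <= \int[leb]_(u in `[x, c])
      (disc p u * gainA u - (1 - be) * m * H u * y u).
    rewrite -Iint_cst ?(ltW xc) //; apply: Iint_le;
      [exact: lint_cst|exact: lint_x|].
    move=> u /andP[xu uc]; have su := le_trans sx xu.
    have h1 := HK u su; have h2 := gA u su uc.
    have h3 := ler_wpM2l K0 (y1 u su); lra.
  lra.
(* Inserting the linear bound on [y] into the loss [K * y] gives at most
   [K * K * (c - x) / (m - be)]; within [e] of [c] this is below the waiting gain
   [disc p c * gainA0 p]. *)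
pose e := disc p c * gainA0 p * (m - be) / (K * K + 1).
have KK : 0 < K * K + 1 by rewrite ltr_wpDl // mulr_ge0.
have e0 : 0 < e by rewrite divr_gt0 // mulr_gt0.
pose x := Num.max s (c - e).
have sx : s <= x by rewrite le_max lexx.
have xc : x < c by rewrite gt_max sc ltrBlDr ltrDl.
have xe : c - x <= e by rewrite lerBlDr -lerBlDl le_max lexx orbT.
have KKe : K * K * (c - x) < disc p c * gainA0 p * (m - be).
  apply: (@le_lt_trans _ _ (K * K * e)); first by rewrite ler_wpM2l // mulr_ge0.
  by rewrite /e mulrA ltr_pdivrMr // mulrC ltr_pM2l ?ltrDl // mulr_gt0.
suff : 0 < \int[leb]_(u in `[x, c])
    (disc p u * gainA u - (1 - be) * m * H u * y u).
  have := key x sx xc; have := mulr_ge0 (ltW mb0) (y0 x sx); lra.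
apply: Iint_gt0 => //; first exact: lint_x.
move=> u /andP[xu uc]; have su := le_trans sx (ltW xu).
rewrite subr_gt0; apply: le_lt_trans (HK u su) _.
apply: lt_le_trans (gA u su (ltW uc)).
rewrite -(ltr_pM2r mb0); apply: le_lt_trans KKe.
have h1 : (m - be) * y u <= K * (c - x).
  by apply: le_trans (bd u su uc) _; rewrite ler_wpM2l // lerB // ltW.
by have := ler_wpM2l K0 h1; lra.
Qed.

End Stop.

End Equilibrium.

(** * The shape of an equilibrium with search *)

Section Search.
Context {R : realType} (p : primitives R) (tau : R) (st : setting p tau).
Context (sigma : R) (hs : 0 < sigma < 1).
Context (a : acceptance R) (FP FA : timing R).
Context (eq : equilibrium p sigma a FP FA) (F0 : cdf FP 0 < 1).
Local Notation leb := (@lebesgue_measure R).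
Local Notation th := (theta p).
Local Notation be := (beta p).
Local Notation m := (mu p).
Local Notation r := (rho p).
Local Notation H := (hazard p).
Local Notation uP' := (uP p sigma a FA).
Local Notation uA' := (uA p a FP).

Let s0 : 0 < sigma. Proof. by case/andP: hs. Qed.
Let pic : picA p sigma a FA := PICa eq.
Let picT := PICt eq.
Let tau0 := tau_gt0 st.
Let mb0 : 0 < m - be. Proof. by rewrite subr_gt0 (beta_lt_mu st). Qed.
Let thm0 : 0 < th - m. Proof. by rewrite subr_gt0 (mu_lt_theta st). Qed.
Let b1 : 0 < 1 - be.
Proof.
rewrite subr_gt0; apply: lt_trans (theta_lt1 st).
by case/andP: (beta_theta st).
Qed.

Section LastStop.
Context (T : R) (T0 : 0 < T) (Ttau : T <= tau) (FT : cdf FP T = 1).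
Context (Flt : forall t : R, 0 <= t -> t < T -> cdf FP t < 1).

Lemma uA_late t : T <= t -> uA' t%:E = uA_flow p a FP T.
Proof.
move=> Tt; have t0 := le_trans (ltW T0) Tt.
have w0 u : T <= u -> waiting p FP u = 0.
  move=> Tu; rewrite /waiting (_ : cdf FP u = 1) ?subrr ?mulr0 //.
  by apply/eqP; rewrite eq_le cdf_le1 -[X in X <= _]FT cdf_le // ltW.
rewrite (uA_fin st) // w0 // mul0r mulr0 addr0.
apply: (prim_const (uA_flow_prim st a FP t)) => //; first exact: ltW.
by move=> u /andP[/ltW Tu _]; rewrite /uA_rate w0 // mul0r.
Qed.

(** Faking at [s] collects a premium of at least [(m - be) * disc p T * q], with [q = 1 - cdf FP s],
    while the flow given up until [T] is at most [K * q * (T - s)]. Both scale with [q], so [s] can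
    be chosen by the distance to [T] alone. *)
Lemma early_fake_better : exists s, [/\ 0 <= s, s < T & uA_flow p a FP T < uA'
  s%:E].
Proof.
pose K := (1 - be) * m * H 0.
have K0 : 0 <= K.
  apply: mulr_ge0; last exact: (hazard_ge0 st).
  by apply/mulr_ge0; apply/ltW => //; exact: (mu_gt0 st).
have d0 := disc_gt0 st T.
pose e := (m - be) * disc p T / (K + 1).
have K1 : 0 < K + 1 by rewrite ltr_wpDl.
have e0 : 0 < e by apply: divr_gt0 => //; apply: mulr_gt0.
pose s := Num.max 0 (T - e).
have sge0 : 0 <= s by rewrite le_max lexx.
have sT : s < T by rewrite gt_max T0 ltrBlDr ltrDl.
have Ts : T - s <= e by rewrite lerBlDr -lerBlDl le_max lexx orbT.
exists s; split => //.
have as1 : a s = 1 by exact: (acc_before st hs eq Ttau FT Flt sge0 sT).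
rewrite (uA_fin st) // as1 mulr1.
pose q := 1 - cdf FP s.
have q0 : 0 < q by rewrite subr_gt0 Flt.
have [_ /(_ s T sge0 (ltW sT) (lexx T)) hf] := uA_flow_prim st a FP T.
have lr : itv_integrable s T (uA_rate p a FP).
  exact/bm_lint/(bm_sub sge0 (lexx T))/(uA_rate_bm st a FP T).
have : \int[leb]_(u in `[s, T]) uA_rate p a FP u <= K * q * (T - s).
  rewrite -Iint_cst ?(ltW sT) //; apply: Iint_le => //; first exact: lint_cst.
  move=> u /andP[su uT]; have u0 := le_trans sge0 su.
  have /andP[a0 a1] := acc_itv a u0; have w0 := waiting_ge0 st FP u.
  have wq : waiting p FP u <= q.
    rewrite /waiting -[leRHS]mul1r; apply: ler_pM.
    - exact: ltW (disc_gt0 st u).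
    - by rewrite subr_ge0 cdf_le1.
    - exact: (disc_le1 st).
    - by rewrite /q lerB // cdf_le.
  have hK : (1 - be) * m * H u * a u <= K.
    have HK : (1 - be) * m * H u <= K.
      apply: ler_wpM2l; last exact: (hazard_nonincr st).
      by apply/mulr_ge0; apply/ltW => //; exact: (mu_gt0 st).
    apply: le_trans HK; rewrite ler_piMr //.
    apply: mulr_ge0; last exact: (hazard_ge0 st).
    by apply/mulr_ge0; apply/ltW => //; exact: (mu_gt0 st).
  have rb : 0 <= r * be.
    by apply: mulr_ge0; apply: ltW; [exact: (rho_gt0 st)|exact: (beta_gt0 st)].
  apply: (@le_trans _ _ (waiting p FP u * K)).
    by rewrite /uA_rate ler_wpM2l // lerBlDr (le_trans hK) // lerDl.
  by rewrite mulrC ler_wpM2l.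
have : (m - be) * (disc p T * q) <= (m - be) * waiting p FP s.
  rewrite ler_wpM2l ?(ltW mb0) // /waiting ler_wpM2r ?(ltW q0) //.
  exact: (disc_nonincr st (ltW sT)).
have : K * q * (T - s) < (m - be) * (disc p T * q).
  rewrite (_ : K * q * (T - s) = K * (T - s) * q); last by ring.
  rewrite mulrA ltr_pM2r //.
  apply: (@le_lt_trans _ _ (K * e)); first by rewrite ler_wpM2l.
  rewrite /e mulrA ltr_pdivrMr // mulrC ltr_pM2l ?ltrDl //.
  by apply: mulr_gt0.
lra.
Qed.

Lemma no_late_fake t : T <= t -> ~ active FA t%:E.
Proof.
move=> Tt At; have t0 := le_trans (ltW T0) Tt.
have [s [sge0 sT lt]] := early_fake_better.
have := AIC eq (t := t%:E) (t' := s%:E); rewrite !lee_fin => /(_ t0 sge0 At).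
by rewrite uA_late // leNgt lt.
Qed.

Lemma no_fake_oo : ~ active FA +oo%E.
Proof.
move=> Ao; have [s [sge0 sT lt]] := early_fake_better.
have sge0' : (0 <= s%:E)%E by rewrite lee_fin.
have := AIC eq (t := +oo%E) (t' := s%:E) (leey _) sge0' Ao.
rewrite leNgt => /negP; apply; apply: le_lt_trans lt.
apply: (uA_pinfty st); exists (Num.bound T) => n Nn.
rewrite uA_late // ltW //; apply: (lt_le_trans (archi_boundP (ltW T0))).
by rewrite ler_nat.
Qed.

Lemma cdfA_T : cdf FA T = 1.
Proof.
apply: inactive_cdf1; first exact: ltW.
  by move=> x /ltW; exact: no_late_fake.
exact: no_fake_oo.
Qed.

(** [T] itself need not be active, but active stopping times, all optimal, accumulate at it, and
    [uP] is Lipschitz. *)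
Lemma uP_max t : (0 <= t)%E -> uP' t <= uP' T%:E.
Proof.
move=> t0; rewrite leNgt; apply/negP => lt.
have [C C0 LC] := prim_lip (uP_prim st hs pic T).
pose e := (uP' t - uP' T%:E) / (C + 1).
have C1 : 0 < C + 1 by rewrite ltr_wpDl.
have e0 : 0 < e by rewrite divr_gt0 // subr_gt0.
pose s := Num.max 0 (T - e).
have sge0 : 0 <= s by rewrite le_max lexx.
have sT : s < T by rewrite gt_max T0 ltrBlDr ltrDl.
have Ts : T - s <= e by rewrite lerBlDr -lerBlDl le_max lexx orbT.
have [x /andP[sx xT] Ax] : exists2 x, s < x <= T & active FP x%:E.
  by apply: active_in => //; [exact: ltW|rewrite FT Flt].
have x0 := le_trans sge0 (ltW sx).
have := @picT x%:E t; rewrite !lee_fin => /(_ x0 t0 Ax) h; clear t0.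
have := LC _ _ x0 xT (lexx T); rewrite ler_norml => /andP[h1 _].
have h2 : C * (T - x) <= C * e by rewrite ler_wpM2l //; lra.
have h3 : C * e + e = uP' t - uP' T%:E.
  by rewrite -{2}[e]mul1r -mulrDl /e mulrC divfK // gt_eqF.
lra.
Qed.

(** If [T < tau], there is no faking on []T, tau[] while search still pays, so stopping at [tau]
    would beat [T], against [uP_max]. *)
Lemma last_stop_tau : T = tau.
Proof.
apply/eqP; rewrite eq_le Ttau /= leNgt; apply/negP => lt.
have tge0 : (0 <= tau%:E)%E by rewrite lee_fin ltW.
have := uP_max tge0; rewrite leNgt => /negP; apply.
apply: (prim_lt (uP_prim st hs pic tau)) => //; first exact: ltW.
move=> u /andP[Tu ut]; have u0 := le_trans (ltW T0) (ltW Tu).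
have An := no_late_fake (ltW Tu).
have d0 : dens FA u = 0.
  apply/eqP; rewrite eq_le dens_ge0 // andbT leNgt; apply/negP => d0.
  by apply: An; left.
have au : a u = 1.
  by apply: (acc_inactive st hs pic) => //; exact: (g_gt0 st).
rewrite (uP_rate_eq1 st) // d0 !mulr0 subr0; apply: mulr_gt0.
  by apply: mulr_gt0; [exact: (disc_gt0 st)|exact: (unfaked_gt0 hs)].
exact: (gainP_gt0 st).
Qed.

End LastStop.

Lemma stop_tau : cdf FP tau = 1 /\ forall t, 0 <= t -> t < tau -> cdf FP t < 1.
Proof.
have [T [T0 Tt FT Flt]] := last_stop st hs eq F0.
by have e := last_stop_tau T0 Tt FT Flt; rewrite -e.
Qed.

Let Ftau := stop_tau.1.
Let Flt := stop_tau.2.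

Lemma acc_search t : 0 <= t -> t < tau -> a t = 1.
Proof. exact: (acc_before st hs eq (lexx tau) Ftau Flt). Qed.

Lemma no_fake_after t : tau <= t -> ~ active FA t%:E.
Proof. exact: (no_late_fake tau0 (lexx tau) Ftau Flt). Qed.

Lemma cdfA_tau : cdf FA tau = 1.
Proof. exact: (cdfA_T tau0 (lexx tau) Ftau Flt). Qed.

Lemma uP_max_tau t : (0 <= t)%E -> uP' t <= uP' tau%:E.
Proof. exact: (uP_max tau0 Ftau Flt). Qed.

(** An atom before [tau] would be rejected, contrary to [acc_search]; from [tau] on nobody fakes. *)
Lemma atomA t : 0 <= t -> atom FA t = 0.
Proof.
move=> t0; have [lt|le] := ltP t tau.
  by apply: (acc1_atom st pic) => //; exact: acc_search.
apply/eqP; rewrite eq_le atom_ge0 andbT leNgt; apply/negP => at0.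
by apply: (no_fake_after le); right.
Qed.

Lemma densA_after t : tau <= t -> dens FA t = 0.
Proof.
move=> tt; apply/eqP; rewrite eq_le dens_ge0 ?(le_trans (ltW tau0)) // andbT
  leNgt.
by apply/negP => d0; apply: (no_fake_after tt); left.
Qed.

(** Certain acceptance before [tau] means that the belief is at least [theta], which caps the
    density of fakes by a multiple of that of real news. *)
Lemma densA_bm : bounded_meas 0 tau (dens FA).
Proof.
apply: (@bm_pos _ _ _ ((1 - th) * m * H 0 / ((th - m) * sigma))).
  exact: dens_measurable.
have tm : 0 <= (1 - th) * m.
  by apply: mulr_ge0; [rewrite subr_ge0 ltW // (theta_lt1 st)|exact: ltW
    (mu_gt0 st)].
have ts : 0 < (th - m) * sigma by exact: mulr_gt0.
move=> u /andP[u0]; rewrite le_eqVlt => /predU1P[->|ut].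
  rewrite densA_after // normr0; apply: divr_ge0; last exact: ltW.
  by apply: mulr_ge0 => //; exact: (hazard_ge0 st).
have d0 := dens_ge0 FA u0; rewrite ger0_norm // ler_pdivlMr //.
have := acc1_fake st hs pic u0 (acc_search u0 ut).
rewrite /fakenews /realnews (hazardE st) => h.
have sv := survival_gt0 st u.
have h1 : (dens FA u * ((th - m) * sigma)) * (1 - G p u)
    <= ((1 - th) * m * H u * unfaked sigma FA u) * (1 - G p u) by lra.
rewrite ler_pM2r // in h1; apply: le_trans h1 _.
apply: (@le_trans _ _ ((1 - th) * m * H u)).
  rewrite ler_piMr ?(unfaked_le1 hs) //.
  by apply: mulr_ge0 => //; exact: (hazard_ge0 st).
by rewrite ler_wpM2l // (hazard_nonincr st).
Qed.

Lemma unfaked_prim : primitive 0 tau (unfaked sigma FA) (fun u =>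
  - (sigma * dens FA u)).
Proof.
have db := densA_bm; split.
  by apply: bmN; apply: bmM => //; exact: bm_cst.
move=> s t sge0 st' tt; rewrite /unfaked.
have -> : 1 - sigma * cdf FA t - (1 - sigma * cdf FA s)
  = - sigma * (cdf FA t - cdf FA s) by ring.
rewrite cdf_AC //; last first.
  by move=> x /andP[sx _]; apply: atomA; exact: le_trans (ltW sx).
rewrite -IintZ; last exact/bm_lint/(bm_sub sge0 tt).
by apply: eq_Iint => u _; ring.
Qed.

(** A fake at [s] is strictly worse than one at the midpoint of [s] and [d]: the principal stays
    idle in between, and the waiting gain is positive up to [tau]. A stop at [c] itself does no
    harm, as it affects both alternatives alike. *)
Lemma idle_fakes c d : 0 <= c -> d <= tau ->
  (forall x, c < x -> x < d -> ~ active FP x%:E) ->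
  forall s, c <= s -> s < d -> ~ active FA s%:E.
Proof.
move=> c0 dt idle s cs sd As; pose t := (s + d) / 2.
have sge0 := le_trans c0 cs.
have st' : s < t by rewrite /t; lra.
have td : t < d by rewrite /t; lra.
have ttau := lt_le_trans td dt.
have t0 := le_trans sge0 (ltW st').
have at1 := acc_search t0 ttau.
have Fc u : s <= u <= t -> cdf FP u = cdf FP s.
  move=> /andP[su ut]; apply: inactive_cdf => // x /andP[sx xu].
  by apply: idle; [exact: le_lt_trans sx|exact: le_lt_trans (le_trans xu ut) td].
have := AIC eq (t := s%:E) (t' := t%:E); rewrite !lee_fin => /(_ sge0 t0 As).
rewrite -subr_le0 (uA_diff st sge0 (ltW st') Fc at1).
rewrite (acc_search sge0 (lt_trans st' ttau)) subrr !mulr0 addr0.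
have q0 : 0 < 1 - cdf FP s by rewrite subr_gt0 Flt // (lt_trans st').
rewrite pmulr_rle0 // leNgt => /negP; apply; apply: Iint_gt0 => //.
  have Hb := bm_sub sge0 (lexx t) (hazard_bm st t).
  have db := bm_sub sge0 (lexx t) (disc_bm st t).
  have ab := bm_sub sge0 (lexx t) (acc_bm a t).
  apply/bm_lint/bmB; apply: bmM => //.
    by apply: bmB; [apply: bmM => //|]; exact: bm_cst.
    by apply: bmM => //; exact: bm_cst.
  by apply: bmM => //; apply: bmB => //; exact: bm_cst.
move=> u /andP[su ut]; have u0 := le_trans sge0 (ltW su).
rewrite (acc_search u0 (lt_trans ut ttau)) subrr !mulr0 subr0.
apply: mulr_gt0; first exact: (disc_gt0 st).
apply: lt_le_trans (gainA0_gt0 st) (gainA_ge st u0 _).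
exact: ltW (lt_trans ut ttau).
Qed.

(* Without stopping there is no faking, and searching at a hazard rate above
   phiP pays. *)
Lemma idle_uP c d : 0 <= c -> c < d -> d <= tau ->
  (forall x, c < x -> x < d -> ~ active FP x%:E) -> uP' c%:E < uP' d%:E.
Proof.
move=> c0 cd dt idle; have d0 := le_trans c0 (ltW cd).
apply: (prim_lt (uP_prim st hs pic d)) => // u /andP[cu ud].
have u0 := le_trans c0 (ltW cu); have ut := lt_le_trans ud dt.
have An := idle_fakes c0 dt idle (ltW cu) ud.
have dn : dens FA u = 0.
  apply/eqP; rewrite eq_le dens_ge0 // andbT leNgt; apply/negP => dp.
  by apply: An; left.
rewrite (uP_rate_eq1 st) ?acc_search // dn !mulr0 subr0; apply: mulr_gt0.
  by apply: mulr_gt0; [exact: (disc_gt0 st)|exact: (unfaked_gt0 hs)].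
exact: (gainP_gt0 st).
Qed.

(** [t] is the first time at which [uP] reaches its maximum. If [uP] were below the maximum at a
    later [d], there would be an inactive stretch ending at [d], on which [uP] rises strictly by
    [idle_uP], although it starts at the maximum. *)
Lemma search_start : exists t, [/\ 0 <= t, t <= tau,
  (forall x, 0 <= x -> x < t -> ~ active FP x%:E) &
  (forall x, t <= x -> x <= tau -> uP' x%:E = uP' tau%:E)].
Proof.
have t0 := ltW tau0.
have [t [tge0 tt Vt Ht]] := prim_first (uP_prim st hs pic tau) t0 (lexx (uP'
  tau%:E)).
have below x : 0 <= x -> uP' x%:E < uP' tau%:E -> ~ active FP x%:E.
  move=> x0 lt Ax; have := @picT x%:E tau%:E; rewrite !lee_fin => /(_ x0 t0 Ax).
  by rewrite leNgt lt.
exists t; split => //; first by move=> x x0 xt; apply: below => //; exact: Ht.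
move=> d td dt; have d0 := le_trans tge0 td.
apply/eqP; rewrite eq_le uP_max_tau ?lee_fin //= leNgt; apply/negP => lt.
(* [c] is the last time before [d] at which [uP] is maximal. *)
have [c [tc cd Vc Hc]] := prim_last (prim_sub tge0 dt (uP_prim st hs pic tau))
  td Vt.
have c0 := le_trans tge0 tc.
have {}cd : c < d.
  by rewrite lt_def cd andbT; apply/eqP => e; move: lt; rewrite e ltNge Vc.
have := idle_uP c0 cd dt.
move=> /(_ _)/lt_trans => /(_ _ _ lt); rewrite ltNge Vc => h.
suff : false by [].
apply: h => x cx xd; apply: below; first exact: le_trans (ltW cx).
exact: Hc (ltW xd).
Qed.

End Search.

(** * Explicit distributions and uniqueness *)

Section Formulas.
Context {R : realType} (p : primitives R) (tau : R) (st : setting p tau).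
Context (sigma : R) (hs : 0 < sigma < 1).
Local Notation leb := (@lebesgue_measure R).
Local Notation th := (theta p).
Local Notation be := (beta p).
Local Notation m := (mu p).
Local Notation r := (rho p).
Local Notation H := (hazard p).

Let s0 : 0 < sigma. Proof. by case/andP: hs. Qed.
Let tau0 := tau_gt0 st.
Let mb0 : 0 < m - be. Proof. by rewrite subr_gt0 (beta_lt_mu st). Qed.
Let thm0 : 0 < th - m. Proof. by rewrite subr_gt0 (mu_lt_theta st). Qed.

Definition tail (k : R -> R) (s t : R) : R :=
  expR (- \int[leb]_(u in `[s, t]) k u).

(** The principal's remaining mass [tail (rateP p) ts tau] is an atom at [tau]. In [fake_cdf] the
    division by [sigma] occurs because the tail describes [1 - sigma * cdf FA]. *)
Definition stop_cdf (ts t : R) : R :=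
  if t < ts then 0 else if t < tau then 1 - tail (rateP p) ts t else 1.

Definition fake_cdf (ts t : R) : R :=
  if t < ts then 0 else if t < tau then (1 - tail (rateA p) ts t) / sigma else 1.

Lemma tail_gt0 k s t : 0 < tail k s t. Proof. exact: expR_gt0. Qed.

Lemma tail_id k s : tail k s s = 1.
Proof. by rewrite /tail Iint_set1 oppr0 expR0. Qed.

Section Equilibrium.
Context (a : acceptance R) (FP FA : timing R).
Context (eq : equilibrium p sigma a FP FA) (F0 : cdf FP 0 < 1).
Local Notation uP' := (uP p sigma a FA).
Local Notation uA' := (uA p a FP).
Let pic : picA p sigma a FA := PICa eq.
Let picT := PICt eq.

Section Start.
Context (ts : R) (ts0 : 0 <= ts) (tst : ts <= tau).
Context (idle : forall x, 0 <= x -> x < ts -> ~ active FP x%:E).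
Context (flat : forall x, ts <= x -> x <= tau -> uP' x%:E = uP' tau%:E).

Lemma no_early_fake x : 0 <= x -> x < ts -> ~ active FA x%:E.
Proof.
apply: (idle_fakes st hs eq F0 (lexx 0) tst) => y /ltW y0 yt; exact: idle.
Qed.

Lemma densA_before x : 0 <= x -> x < ts -> dens FA x = 0.
Proof.
move=> x0 xt; apply/eqP; rewrite eq_le dens_ge0 // andbT leNgt; apply/negP => dp.
by apply: (no_early_fake x0 xt); left.
Qed.

Lemma unfaked_before x : 0 <= x -> x <= ts -> unfaked sigma FA x = 1.
Proof.
move=> x0 xt; rewrite (@prim_const _ 0 tau _ _ 0 x (unfaked_prim st hs eq F0)) //.
- by rewrite /unfaked cdf_at0 (atomA st hs eq F0) // mulr0 subr0.
- exact: le_trans tst.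
- move=> u /andP[u0 ux]; rewrite densA_before ?mulr0 ?oppr0 // ?ltW //.
  exact: lt_le_trans xt.
Qed.

Lemma unfaked_after t : ts <= t <= tau ->
  unfaked sigma FA t = tail (rateA p) ts t.
Proof.
move=> tst'; rewrite -[RHS]mul1r -(unfaked_before ts0 (lexx ts)).
apply: (disc_linear st (b := tau)) => //.
  exact: bm_sub ts0 (lexx tau) (rateA_bm st tau).
have pQ := prim_sub ts0 (lexx tau) (unfaked_prim st hs eq F0).
have pd := prim_sub ts0 (lexx tau) (prim_disc st tau).
have pu := prim_sub ts0 (lexx tau) (uP_prim st hs pic tau).
(* The added multiple of [uP - uP tau] vanishes on [[ts, tau]], but its rate cancels [dens FA] and
   brings in [rateA]. Thus no almost-everywhere identity between rates has to be extracted from the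
   flatness of [uP]. *)
have pr := primD (primM pd pQ) (primZ (- (th - m)^-1) (primD pu (prim_cst _ _
  (- uP' tau%:E)))).
have kbm : bounded_meas ts tau (fun u =>
  - (r + H u + rateA p u) * (disc p u * unfaked sigma FA u)).
  apply: (bm_sub ts0 (lexx tau)); apply: bmM.
    apply: bmN; apply: bmD; last exact: (rateA_bm st).
    by apply: bmD; [exact: bm_cst|exact: (hazard_bm st)].
  by apply: bmM; [exact: (disc_bm st)|exact: unfaked_bm].
apply: (eq_primF _ (eq_prim_oo kbm _ pr)).
  by move=> u /andP[tu ut]; rewrite flat // subrr mulr0 addr0.
move=> u /andP[tu ut]; have u0 := le_trans ts0 (ltW tu).
rewrite (uP_rate_eq1 st) ?(acc_search st hs eq F0) // -(rateAE st).
by field; rewrite gt_eqF.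
Qed.

Lemma tail_sigma : tail (rateA p) ts tau = 1 - sigma.
Proof.
by rewrite -unfaked_after ?tst ?lexx // /unfaked (cdfA_tau st hs eq F0) mulr1.
Qed.

Lemma start_lt : ts < tau.
Proof.
rewrite lt_def tst andbT; apply/eqP => e; have := tail_sigma.
by have := s0; rewrite e tail_id; lra.
Qed.

Lemma fakes_everywhere s t : ts <= s -> s < t -> t <= tau -> cdf FA s < cdf FA t.
Proof.
move=> tss st' tt; have sge0 := le_trans ts0 tss.
suff : unfaked sigma FA t < unfaked sigma FA s.
  by rewrite /unfaked ltrD2l ltrN2 ltr_pM2l.
rewrite !unfaked_after ?tss ?tt ?(le_trans tss (ltW st')) ?(le_trans (ltW st')
  tt) //.
rewrite /tail ltr_expR ltrN2.
have pK := prim_int (bm_sub ts0 tt (rateA_bm st tau)).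
apply: (prim_lt pK) => // u /andP[su ut].
exact: (rateA_gt0 st (le_trans sge0 (ltW su)) (lt_le_trans ut tt)).
Qed.

Lemma fake_in s t : ts <= s -> s < t -> t <= tau ->
  exists2 x, s < x <= t & active FA x%:E.
Proof.
move=> tss st' tt; have sge0 := le_trans ts0 tss.
by apply: active_in => //; [exact: ltW|exact: fakes_everywhere].
Qed.

Let lot (u : R) := uA_flow p a FP u + (m - be) * waiting p FP u.

(** Every right neighbourhood of a point of [[ts, tau[] contains an active faking time, where [lot]
    equals the optimum; right continuity extends this to the point itself. *)
Lemma fake_indifference x y : ts <= x -> x < tau -> ts <= y -> y < tau ->
  lot x = lot y.
Proof.
have [z /andP[tz zt] Az] := fake_in (lexx ts) start_lt (lexx tau).
have z0 := le_trans ts0 (ltW tz).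
suff key x' : ts <= x' -> x' < tau -> lot x' = uA' z%:E.
  by move=> *; rewrite !key.
move=> tx xt; have x0 := le_trans ts0 tx.
apply/eqP; rewrite -subr_eq0 -normr_le0; apply/ler_addgt0Pr => e e0;
  rewrite add0r.
have [d d0 Hd] := lot_right_continuous st a FP x0 e0.
pose t := Num.min (x' + d) ((x' + tau) / 2).
have xlt : x' < t by rewrite lt_min ltrDl d0 /=; lra.
have tlt : t < tau by rewrite gt_min; apply/orP; right; lra.
have [w /andP[xw wt] Aw] := fake_in tx xlt (ltW tlt).
have w0 := le_trans x0 (ltW xw).
have aw := acc_search st hs eq F0 w0 (le_lt_trans wt tlt).
have wE : lot w = uA' w%:E by rewrite (uA_acc1 st).
have wz : uA' w%:E = uA' z%:E.
  apply/eqP; rewrite eq_le; apply/andP; split.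
    by have := AIC eq (t := z%:E) (t' := w%:E); rewrite !lee_fin => /(_ z0 w0 Az).
  by have := AIC eq (t := w%:E) (t' := z%:E); rewrite !lee_fin => /(_ w0 z0 Aw).
rewrite -wz -wE distrC; apply: Hd; first exact: ltW.
by apply: le_trans wt _; rewrite ge_min lexx.
Qed.

(** Constancy of [lot] writes [waiting] as a constant minus a multiple of [uA_flow]. So it is
    Lipschitz, with a rate known from [acc_search], and [disc_linear] solves for [1 - cdf FP]. *)
Lemma stop_tail t : ts <= t -> t < tau ->
  1 - cdf FP t = (1 - cdf FP ts) * tail (rateP p) ts t.
Proof.
move=> tt ttau; have t0 := le_trans ts0 tt.
apply: (disc_linear st (b := t) (Y := fun u => 1 - cdf FP u)) => //; last 1 first.
- by rewrite tt lexx.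
- exact: bm_sub ts0 (lexx t) (rateP_bm st t).
have pf := prim_sub ts0 (lexx t) (uA_flow_prim st a FP t).
have pr := primD (prim_cst ts t ((m - be)^-1 * lot ts)) (primZ (- (m - be)^-1)
  pf).
apply: (eq_primF _ (eq_prim _ pr)) => u /andP[tu ut]; have u0 := le_trans ts0 tu.
  have := fake_indifference tu (le_lt_trans ut ttau) (lexx ts) start_lt.
  move=> <-; rewrite /lot -/(waiting p FP u); field; rewrite gt_eqF //.
rewrite /uA_rate (acc_search st hs eq F0 u0 (le_lt_trans ut ttau)) -/(waiting
  p FP u).
have e : rateP p u = (be * (1 - m) * H u - r * m) / (m - be) by [].
by rewrite e; field; rewrite gt_eqF.
Qed.

(** A stopping atom at [ts] would make [lot] drop there, and faking just before [ts], where nobody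
    has stopped yet, would beat the equilibrium payoff. *)
Lemma stop_start : 0 < ts -> cdf FP ts = 0.
Proof.
move=> tsp; apply/eqP; rewrite eq_le cdf_ge0 andbT.
have [z /andP[tz zt] Az] := fake_in (lexx ts) start_lt (lexx tau).
have z0 := le_trans ts0 (ltW tz).
have ztau : z < tau.
  rewrite lt_def zt andbT; apply/eqP => e; rewrite -e in Az.
  exact: (no_fake_after st hs eq F0 (lexx tau)).
have zE : uA' z%:E = lot ts.
  rewrite (uA_acc1 st) ?(acc_search st hs eq F0) //.
  exact: fake_indifference (ltW tz) ztau (lexx ts) start_lt.
have pf := prim_sub (lexx 0) tst (uA_flow_prim st a FP tau).
have pd := prim_sub (lexx 0) tst (prim_disc st tau).
have := prim_le_left (v := lot ts) (primD pf (primZ (m - be) pd)) tsp.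
move=> h; have {}h : uA_flow p a FP ts + (m - be) * disc p ts <= lot ts.
  apply: h => u u0 ut; have utau := lt_le_trans ut tst.
  have Fu : cdf FP u = 0.
    by apply: inactive_cdf0 => // x /andP[x0 xu]; apply: idle => //;
      exact: le_lt_trans ut.
  have := AIC eq (t := z%:E) (t' := u%:E); rewrite !lee_fin => /(_ z0 u0 Az).
  rewrite zE (uA_acc1 st) ?(acc_search st hs eq F0) //.
  by rewrite /waiting Fu subr0 mulr1.
have d0 := disc_gt0 st ts.
have : (m - be) * disc p ts * cdf FP ts <= 0.
  by move: h; rewrite /lot /waiting; lra.
by rewrite pmulr_rle0 // mulr_gt0.
Qed.

Lemma payoff_start : payoffP p sigma a FP FA =
  th + (th - m) * \int[leb]_(u in `[0, ts]) (disc p u * rateA p u).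
Proof.
have [x /andP[x0 xt] Ax] : exists2 x, 0 < x <= tau & active FP x%:E.
  apply: active_in => //; first exact: ltW.
  by rewrite (stop_tau st hs eq F0).1.
rewrite (payoff_active st hs pic picT (t := x%:E)) ?lee_fin ?ltW //.
have -> : uP' x%:E = uP' ts%:E.
  rewrite (flat (lexx ts) tst); apply/eqP; rewrite eq_le.
  apply/andP; split.
    by apply: (uP_max_tau st hs eq F0); rewrite lee_fin ltW.
  have := @picT x%:E tau%:E; rewrite !lee_fin.
  by move=> /(_ (ltW x0) (ltW tau0) Ax).
rewrite (uP_fin st hs pic) //; congr (_ + _).
have lr := bm_lint (bm_sub (lexx 0) (lexx ts)
  (bmM (disc_bm st ts) (rateA_bm st ts))).
rewrite -(IintZ _ lr) (Iint_oo (bm_lint (uP_rate_bm st hs pic ts))).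
rewrite (Iint_oo (lintZ _ lr)).
apply: eq_Rintegral => u; rewrite inE /= in_itv /= => /andP[/ltW u0 ut].
have utau := lt_le_trans ut tst.
rewrite (uP_rate_eq1 st) ?(acc_search st hs eq F0) //.
rewrite densA_before // unfaked_before ?(ltW ut) // -(rateAE st); ring.
Qed.

(** From [tau] on there are no fakes: where [g] is positive the belief is 1, and where [g] vanishes
    [mu1] is 0 / 0 = 0, so type-1 news is rejected. Before [tau] the density [g] is positive. *)
Lemma profile_start t : 0 < ts -> 0 <= t ->
  [/\ a t = (if 0 < g p t then 1 else 0), cdf FP t = stop_cdf ts t
    & cdf FA t = fake_cdf ts t].
Proof.
move=> tsp t0; split.
- have [tt|tt] := ltP t tau.
    by rewrite (acc_search st hs eq F0) // (g_gt0 st).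
  have An := no_fake_after st hs eq F0 tt.
  case: ifPn => [g0|]; first exact: (acc_inactive st hs pic).
  rewrite -leNgt => g0; apply: (acc_noreal st pic) => //.
  by apply/eqP; rewrite eq_le g0 (g_ge0 (newsG st)).
- rewrite /stop_cdf; have [lt|le] := ltP t ts.
    apply: inactive_cdf0 => // x /andP[x0 xt]; apply: idle => //.
    exact: le_lt_trans lt.
  have [ltt|let_] := ltP t tau.
    by have := stop_tail le ltt; rewrite stop_start // subr0 mul1r => <-; lra.
  apply/eqP; rewrite eq_le cdf_le1 -[X in X <= _](stop_tau st hs eq F0).1
    cdf_le //.
  exact: ltW.
- rewrite /fake_cdf; have [lt|le] := ltP t ts.
    have := unfaked_before t0 (ltW lt); rewrite /unfaked => e.
    have : sigma * cdf FA t = 0 by lra.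
    by move/eqP; rewrite mulf_eq0 gt_eqF //= => /eqP.
  have [ltt|let_] := ltP t tau.
    have := @unfaked_after t; rewrite le ltW // => /(_ isT) <-.
    by rewrite /unfaked; field; rewrite gt_eqF.
  apply/eqP; rewrite eq_le cdf_le1 -[X in X <= _](cdfA_tau st hs eq F0) cdf_le //.
  exact: ltW.
Qed.

End Start.

(** The profile is given only for [0 < ts], because [stop_start] rules out an atom at [ts] by
    comparison with earlier fakes. *)
Lemma search_characterization : exists ts, [/\ 0 <= ts, ts < tau,
  tail (rateA p) ts tau = 1 - sigma,
  payoffP p sigma a FP FA =
    th + (th - m) * \int[leb]_(u in `[0, ts]) (disc p u * rateA p u) &
  0 < ts -> forall t, 0 <= t ->
    [/\ a t = (if 0 < g p t then 1 else 0), cdf FP t = stop_cdf ts t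
      & cdf FA t = fake_cdf ts t]].
Proof.
have [ts [ts0 tst idle flat]] := search_start st hs eq F0.
exists ts; split => //.
- exact: start_lt ts0 tst idle flat.
- exact: tail_sigma.
- exact: payoff_start.
- by move=> tsp t t0; exact: (profile_start ts0 tst idle flat tsp t0).
Qed.

End Equilibrium.

Lemma tail_inj s t : 0 <= s -> s <= tau -> 0 <= t -> t <= tau ->
  tail (rateA p) s tau = tail (rateA p) t tau -> s = t.
Proof.
wlog lt : s t / s < t => [hw|] sge0 stau t0 tt e.
  have [lt|lt|//] := ltgtP s t.
    exact: (hw _ _ lt sge0 stau t0 tt e).
  exact/esym/(hw _ _ lt t0 tt sge0 stau (esym e)).
exfalso; move: e; rewrite /tail => /expR_inj /oppr_inj.
rewrite (lint_split (c := t) (ltW lt) tt); last first.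
  exact/bm_lint/(bm_sub sge0 (lexx tau) (rateA_bm st tau)).
have : 0 < \int[leb]_(u in `[s, t]) rateA p u.
  apply: Iint_gt0 => //; first exact/bm_lint/(bm_sub sge0 tt (rateA_bm st tau)).
  move=> u /andP[su ut]; apply: (rateA_gt0 st); last exact: lt_le_trans tt.
  exact: le_trans (ltW su).
lra.
Qed.

End Formulas.

(** * Existence *)

Section HazardTiming.
Context {R : realType} (ts tau c w : R) (k : R -> R).
Context (ts0 : 0 <= ts) (tst : ts < tau) (c0 : 0 <= c) (w0 : 0 <= w).
Context (kbm : bounded_meas ts tau k) (k0 : forall u, ts <= u -> u <= tau ->
  0 <= k u).
Context (mass : c * (1 - tail k ts tau) + w = 1).
Local Notation leb := (@lebesgue_measure R).
Local Notation pos := (`[0%R, +oo[%classic : set R).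

Let f (u : R) := c * (k u * tail k ts u).
(** The interval is half-open to keep [tau] inactive for the agent: at [tau] the principal has
    already stopped, and a fake would earn less. *)
Let d := patch (fun=> 0 : R) (`[ts, tau[%classic : set R) f.
Let at_ (t : R) := if t == tau then w else 0.

Lemma prim_tail : primitive ts tau (tail k ts) (fun u => - (k u * tail k ts u)).
Proof.
apply: (eq_primF _ (eq_prim _ (prim_expR (primZ (-1) (prim_int kbm))))) => u _ /=.
  by rewrite /tail mulN1r.
by rewrite /tail !mulN1r; ring.
Qed.

Let f_prim : primitive ts tau (fun u => - c * tail k ts u) f.
Proof.
by apply: (eq_prim _ (primZ (- c) prim_tail)) => u _ /=; rewrite /f; ring.
Qed.

Let f_int t : ts <= t -> t <= tau ->
  \int[leb]_(u in `[ts, t]) f u = c * (1 - tail k ts t).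
Proof.
move=> st' tt; have [_ <-] := f_prim => //.
by rewrite tail_id; ring.
Qed.

Let d_in u : ts <= u -> u < tau -> d u = f u.
Proof. by move=> tu ut; rewrite /d patchT // inE /= in_itv /= tu ut. Qed.

Let d_out u : u < ts \/ tau <= u -> d u = 0.
Proof.
move=> h; rewrite /d patchC // inE /= in_itv /= => /andP[tu ut].
by case: h => h; [move: tu; rewrite leNgt h|move: ut; rewrite ltNge h].
Qed.

Let d_meas : measurable_fun pos d.
Proof.
have [[mf _] _] := f_prim.
have sub : (`[ts, tau[%classic : set R) `<=` `[ts, tau]%classic.
  by move=> u; rewrite /= !in_itv /= => /andP[-> /ltW ->].
have mfo : measurable_fun (`[ts, tau[%classic : set R) f.
  exact: (measurable_funS (measurable_itv _) sub mf).
apply: measurable_funTS.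
exact: (iffLR (measurable_restrictT f (measurable_itv `[ts, tau[)) mfo).
Qed.

Let f_ge0 u : ts <= u -> u <= tau -> 0 <= f u.
Proof. by move=> tu ut; rewrite !mulr_ge0 ?k0 // ltW // tail_gt0. Qed.

Let d_ge0 t : 0 <= t -> 0 <= d t.
Proof.
move=> t0; have [lt|le] := ltP t ts; first by rewrite d_out //; left.
have [lt2|le2] := ltP t tau; last by rewrite d_out //; right.
by rewrite d_in // f_ge0 // ltW.
Qed.

Let at_ge0 t : 0 <= at_ t.
Proof. by rewrite /at_; case: ifP. Qed.

Let at_countable : countable [set t | 0 < at_ t].
Proof.
apply: (@sub_countable _ _ _ [set tau]);
  last exact/finite_set_countable/finite_set1.
apply: subset_card_le => t; rewrite /at_ /=.
by case: eqP => [->//|_]; rewrite ltxx.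
Qed.

Let tau0 : 0 < tau. Proof. exact: le_lt_trans tst. Qed.

Let at_neg t : t < 0 -> at_ t = 0.
Proof.
by move=> t0; rewrite /at_ lt_eqF // (lt_trans t0).
Qed.

Let esum_at (A : set R) : A tau -> (\esum_(s in A) (at_ s)%:E = w%:E)%E.
Proof.
move=> Atau; rewrite (esumID [set tau]); last by move=> x _; rewrite lee_fin.
rewrite (_ : A `&` [set tau] = [set tau]); last first.
  by apply/seteqP; split => [x []|x ->].
rewrite esum_set1 ?lee_fin // esum1; first by rewrite adde0 /at_ eqxx.
by move=> x [_ /= xt]; rewrite /at_; case: eqP.
Qed.

Let d_total : (\int[leb]_(s in pos) (d s)%:E = (c * (1 - tail k ts tau))%:E)%E.
Proof.
have fl := bm_lint (f_prim.1).
have e : pos `&` `[ts, tau[%classic = `[ts, tau[%classic.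
  apply/seteqP; split => x; first by case.
  by rewrite /= !in_itv /= => /andP[tx xt]; rewrite tx xt (le_trans ts0).
rewrite -(f_int (ltW tst) (lexx tau)) -Rintegral_itv_bndo_bndc; last first.
  by apply: integrableS fl => // u; rewrite /= !in_itv /= => /andP[-> /ltW ->].
rewrite /Rintegral fineK; last first.
  apply: integrable_fin_num => //.
  by apply: integrableS fl => // u; rewrite /= !in_itv /= => /andP[-> /ltW ->].
rewrite -[in RHS]e integral_mkcondr; apply: eq_integral => u _.
by rewrite /d /patch; case: ifP.
Qed.

Let d_mass : (\int[leb]_(s in pos) (d s)%:E + \esum_(s in pos) (at_ s)%:E <= 1)%E.
Proof.
rewrite d_total esum_at; last by rewrite /= in_itv /= ltW.
by rewrite -EFinD mass.
Qed.

(** One construction for both players: [c = sigma^-1] and [w = 0] give the faking time, [c = 1] and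
    [w = tail (rateP p) ts tau] the stopping time. *)
Definition hazard_timing : timing R :=
  Timing d_meas d_ge0 at_ge0 at_countable at_neg d_mass.

Lemma hazard_dens_in u : ts <= u -> u < tau ->
  dens hazard_timing u = c * (k u * tail k ts u).
Proof. exact: d_in. Qed.

Lemma hazard_dens_out u : u < ts \/ tau <= u -> dens hazard_timing u = 0.
Proof. exact: d_out. Qed.

Lemma hazard_atom u : atom hazard_timing u = if u == tau then w else 0.
Proof. by []. Qed.

Let d_lint t : itv_integrable 0 t d.
Proof. exact: (dens_lint hazard_timing t). Qed.

Let d_before t : 0 <= t -> t <= ts -> \int[leb]_(u in `[0, t]) d u = 0.
Proof.
move=> t0 tt; rewrite Iint_oo // (@eq_Rintegral _ _ _ leb _ (fun=> 0));
  last first.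
  move=> u; rewrite inE /= in_itv /= => /andP[_ ut]; rewrite d_out //.
  by left; exact: lt_le_trans tt.
by rewrite /Rintegral integral0.
Qed.

Let d_upto t : ts <= t -> t <= tau ->
  \int[leb]_(u in `[0, t]) d u = c * (1 - tail k ts t).
Proof.
move=> tt ttau; rewrite (lint_split ts0 tt (d_lint t)) d_before // add0r.
rewrite -f_int // !Iint_oo; last 2 first.
- exact/bm_lint/(bm_sub (lexx ts) ttau f_prim.1).
- exact: lint_sub ts0 (lexx t) (d_lint t).
apply: eq_Rintegral => u; rewrite inE /= in_itv /= => /andP[/ltW tu ut].
by rewrite d_in // (lt_le_trans ut).
Qed.

Lemma hazard_cdf t : 0 <= t -> cdf hazard_timing t =
  if t < ts then 0 else if t < tau then c * (1 - tail k ts t) else 1.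
Proof.
move=> t0; have c00 : cdf hazard_timing 0 = 0.
  by rewrite cdf_at0 hazard_atom lt_eqF.
have AC : t < tau -> cdf hazard_timing t = \int[leb]_(u in `[0, t]) d u.
  move=> tt; rewrite -(cdf_AC (F := hazard_timing) (lexx 0) t0) ?c00 ?subr0 //.
  by move=> x /andP[_ xt]; rewrite hazard_atom lt_eqF // (le_lt_trans xt).
case: ltP => [lt|le]; first by rewrite AC ?d_before ?(ltW lt) // (lt_trans lt).
case: ltP => [lt|tt]; first by rewrite AC // d_upto // ltW.
apply/eqP; rewrite eq_le cdf_le1 /=.
apply: le_trans (cdf_le hazard_timing (ltW tau0) tt).
rewrite -[leLHS]mass /cdf /tint le_eqVlt; apply/orP; left; apply/eqP.
congr (_ + _).
  transitivity (\int[leb]_(u in `[0, tau]) d u).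
    by rewrite (d_upto (ltW tst) (lexx tau)).
  by apply: eq_Rintegral => u _; rewrite mul1r.
rewrite -[LHS]/(fine w%:E) -(@esum_at `[0, tau]%classic); last first.
  by rewrite /= in_itv /= lexx ltW.
by congr fine; apply: eq_esum => u _; rewrite mul1r.
Qed.

End HazardTiming.

(** * The equilibrium whose search starts at [ts] *)

Section Existence.
Context {R : realType} (p : primitives R) (tau : R) (st : setting p tau).
Context (sigma : R) (hs : 0 < sigma < 1).
Context (ts : R) (ts0 : 0 < ts) (tst : ts < tau)
        (tsE : tail (rateA p) ts tau = 1 - sigma).
Local Notation leb := (@lebesgue_measure R).
Local Notation pos := (`[0%R, +oo[%classic : set R).
Local Notation th := (theta p).
Local Notation be := (beta p).
Local Notation m := (mu p).
Local Notation r := (rho p).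
Local Notation H := (hazard p).

Let s0 : 0 < sigma. Proof. by case/andP: hs. Qed.
Let tau0 := tau_gt0 st.
Let mb0 : 0 < m - be. Proof. by rewrite subr_gt0 (beta_lt_mu st). Qed.
Let thm0 : 0 < th - m. Proof. by rewrite subr_gt0 (mu_lt_theta st). Qed.

Let acceptance_fun (t : R) : R := if 0 < g p t then 1 else 0.

Let acceptance_measurable : measurable_fun pos acceptance_fun.
Proof.
apply: measurable_fun_if => //; try exact: measurable_cst.
by apply: measurable_fun_ltr;
  [exact: measurable_cst|exact: g_measurable (newsG st)].
Qed.

Let acceptance_itv t : 0 <= t -> 0 <= acceptance_fun t <= 1.
Proof. by move=> _; rewrite /acceptance_fun; case: ifP; rewrite ?lexx ?ler01. Qed.

Definition accept_real : acceptance R :=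
  Acceptance acceptance_measurable acceptance_itv.

Let rateA_itv : bounded_meas ts tau (rateA p).
Proof. exact: bm_sub (ltW ts0) (lexx tau) (rateA_bm st tau). Qed.

Let rateP_itv : bounded_meas ts tau (rateP p).
Proof. exact: bm_sub (ltW ts0) (lexx tau) (rateP_bm st tau). Qed.

Let rateA_nneg u : ts <= u -> u <= tau -> 0 <= rateA p u.
Proof. by move=> tu ut; apply: (rateA_ge0 st) => //;
  exact: le_trans (ltW ts0) tu. Qed.

Let rateP_nneg u : ts <= u -> u <= tau -> 0 <= rateP p u.
Proof. by move=> tu ut; apply/ltW/(rateP_gt0 st) => //;
  exact: le_trans (ltW ts0) tu. Qed.

Let massA : sigma^-1 * (1 - tail (rateA p) ts tau) + 0 = 1.
Proof. by rewrite tsE subKr addr0 mulVf // gt_eqF. Qed.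

Let massP : 1 * (1 - tail (rateP p) ts tau) + tail (rateP p) ts tau = 1.
Proof. by rewrite mul1r subrK. Qed.

Let sigmaV0 : 0 <= sigma^-1. Proof. by rewrite invr_ge0 ltW. Qed.

Definition fake_timing : timing R :=
  hazard_timing (ltW ts0) tst sigmaV0 (lexx 0) rateA_itv rateA_nneg massA.

Definition stop_timing : timing R :=
  hazard_timing (ltW ts0) tst ler01 (ltW (tail_gt0 (rateP p) ts tau))
    rateP_itv rateP_nneg massP.

Let a := accept_real.
Let FP := stop_timing.
Let FA := fake_timing.
Local Notation uP' := (uP p sigma a FA).
Local Notation uA' := (uA p a FP).

Let acc1 t : 0 <= t -> t < tau -> a t = 1.
Proof. by move=> t0 tt; rewrite /= /acceptance_fun (g_gt0 st). Qed.

Let Q_before t : 0 <= t -> t < ts -> unfaked sigma FA t = 1.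
Proof. by move=> t0 tt; rewrite /unfaked hazard_cdf // tt mulr0 subr0. Qed.

Let Q_after t : ts <= t -> t < tau -> unfaked sigma FA t = tail (rateA p) ts t.
Proof.
move=> tt ttau; have t0 := le_trans (ltW ts0) tt.
rewrite /unfaked hazard_cdf // ltNge tt /= ttau mulrA mulfV ?gt_eqF // mul1r.
by rewrite subKr.
Qed.

Let fakes_after t : ts <= t -> t < tau ->
  sigma * dens FA t = rateA p t * unfaked sigma FA t.
Proof.
move=> tt ttau; rewrite Q_after // hazard_dens_in // mulrA mulfV ?gt_eqF //
  mul1r //.
Qed.

Let fakes_out t : t < ts \/ tau <= t -> dens FA t = 0.
Proof. exact: hazard_dens_out. Qed.

Let atomA0 t : atom FA t = 0.
Proof. by rewrite hazard_atom; case: ifP. Qed.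

(** With faking hazard [rateA], fakes weighted by [theta - mu] fall short of real news weighted by
    [1 - theta] by exactly the discounting term [r * th], which is nonnegative; so the belief never
    falls below [theta] before [tau]. *)
Lemma pic_exists : picA p sigma a FA.
Proof.
move=> t t0.
have real0 := realnews_ge0 st hs FA t0.
have fake0 : 0 <= fakenews p sigma FA t := fakenews_ge0 st hs FA t0.
have news0 : 0 < g p t -> 0 < realnews p sigma FA t + fakenews p sigma FA t.
  by move=> g0; rewrite ltr_wpDr // (realnews_gt0 st hs).
rewrite mu1E // /a /= /acceptance_fun.
have nofake : dens FA t = 0 -> fakenews p sigma FA t = 0.
  by move=> d0; rewrite /fakenews d0 mulr0 mul0r.
have th0 := theta_gt0 st.
case: ifPn => [g0|]; last first.
  rewrite -leNgt => g0; have {}g0 : g p t = 0.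
    by apply/eqP; rewrite eq_le g0 (g_ge0 (newsG st)).
  have tt : tau <= t by rewrite leNgt; apply/negP => /(g_gt0 st t0);
    rewrite g0 ltxx.
  split=> //; rewrite nofake; last by apply: fakes_out; right.
  by rewrite /realnews g0 !(mulr0, mul0r) addr0 mul0r ltNge (ltW th0).
split=> //; suff : th <= (realnews p sigma FA t + m * fakenews p sigma FA t) /
    (realnews p sigma FA t + fakenews p sigma FA t) by rewrite leNgt =>
      /negbTE ->.
rewrite ler_pdivlMr ?news0 //.
have [[tt ttau]|out] : (ts <= t /\ t < tau) \/ (t < ts \/ tau <= t).
  have [?|?] := ltP t ts; first by right; left.
  by have [?|?] := ltP t tau; [left|right; right].
- have e : (th - m) * fakenews p sigma FA t =
      (m * (1 - th) * H t - r * th) * unfaked sigma FA t * (1 - G p t).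
    by rewrite /fakenews fakes_after // -(rateAE st); ring.
  have e2 : (1 - th) * realnews p sigma FA t =
      m * (1 - th) * H t * unfaked sigma FA t * (1 - G p t).
    by rewrite /realnews (hazardE st); ring.
  have : 0 <= r * th * unfaked sigma FA t * (1 - G p t).
    apply: mulr_ge0; last exact: ltW (survival_gt0 st t).
    apply: mulr_ge0; last exact: ltW (unfaked_gt0 hs FA t).
    by apply: mulr_ge0; apply: ltW => //; exact: (rho_gt0 st).
  lra.
- rewrite nofake; last exact: fakes_out.
  by rewrite mulr0 !addr0 ler_piMl // ltW // (theta_lt1 st).
Qed.

Let pic := pic_exists.

Let rate_before u : 0 <= u -> u < ts ->
  uP_rate p sigma a FA u = (th - m) * (disc p u * rateA p u).
Proof.
move=> u0 ut; have utau := lt_trans ut tst.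
rewrite (uP_rate_eq1 st) ?acc1 // fakes_out ?Q_before //; last by left.
by rewrite -(rateAE st); ring.
Qed.

Let rate_after u : ts <= u -> u < tau -> uP_rate p sigma a FA u = 0.
Proof.
move=> tu ut; have u0 := le_trans (ltW ts0) tu.
rewrite (uP_rate_eq1 st) ?acc1 // -(rateAE st).
have e := fakes_after tu ut.
rewrite (_ : sigma * (disc p u * dens FA u) = disc p u * (sigma * dens FA u));
  last by ring.
by rewrite e; ring.
Qed.

Let uP_flat t : ts <= t -> t <= tau -> uP' t%:E = uP' ts%:E.
Proof.
move=> tt ttau; apply: (prim_const (uP_prim st hs pic tau)) => //;
  first exact: ltW.
by move=> u /andP[tu ut]; rewrite rate_after ?(ltW tu) // (lt_le_trans ut).
Qed.

Let uP_le_start (t : \bar R) : (0 <= t)%E -> uP' t <= uP' ts%:E.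
Proof.
have tauE := uP_flat (ltW tst) (lexx tau).
case: t => [t||] //; last by move=> _; rewrite -tauE;
  exact: ltW (uP_oo_lt st hs pic).
rewrite lee_fin => t0; have [lt|le] := ltP t ts.
  apply/ltW/(prim_lt (uP_prim st hs pic tau)) => //; first exact: ltW.
  move=> u /andP[tu ut]; have u0 := le_trans t0 (ltW tu).
  rewrite rate_before // mulr_gt0 // mulr_gt0 ?(disc_gt0 st) //.
  exact: (rateA_gt0 st u0 (lt_trans ut tst)).
have [le2|lt2] := leP t tau; first by rewrite uP_flat.
by rewrite -tauE; apply/ltW/(uP_lt_after st hs pic).
Qed.

Let active_stop t : 0 <= t -> active FP t%:E -> ts <= t /\ t <= tau.
Proof.
move=> t0 [d0|]; last first.
  by rewrite hazard_atom; case: eqP => [->|_]; rewrite ?ltxx // lexx ltW.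
have [lt|le] := ltP t ts; first by move: d0; rewrite hazard_dens_out ?ltxx //;
  left.
have [lt2|le2] := ltP t tau; first by rewrite ltW.
by move: d0; rewrite hazard_dens_out ?ltxx //; right.
Qed.

Let never_le0 (F : timing R) (t : R) : 0 <= t -> cdf F t = 1 -> ~ active F +oo%E.
Proof.
move=> t0 F1 /=; rewrite /never (cdf_total F t0) F1 subr_gt0 ltNge => /negP;
  apply.
by rewrite lerDl tint_ge0 //; exact: itvoy_pos.
Qed.

Let FP1 : cdf FP tau = 1.
Proof. by rewrite hazard_cdf ?ltW // ltNge (ltW tst) /= ltxx. Qed.

Let FA1 : cdf FA tau = 1.
Proof. by rewrite hazard_cdf ?ltW // ltNge (ltW tst) /= ltxx. Qed.

Lemma picT_exists (t t' : \bar R) : (0 <= t)%E -> (0 <= t')%E ->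
  active FP t -> uP' t' <= uP' t.
Proof.
case: t => [t||] // t0 t'0 At; last by have := never_le0 (ltW tau0) FP1 At.
rewrite lee_fin in t0; have [tt ttau] := active_stop t0 At.
by rewrite (uP_flat tt ttau) uP_le_start.
Qed.

Let lot (u : R) := uA_flow p a FP u + (m - be) * waiting p FP u.

(** By [ratePE], the waiting gain and the loss from stopping at hazard [rateP] cancel. *)
Let lot_after t : ts <= t -> t < tau -> lot t = lot ts.
Proof.
move=> tt ttau; have t0 := le_trans (ltW ts0) tt.
have pf := prim_sub (ltW ts0) (ltW ttau) (uA_flow_prim st a FP tau).
have pd := prim_sub (ltW ts0) (ltW ttau) (prim_disc st tau).
have pt := prim_sub (lexx ts) (ltW ttau) (prim_tail rateP_itv).
have pL := primD pf (primZ (m - be) (primM pd pt)).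
have e u : ts <= u -> u <= t -> lot u =
    uA_flow p a FP u + (m - be) * (disc p u * tail (rateP p) ts u).
  move=> tu ut; have u0 := le_trans (ltW ts0) tu.
  rewrite /lot /waiting hazard_cdf // ltNge tu /= (le_lt_trans ut ttau) mul1r.
  by rewrite subKr.
rewrite (e t tt (lexx t)) (e ts (lexx ts) tt).
apply: (prim_const pL (lexx ts) tt (lexx t)) => u /andP[/ltW tu ut].
have u0 := le_trans (ltW ts0) tu; have utau := lt_trans ut ttau.
rewrite /uA_rate /waiting acc1 // hazard_cdf // ltNge tu /= utau mul1r subKr.
transitivity (disc p u * tail (rateP p) ts u *
  ((1 - be) * m * H u - r * be - (m - be) * (r + H u) - (m - be) * rateP p u)).
  by ring.
by rewrite (ratePE st); ring.
Qed.

Let lot_before t : 0 <= t -> t <= ts -> lot t <= lot ts.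
Proof.
move=> t0; rewrite le_eqVlt => /predU1P[->//|tt].
have ttau := lt_trans tt tst.
have Fc u : t <= u <= ts -> cdf FP u = cdf FP t.
  move=> /andP[tu ut]; have u0 := le_trans t0 tu.
  have F0 v : 0 <= v -> v <= ts -> cdf FP v = 0.
    move=> v0; rewrite le_eqVlt hazard_cdf // => /predU1P[->|->] //.
    by rewrite ltxx tst tail_id subrr mulr0.
  by rewrite !F0 // (le_trans tu).
have := uA_diff st t0 (ltW tt) Fc (acc1 (ltW ts0) tst).
rewrite (uA_acc1 st FP (ltW ts0)) ?(uA_acc1 st FP t0) ?acc1 ?(ltW ts0) //.
rewrite -/(lot ts) -/(lot t) subrr !mulr0 addr0 => e.
rewrite -subr_ge0 e; apply: mulr_ge0; first by rewrite subr_ge0 cdf_le1.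
apply: Iint_ge0.
  have Hb := bm_sub t0 (lexx ts) (hazard_bm st ts).
  have db := bm_sub t0 (lexx ts) (disc_bm st ts).
  have ab := bm_sub t0 (lexx ts) (acc_bm a ts).
  apply/bm_lint/bmB; apply: bmM => //.
    by apply: bmB; [apply: bmM => //|]; exact: bm_cst.
    by apply: bmM => //; exact: bm_cst.
  by apply: bmM => //; apply: bmB => //; exact: bm_cst.
move=> u /andP[tu ut]; have u0 := le_trans t0 (ltW tu).
rewrite acc1 ?(lt_trans ut) // subrr !mulr0 subr0.
apply: mulr_ge0; first exact: ltW (disc_gt0 st u).
apply: le_trans (ltW (gainA0_gt0 st)) (gainA_ge st u0 _).
exact: ltW (lt_trans ut tst).
Qed.

(** A fake at or after [tau] earns the flow up to [tau], which is bounded by continuity: before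
    [tau] the flow is at most the constant [lot]. *)
Let flow_tau : uA_flow p a FP tau <= lot ts.
Proof.
have pf := prim_sub (ltW ts0) (lexx tau) (uA_flow_prim st a FP tau).
apply: (prim_le_left pf tst) => u tu ut.
rewrite -(lot_after tu ut) /lot lerDl mulr_ge0 ?(ltW mb0) //.
exact: waiting_ge0 st FP u.
Qed.

Let uA_le_start (t : \bar R) : (0 <= t)%E -> uA' t <= lot ts.
Proof.
case: t => [t||] //.
  rewrite lee_fin => t0; have [ltau|le] := ltP t tau; last first.
    by rewrite (uA_late st a tau0 FP1 le).
  rewrite (uA_acc1 st) ?acc1 //; have [tt|tt] := leP t ts;
    first exact: lot_before.
  by rewrite -/(lot t) lot_after // ltW.
move=> _; apply: (uA_pinfty st); exists (Num.bound tau) => n Nn.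
rewrite (uA_late st a tau0 FP1) //; apply: ltW.
by apply: (lt_le_trans (archi_boundP (ltW tau0))); rewrite ler_nat.
Qed.

Lemma AIC_exists (t t' : \bar R) : (0 <= t)%E -> (0 <= t')%E ->
  active FA t -> uA' t' <= uA' t.
Proof.
case: t => [t||] // t0 t'0 At; last by have := never_le0 (ltW tau0) FA1 At.
rewrite lee_fin in t0.
have [tt ttau] : ts <= t /\ t < tau.
  case: At => [d0|]; last by rewrite atomA0 ltxx.
  have [lt|le] := ltP t ts; first by move: d0; rewrite fakes_out ?ltxx //; left.
  have [lt2|le2] := ltP t tau; first by [].
  by move: d0; rewrite fakes_out ?ltxx //; right.
by rewrite [leRHS](uA_acc1 st FP t0) ?acc1 // -/(lot t) lot_after // uA_le_start.
Qed.

Lemma equilibrium_exists : equilibrium p sigma accept_real stop_timing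
  fake_timing.
Proof.
split; [exact: AIC_exists|exact: pic_exists|exact: picT_exists].
Qed.

Lemma stop_timing_cdf0 : cdf stop_timing 0 = 0.
Proof. by rewrite hazard_cdf // ts0. Qed.

End Existence.

(** * Comparison with naive search *)

Section Naive.
Context {R : realType} (p : primitives R) (tau : R) (st : setting p tau).
Local Notation leb := (@lebesgue_measure R).
Local Notation th := (theta p).
Local Notation m := (mu p).
Local Notation r := (rho p).
Local Notation H := (hazard p).

Let tau0 := tau_gt0 st.
Let thm0 : 0 < th - m. Proof. by rewrite subr_gt0 (mu_lt_theta st). Qed.

Definition search_gain (s t : R) : R :=
  \int[leb]_(u in `[s, t]) (disc p u * rateA p u).

Lemma sigmabarE : sigmabar p tau = 1 - tail (rateA p) 0 tau.
Proof. by []. Qed.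

Lemma uN_uFB sigma : uN p sigma tau =
  uFB p tau - expR (- r * tau) * (1 - G p tau) * sigma * (th - m).
Proof. by rewrite /uN /uFB; ring. Qed.

Lemma search_gain_lint s t : 0 <= s -> itv_integrable s t (fun u =>
  disc p u * rateA p u).
Proof.
move=> sge0; apply/bm_lint/(bm_sub sge0 (lexx t)).
by apply: bmM; [exact: (disc_bm st)|exact: (rateA_bm st)].
Qed.

Lemma uN_gain sigma :
  uN p sigma tau = th + (th - m) * (search_gain 0 tau - disc p tau * sigma).
Proof.
have t0 := ltW tau0; have Hb := hazard_bm st tau; have db := disc_bm st tau.
have hdl : itv_integrable 0 tau (fun u => H u * disc p u) by exact/bm_lint/bmM.
have dl := bm_lint db.
have e1 : \int[leb]_(x in `[0, tau])
    (expR (- r * x) * g p x * (m + (1 - m) * th)) =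
    (m + (1 - m) * th) * \int[leb]_(u in `[0, tau]) (H u * disc p u).
  rewrite -IintZ //; apply: eq_Iint => u _; rewrite (hazardE st) /disc; ring.
have e2 : disc p tau = 1 - (r * \int[leb]_(u in `[0, tau]) disc p u
    + \int[leb]_(u in `[0, tau]) (H u * disc p u)).
  have [_ /(_ 0 tau (lexx 0) t0 (lexx tau))] := prim_disc st tau.
  rewrite (disc0 st) => e; rewrite -[LHS](subrK 1) e addrC; congr (_ + _).
  rewrite -IintZ // -IintD //; last exact: lintZ.
  rewrite -mulN1r -IintZ; last by apply: lintD => //; exact: lintZ.
  by apply: eq_Iint => u _; ring.
have e3 : (th - m) * search_gain 0 tau =
    m * (1 - th) * \int[leb]_(u in `[0, tau]) (H u * disc p u)
    - r * th * \int[leb]_(u in `[0, tau]) disc p u.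
  rewrite -IintZ; last exact: search_gain_lint.
  rewrite -mulNr -!IintZ // -IintD; [|exact: lintZ|exact: lintZ].
  apply: eq_Iint => u _.
  rewrite (_ : (th - m) * (disc p u * rateA p u) = disc p u * ((th - m) *
    rateA p u)).
    by rewrite (rateAE st); ring.
  by ring.
rewrite mulrBr e3 /uN e1.
have -> : expR (- r * tau) * (1 - G p tau) * ((1 - sigma) * th + sigma * m) =
  th * disc p tau - (th - m) * (disc p tau * sigma) by rewrite /disc; ring.
set X := (th - m) * (disc p tau * sigma).
by rewrite {1}e2; ring.
Qed.

Lemma search_gain_gt s : 0 <= s -> s < tau ->
  disc p tau * (1 - tail (rateA p) s tau) < search_gain s tau.
Proof.
move=> sge0 stau; pose A := \int[leb]_(u in `[s, tau]) rateA p u.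
have Al : itv_integrable s tau (rateA p) by exact/bm_lint/(bm_sub sge0 (lexx
  tau) (rateA_bm st tau)).
have A0 : 0 < A.
  apply: Iint_gt0 => // u /andP[su ut].
  exact: (rateA_gt0 st (le_trans sge0 (ltW su)) ut).
have h1 : disc p tau * A <= search_gain s tau.
  rewrite -IintZ //; apply: Iint_le; [exact: lintZ|exact: search_gain_lint|].
  move=> u /andP[su ut]; apply: ler_wpM2r; last exact: (disc_nonincr st).
  exact: (rateA_ge0 st (le_trans sge0 su) ut).
apply: lt_le_trans h1; rewrite ltr_pM2l ?(disc_gt0 st) //.
have An : - A != 0 by rewrite oppr_eq0 gt_eqF.
by have := expR_gt1Dx An; rewrite /tail -/A; lra.
Qed.

Lemma start_exists sigma : 0 < sigma < 1 -> sigma < sigmabar p tau ->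
  exists ts, [/\ 0 < ts, ts < tau & tail (rateA p) ts tau = 1 - sigma].
Proof.
move=> /andP[sg0 sg1]; rewrite sigmabarE => sb.
have t0 := ltW tau0; have rb := rateA_bm st tau.
(* The integral of [rateA] that must lie between [ts] and [tau]. That [sigma] is below [sigmabar]
   says that the integral over all of [[0, tau]] exceeds [v], which puts [ts] above 0. *)
pose v := - ln (1 - sigma).
have ev : expR (- v) = 1 - sigma by rewrite opprK lnK // posrE subr_gt0.
pose K t := \int[leb]_(u in `[0, t]) rateA p u.
have vK : v < K tau.
  have : expR (- K tau) < expR (- v) by rewrite ev; move: sb;
    rewrite /tail -/(K tau); lra.
  by rewrite ltr_expR ltrN2.
have v0 : 0 < v.
  have : expR (- v) < expR 0 by rewrite ev expR0; lra.
  by rewrite ltr_expR; lra.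
have K0 : K 0 = 0 by rewrite /K Iint_set1.
have [|//||ts [ts0 tst Kts]] := prim_IVT (v := K tau - v) (prim_int rb).
- exact: t0.
- by rewrite Iint_set1; lra.
- by rewrite -/(K tau); lra.
rewrite -/(K ts) in Kts.
exists ts; split.
- rewrite lt_def ts0 andbT; apply/eqP => e; move: Kts; rewrite e K0; lra.
- rewrite lt_def tst andbT; apply/eqP => e; move: Kts; rewrite e; lra.
rewrite /tail -ev; congr expR; congr (- _).
have := lint_split ts0 tst (bm_lint rb); rewrite -/(K tau) -/(K ts); lra.
Qed.

Section Bounds.
Context (sigma : R) (hs : 0 < sigma < 1).
Context (a : acceptance R) (FP FA : timing R).
Context (eq : equilibrium p sigma a FP FA).

Let search_or_not : cdf FP 0 = 1 \/ cdf FP 0 < 1.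
Proof. by have := cdf_le1 FP 0; rewrite le_eqVlt => /predU1P[]; [left|right]. Qed.

(** By [uN_gain] the hypothesis says that naive search beats [theta], the payoff without search.
    With search, [search_gain_gt] on [[ts, tau]] gives the comparison. *)
Lemma payoff_lt_naive : disc p tau * sigma < search_gain 0 tau ->
  payoffP p sigma a FP FA < uN p sigma tau.
Proof.
move=> gain; rewrite uN_gain; case: search_or_not => [F0|F0].
  by rewrite (no_search_payoff st hs eq F0) ltrDl mulr_gt0 // subr_gt0.
have [ts [ts0 tst tsE -> _]] := search_characterization st hs eq F0.
rewrite ltrD2l ltr_pM2l //.
have := search_gain_gt ts0 tst; rewrite tsE.
rewrite /search_gain (lint_split ts0 (ltW tst) (search_gain_lint tau (lexx
  0))); lra.
Qed.

Lemma no_search_above : sigmabar p tau < sigma -> cdf FP 0 = 1.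
Proof.
rewrite sigmabarE => sb; case: search_or_not => // F0; exfalso.
have [ts [ts0 tst tsE _ _]] := search_characterization st hs eq F0.
have : tail (rateA p) 0 tau <= tail (rateA p) ts tau.
  rewrite /tail ler_expR lerN2.
  rewrite [leRHS](lint_split ts0 (ltW tst) (bm_lint (rateA_bm st tau))) lerDr.
  apply: Iint_ge0; first exact/bm_lint/(rateA_bm st).
  move=> u /andP[/ltW u0 ut]; apply: (rateA_ge0 st) => //.
  exact: ltW (lt_trans ut tst).
rewrite [leRHS]tsE leNgt => /negP; apply.
by rewrite ltrBlDr addrC -ltrBlDr.
Qed.

End Bounds.

Lemma gain_below_sigmabar sigma : sigma <= sigmabar p tau ->
  disc p tau * sigma < search_gain 0 tau.
Proof.
move=> sb; apply: le_lt_trans (search_gain_gt (lexx 0) tau0).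
by rewrite -sigmabarE ler_wpM2l // ltW // (disc_gt0 st).
Qed.

End Naive.

Theorem proposition4 (R : realType) (p : primitives R) (tauP : R)
  (htheta : 0 < theta p < 1)
  (hbeta : 0 < beta p < theta p)
  (hmu : beta p < mu p < theta p)
  (hrho : 0 < rho p)
  (hG : news_distribution p)
  (A1 : phiP p < hazard p 0 /\ lim (hazard p t @[t --> +oo]) < phiP p)
  (A2 : phiA p < phiP p)
  (htauP : is_tauP p tauP) :
  (forall sigma : R, 0 < sigma < 1 ->
     uN p sigma tauP =
       uFB p tauP - expR (- rho p * tauP) * (1 - G p tauP)
                    * sigma * (theta p - mu p)) /\
  (forall sigma : R, 0 < sigma < 1 -> sigma < sigmabar p tauP ->
     (exists (a : acceptance R) (FP FA : timing R),
        [/\ equilibrium p sigma a FP FA,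
            beneficial p sigma a FP FA,
            payoffP p sigma a FP FA < uN p sigma tauP &
            forall (a' : acceptance R) (FP' FA' : timing R),
              equilibrium p sigma a' FP' FA' ->
              same_profile a FP FA a' FP' FA' \/
              (no_search FP' /\ ~ beneficial p sigma a' FP' FA')]) /\
     (forall (a : acceptance R) (FP FA : timing R),
        equilibrium p sigma a FP FA ->
        payoffP p sigma a FP FA < uN p sigma tauP)) /\
  (exists sigmaN : R, sigmabar p tauP < sigmaN <= 1 /\
     forall sigma : R, 0 < sigma < 1 -> sigmabar p tauP < sigma < sigmaN ->
     forall (a : acceptance R) (FP FA : timing R),
       equilibrium p sigma a FP FA ->
       ~ beneficial p sigma a FP FA /\
       payoffP p sigma a FP FA < uN p sigma tauP).
Proof.
have st : setting p tauP by split.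
split; first by move=> sigma _; exact: uN_uFB.
split.
  move=> sigma hs sb.
  have below a FP FA : equilibrium p sigma a FP FA ->
      payoffP p sigma a FP FA < uN p sigma tauP.
    by move=> eq; apply: (payoff_lt_naive st hs eq);
      exact/(gain_below_sigmabar st)/ltW.
  split => //.
  have [ts [ts0 tst tsE]] := start_exists st hs sb.
  have eq := equilibrium_exists st hs ts0 tst tsE.
  exists (accept_real st), (stop_timing st ts0 tst), (fake_timing st hs ts0
    tst tsE).
  have F0 : cdf (stop_timing st ts0 tst) 0 < 1 by rewrite stop_timing_cdf0 ltr01.
  have uniq a FP FA : equilibrium p sigma a FP FA -> cdf FP 0 < 1 ->
      payoffP p sigma a FP FA =
        theta p + (theta p - mu p) * search_gain p 0 ts /\
      forall t, 0 <= t -> [/\ a t = (if 0 < g p t then 1 else 0),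
        cdf FP t = stop_cdf p tauP ts t & cdf FA t = fake_cdf p tauP sigma ts t].
    move=> eq' F0'.
    have [ts' [ts0' tst' tsE' Ep Hp]] := search_characterization st hs eq' F0'.
    have e : ts' = ts.
      exact: (tail_inj st ts0' (ltW tst') (ltW ts0) (ltW tst) (etrans tsE'
        (esym tsE))).
    by rewrite e in Ep Hp; split => //; exact: Hp.
  have [Ep Hp] := uniq _ _ _ eq F0.
  split => //; last 2 first.
  - exact: below.
  - move=> a' FP' FA' eq'.
    (* Stopping surely at 0 earns exactly [theta]; any other equilibrium has the same start
       [ts > 0], hence the same profile. *)
    have := cdf_le1 FP' 0; rewrite le_eqVlt => /predU1P[F1|F1].
      right; split => //; rewrite /beneficial (no_search_payoff st hs eq' F1).
      by rewrite ltxx.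
    left => t t0; have [-> -> ->] := Hp t t0.
    by have [_ /(_ t t0)[-> -> ->]] := uniq _ _ _ eq' F1.
  rewrite /beneficial Ep ltrDl mulr_gt0 ?subr_gt0 ?(mu_lt_theta st) //.
  apply: Iint_gt0 => //; first exact: (search_gain_lint st).
  move=> u /andP[/ltW u0 ut]; rewrite mulr_gt0 ?(disc_gt0 st) //.
  exact: (rateA_gt0 st u0 (lt_trans ut tst)).
have d0 := disc_gt0 st tauP.
(* The quotient is the [sigma] at which naive search earns exactly [theta]. It exceeds [sigmabar] by
   the strict inequality of [gain_below_sigmabar], and [sigmabar < 1] because [tail] is positive. *)
exists (Num.min 1 (search_gain p 0 tauP / disc p tauP)); split.
  rewrite ge_min lexx andbT lt_min sigmabarE gtrBl tail_gt0 /=.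
  rewrite ltr_pdivlMr // mulrC -sigmabarE.
  exact: (gain_below_sigmabar st (lexx _)).
move=> sigma hs /andP[sb sn] a FP FA eq.
have F1 := no_search_above st hs eq sb; split.
  by rewrite /beneficial (no_search_payoff st hs eq F1) ltxx.
apply: (payoff_lt_naive st hs eq).
by move: sn; rewrite lt_min => /andP[_]; rewrite ltr_pdivlMr // mulrC.
Qed.
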